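(* For each $\lambda>4$, there is a compact interval $K\subseteq\mathbb{R}$ such that $\dim_{\mathrm H}(K\cap\Sigma_\lambda^{[\ell]})>0$ for all $\ell\in\mathbb{N}$ and $$\lim_{\ell\to\infty}\dim_{\mathrm H}(K\cap\Sigma_\lambda^{[\ell]})=0,$$ where $\Sigma_\lambda^{[\ell]}$ is the spectrum of the $\ell$-fold sieved Fibonacci Hamiltonian with coupling constant $\lambda$.
   Context: Let $\mathbb{N}=\{1,2,3,\ldots\}$; $\dim_{\mathrm H}$ denotes Hausdorff dimension. The Fibonacci substitution $S$ acts on finite and one-sided infinite words over $\{0,1\}$ by concatenation from $0\mapsto 1$, $1\mapsto 10$. The words $w_k=S^k(1)$ satisfy that $w_k$ is a prefix of $w_{k'}$ for $k\le k'$, so they converge to a one-sided infinite word $w_\infty=10110101\cdots$ with $S(w_\infty)=w_\infty$. The Fibonacci subshift $\Omega\subseteq\{0,1\}^{\mathbb{Z}}$ is the set of all $\omega=\{\omega(n)\}_{n\in\mathbb{Z}}$ such that for any $n\in\mathbb{Z}$ and $m\in\mathbb{N}$ the string $\omega(n)\omega(n+1)\cdots\omega(n+m-1)$ appears in $w_\infty$. For $\lambda>0$, $\ell\in\mathbb{N}$, $\omega\in\Omega$, let $V_{\lambda,\omega}^{[\ell]}(n)=\lambda\,\omega(n/\ell)$ if $n\in\ell\mathbb{Z}$ and $V_{\lambda,\omega}^{[\ell]}(n)=0$ if $n\notin\ell\mathbb{Z}$. The sieved Fibonacci Hamiltonian is the operator $H_{\lambda,\omega}^{[\ell]}$ on $\ell^2(\mathbb{Z})$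 given by $[H_{\lambda,\omega}^{[\ell]}\psi](n)=\psi(n-1)+\psi(n+1)+V_{\lambda,\omega}^{[\ell]}(n)\psi(n)$. By minimality of the subshift, there is a compact set $\Sigma_\lambda^{[\ell]}\subseteq\mathbb{R}$ such that $\Sigma_\lambda^{[\ell]}=\operatorname{spec}H_{\lambda,\omega}^{[\ell]}$ for every $\omega\in\Omega$. *)

(* Defs.v *)
From HB Require Import structures.
From mathcomp Require Import all_boot all_order all_algebra.
From mathcomp Require Import all_classical all_reals all_analysis.
From mathcomp Require Import complex.
Set Implicit Arguments.
Unset Strict Implicit.
Unset Printing Implicit Defensive.
Import Order.TTheory GRing.Theory Num.Theory.
Import numFieldNormedType.Exports.
Local Open Scope classical_set_scope.
Local Open Scope ring_scope.
Local Open Scope complex_scope.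

(* The letters 0 and 1 are encoded as [false] and [true]. *)

Definition fib_letter (b : bool) : seq bool :=
  if b then [:: true; false] else [:: true].

Definition fib_subst (u : seq bool) : seq bool := flatten (map fib_letter u).

Definition fib_word (k : nat) : seq bool := iter k fib_subst [:: true].

(* The limit of the words [fib_word k]: each is a prefix of the next one and
   [n < size (fib_word n)], so letter [n] of the limit is letter [n] of
   [fib_word n]. *)
Definition fib_infinite_word (n : nat) : bool := nth false (fib_word n) n.

Definition fib_subshift : set (int -> bool) :=
  [set w | forall (n : int) (m : nat), (0 < m)%N ->
     exists j : nat, forall i : nat, (i < m)%N ->
       w (n + i%:Z) = fib_infinite_word (j + i)%N].

Section SquareSummable.
Context {R : realType}.
Implicit Types (psi phi : int -> R[i]).

Definition abs_sq (z : R[i]) : R := complex.Re z ^+ 2 + complex.Im z ^+ 2.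

Definition l2sq psi : \bar R := \esum_(n in [set: int]) (abs_sq (psi n))%:E.

Definition l2 : set (int -> R[i]) := [set psi | (l2sq psi < +oo)%E].

Definition l2norm psi : R := Num.sqrt (fine (l2sq psi)).

(* An operator on l2 is represented by a map on all functions [int -> R[i]];
   only its values on [l2] are relevant below. *)
Definition bounded_operator (T : (int -> R[i]) -> (int -> R[i])) : Prop :=
  [/\ forall psi, l2 psi -> l2 (T psi),
      forall (a : R[i]) psi phi, l2 psi -> l2 phi ->
        T (a *: psi + phi) = a *: T psi + T phi
    & exists M : R, forall psi, l2 psi -> l2norm (T psi) <= M * l2norm psi].

Definition resolvent_set (T : (int -> R[i]) -> (int -> R[i])) : set R[i] :=
  [set z | exists2 B, bounded_operator B &
     forall psi, l2 psi ->
       B (T psi - z *: psi) = psi /\ T (B psi) - z *: B psi = psi].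

Definition spectrum (T : (int -> R[i]) -> (int -> R[i])) : set R[i] :=
  ~` resolvent_set T.

End SquareSummable.

Section SievedFibonacci.
Context {R : realType}.

Definition sieved_potential (lam : R) (l : nat) (w : int -> bool) (n : int) : R :=
  if (l %| n)%Z then lam * (w (n %/ l)%Z)%:R else 0.

Definition sieved_hamiltonian (lam : R) (l : nat) (w : int -> bool)
    (psi : int -> R[i]) : int -> R[i] :=
  fun n => psi (n - 1) + psi (n + 1) + (sieved_potential lam l w n)%:C * psi n.

(* The operator is self-adjoint, so its spectrum consists of real numbers;
   here it is regarded as a set of elements of [R]. *)
Definition sieved_spectrum (lam : R) (l : nat) (w : int -> bool) : set R :=
  [set x : R | spectrum (sieved_hamiltonian lam l w) x%:C].

End SievedFibonacci.

Section HausdorffDimension.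
Context {R : realType}.
Local Open Scope ereal_scope.

(* [diameter set0 = -oo]. *)
Definition diameter (U : set R) : \bar R :=
  ereal_sup [set (`|p.1 - p.2|%R)%:E | p in U `*` U].

(* The empty set has weight 0 for every [s]; a one-point set has weight 1 for
   [s = 0] and weight 0 for [s > 0]. *)
Definition hausdorff_weight (s : R) (U : set R) : \bar R :=
  if U == set0 then 0 else (diameter U `^ s).

Definition hausdorff_premeasure (s delta : R) (A : set R) : \bar R :=
  ereal_inf [set \sum_(0 <= i <oo) hausdorff_weight s (U i) | U in
    [set U : nat -> set R |
       A `<=` \bigcup_i U i /\ forall i, diameter (U i) <= delta%:E]].

Definition hausdorff_measure (s : R) (A : set R) : \bar R :=
  ereal_sup [set hausdorff_premeasure s delta A | delta in [set d | (0 < d)%R]].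

Definition hausdorff_dim (A : set R) : \bar R :=
  ereal_inf [set s%:E | s in [set s | (0 <= s)%R /\ hausdorff_measure s A = 0]].

End HausdorffDimension.

(* Main.v *)
Require Import Defs.
From HB Require Import structures.
From mathcomp Require Import all_boot all_order all_algebra.
From mathcomp Require Import all_classical all_reals all_analysis.
From mathcomp Require Import complex ring lra zify.
Set Implicit Arguments.
Unset Strict Implicit.
Unset Printing Implicit Defensive.
Import Order.TTheory GRing.Theory Num.Theory.
Import numFieldNormedType.Exports.
Local Open Scope classical_set_scope.
Local Open Scope ring_scope.

(* Let [x_k] be the half-trace of the transfer matrix over the sieved word [w_k]. It
   satisfies [x_(k+1) = 2 x_k x_(k-1) - x_(k-2)] and the Fricke invariant is
   [W^2], where [W = lam U_(l-1)(E/2) / 2]. We take [K = [lam - 2, lam + 2]], which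
   for [lam > 4] lies in [E > 2], where [W >= lam / 2 > 2] and [W] grows exponentially
   in [l]; hence a value [x_k] between two values in [[-1, 1]] has modulus > 1.

   An energy with [|x_k| <= 1] for infinitely many [k] is in the spectrum, by cutting
   off Floquet solutions over an occurrence of [w_k w_k]. Conversely an energy whose
   trace orbit escapes is in the resolvent set: nearby energies escape too, so the
   periodic approximants have a uniform spectral gap around it.

   Lower bound: intervals on which every second trace runs through [[-1, 1]] have two
   such subintervals two steps later. The resulting Cantor set lies in the spectrum,
   and its coding by binary sequences is quantitatively separated.

   Upper bound: for large [l] two energies of the spectrum whose orbits have the same
   code (smallness and sign of the traces) up to time [N] are at distance at most
   [C r^(-N)] with [r^2 <= W], and there are [4^(N+1)] codes. *)

(** * Fibonacci words *)

(** The zeros of U_(l-1)(E/2) lie in (-2, 2), where W has no lower bound; this is why the energies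
    are taken above 2. The radius 2 of K comes from the half-trace over the letter 1: at E = lam -+
    2 it equals -+U_(l-1) - U_(l-2), so it runs through [-1, 1] on K. The obstacle to comparing two
    energies is that the invariant surface moves with the energy, and W is exponentially large. What
    helps is that the relative Lipschitz rate of W is only linear in l, hence small compared with W
    itself: the drift [|W - W'|] is then controlled by the distance of the half-traces over the
    letter 1. All expansion estimates are finite differences that carry this drift as an error term,
    and no derivative of a trace appears. In the upper bound a unit of time multiplies the number of
    codes by 4 whatever l is, while the expansion rate r can be prescribed by taking l large; the
    exponent log 4 / log r thus becomes arbitrarily small. *)

Lemma fib_subst_cat u v : fib_subst (u ++ v) = fib_subst u ++ fib_subst v.
Proof. by rewrite /fib_subst map_cat flatten_cat. Qed.

Lemma iter_fib_subst_cat k u v :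
  iter k fib_subst (u ++ v) = iter k fib_subst u ++ iter k fib_subst v.
Proof. by elim: k => //= k ->; rewrite fib_subst_cat. Qed.

Lemma fib_wordSS k : fib_word k.+2 = fib_word k.+1 ++ fib_word k.
Proof. by rewrite /fib_word -(addn2 k) -(addn1 k) !iterD -iter_fib_subst_cat. Qed.

Lemma prefix_fib_wordS k : prefix (fib_word k) (fib_word k.+1).
Proof. by case: k => // k; rewrite fib_wordSS prefix_prefix. Qed.

Lemma prefix_fib_word k m : (k <= m)%N -> prefix (fib_word k) (fib_word m).
Proof.
elim: m => [|m IH]; first by rewrite leqn0 => /eqP ->; exact: prefix_refl.
rewrite leq_eqVlt => /orP[/eqP -> |]; first exact: prefix_refl.
by rewrite ltnS => /IH h; exact: prefix_trans h (prefix_fib_wordS m).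
Qed.

Lemma size_fib_word k : (k < size (fib_word k))%N.
Proof.
elim: k {-2}k (leqnn k) => [|n IH] [|[|k]] // hk.
rewrite fib_wordSS size_cat.
have h1 := IH k.+1 hk; have h0 := IH k (ltnW hk); lia.
Qed.

Lemma fib_infinite_wordE m n : (n < size (fib_word m))%N ->
  fib_infinite_word n = nth false (fib_word m) n.
Proof.
move=> hn; rewrite /fib_infinite_word.
have [h|h] := leqP n m.
  have /prefixP[s ->] := prefix_fib_word h.
  by rewrite nth_cat size_fib_word.
have /prefixP[s ->] := prefix_fib_word (ltnW h).
by rewrite nth_cat hn.
Qed.

Lemma leq_size_fib_word k m : (k <= m)%N ->
  (size (fib_word k) <= size (fib_word m))%N.
Proof. by move=> /prefix_fib_word; exact: size_prefix. Qed.

(** Since w_(n+2) ends in w_n, the endings alternate with the parity of the index; the disjunction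
    is the parity of n - k. *)
Lemma suffix_fib_word k n : (k < n)%N ->
  suffix (fib_word k.+1) (fib_word n) || suffix (fib_word k) (fib_word n).
Proof.
elim: n {-2}n (leqnn n) => [|m IH] [|[|n]] //.
  by move=> _; rewrite ltnS leqn0 => /eqP ->.
rewrite ltnS => hn; rewrite ltnS leq_eqVlt => /orP[/eqP ->|].
  by rewrite suffix_refl.
rewrite ltnS leq_eqVlt => /orP[/eqP ->|hk].
  by rewrite [X in _ || suffix _ X]fib_wordSS suffix_suffix orbT.
have hs : suffix (fib_word n) (fib_word n.+2) by rewrite fib_wordSS suffix_suffix.
by case/orP: (IH n (ltnW hn) hk) => h; rewrite (suffix_trans h hs) ?orbT.
Qed.

(** Uniform recurrence. In w_(m+2) = w_(m+1) w_m a factor lies in one part, or it straddles the cut;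
    then either its right piece contains the prefix w_k of w_m, or its left piece is longer than
    w_(k+1) and contains one of the suffixes of [suffix_fib_word]. *)
Lemma infix_fib_word k m u : infix u (fib_word m) ->
  (2 * size (fib_word k.+1) <= size u)%N -> infix (fib_word k) u.
Proof.
have sk := size_fib_word k.+1.
elim: m {-2}m (leqnn m) u => [|n IH] m hm u hu hL.
  exfalso; have := size_infix hu.
  move: hm; rewrite leqn0 => /eqP ->; rewrite [size (fib_word 0)]/=; lia.
have [hmk|hmk] := leqP m k.+1.
  exfalso; have h := leq_trans (leq_trans hL (size_infix hu)) (leq_size_fib_word hmk).
  lia.
case: m hm hmk hu => [|[|m]] //.
rewrite ltnS => hm hmk /infixP[p [s]]; rewrite fib_wordSS.
set a := fib_word m.+1; set b := fib_word m => e.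
have km : (k <= m)%N by [].
have esz : (size a + size b = size p + (size u + size s))%N.
  by rewrite -!size_cat e.
have [hp|hp] := leqP (size a) (size p).
  apply: (IH m _ u) => //; first lia.
  apply/infixP; exists (drop (size a) p), s.
  have := congr1 (drop (size a)) e.
  rewrite -/b (@drop_size_cat _ _ a b) // drop_cat; case: ltnP => h -> //.
  have -> : size a = size p by lia.
  by rewrite subnn drop0 drop_size.
have [hq|hq] := leqP (size p + size u) (size a).
  apply: (IH m.+1 _ u) => //.
  apply/infixP; exists p, (take (size a - (size p + size u)) s).
  have := congr1 (take (size a)) e.
  rewrite -/a (@take_size_cat _ _ a b) // => {1}->.
  rewrite take_cat ltnNge (ltnW hp) /=; congr (_ ++ _).
  rewrite take_cat ltnNge leq_subRL ?(ltnW hp) // hq /=.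
  by rewrite subnDA.
have eu : u = drop (size p) a ++ take (size p + size u - size a) b.
  have := congr1 (fun x => take (size u) (drop (size p) x)) e.
  rewrite (@drop_size_cat _ _ p) // take_size_cat // => eu; rewrite -[LHS]eu.
  rewrite drop_cat hp take_cat size_drop ltnNge.
  have -> /= : (size a - size p <= size u)%N by lia.
  by rewrite subnBA ?(ltnW hp) // addnC.
rewrite eu.
have [h2|h2] := leqP (size (fib_word k)) (size p + size u - size a).
  apply: infix_trans _ (suffix_infix _ _).
  apply: prefixW.
  have /prefixP[t et] := prefix_fib_word km.
  rewrite /b et take_cat; case: ltnP => h; first lia.
  exact: prefix_prefix.
apply: infix_trans _ (prefix_infix _ _).
have skk : (size (fib_word k) <= size (fib_word k.+1))%N by exact: leq_size_fib_word.
have key v : suffix v a -> (size v <= size (fib_word k.+1))%N ->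
    suffix v (drop (size p) a).
  case/suffixP=> t et hv; rewrite et drop_cat.
  have ea : size a = (size t + size v)%N by rewrite et size_cat.
  case: ltnP => h; first exact: suffix_suffix.
  have -> : (size p - size t = 0)%N by lia.
  by rewrite drop0 suffix_refl.
have /orP[h|h] : suffix (fib_word k.+1) a || suffix (fib_word k) a.
  by apply: suffix_fib_word; lia.
  apply: infix_trans (suffixW (key _ h _)) => //.
  exact/prefixW/prefix_fib_wordS.
exact/suffixW/key.
Qed.

(** w_3 = 10110 contains 11, whose image under S^k is the square. *)
Lemma infix_square_fib_word k :
  infix (fib_word k ++ fib_word k) (fib_word k.+3).
Proof.
have -> : fib_word k.+3 = iter k fib_subst ([:: true; false] ++ ([:: true] ++ [:: true]) ++ [:: false]).
  by rewrite /fib_word -addn3 iterD.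
rewrite !iter_fib_subst_cat; exact: infix_infix.
Qed.

(** The offset j serves all large m, so the word can later be chosen as long as needed. *)
Lemma fib_subshift_window (w : int -> bool) (n : int) (L : nat) :
  fib_subshift w -> (0 < L)%N ->
  exists j : nat, forall m, (j + L <= m)%N -> forall i : nat, (i < L)%N ->
    w (n + i%:Z) = nth false (fib_word m) (j + i).
Proof.
move=> hw /(hw n) [j hj]; exists j => m hm i hi.
rewrite hj //; apply: fib_infinite_wordE.
have := size_fib_word m; lia.
Qed.

Lemma fib_subshift_square (w : int -> bool) (k : nat) : fib_subshift w ->
  exists n : int, forall i, (i < size (fib_word k ++ fib_word k))%N ->
    w (n + i%:Z) = nth false (fib_word k ++ fib_word k) i.
Proof.
(* By recurrence a window of this length contains w_(k+3), hence the square of w_k. *)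
move=> hw; set L := (2 * size (fib_word k.+4))%N.
have L0 : (0 < L)%N by rewrite /L; have := size_fib_word k.+4; lia.
have [j hj] := fib_subshift_window 0 hw L0.
set m := (j + L)%N; have szm := size_fib_word m.
pose u := take L (drop j (fib_word m)).
have su : size u = L by rewrite /u size_take size_drop; case: ltnP; lia.
have iu : infix u (fib_word m).
  apply/infixP; exists (take j (fib_word m)), (drop L (drop j (fib_word m))).
  by rewrite cat_take_drop cat_take_drop.
have : infix (fib_word k ++ fib_word k) u.
  apply: infix_trans (infix_square_fib_word k) _.
  by apply: infix_fib_word iu _; rewrite su.
case/infixP=> p [s e]; exists (size p)%:Z => i hi.
have hpi : (size p + i < L)%N.
  by rewrite -su e !size_cat ltn_add2l ltn_addr // -size_cat.
rewrite -PoszD -[_%:Z]add0r (hj m) // -nth_drop -(nth_take _ hpi) -/u e.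
by rewrite (nth_cat _ p) ltnNge leq_addr /= addKn (nth_cat _ (_ ++ _)) hi.
Qed.

(** * Transfer matrices and the trace map *)

Section TransferMatrices.
Context {R : comNzRingType}.
Implicit Types (E lam v : R) (u : seq bool) (th : nat -> R).

(** Entries as record fields turn every matrix identity below into a goal for [ring]. *)
Record mat2 := Mat2 { m11 : R; m12 : R; m21 : R; m22 : R }.

Definition mul2 (A B : mat2) : mat2 :=
  Mat2 (m11 A * m11 B + m12 A * m21 B) (m11 A * m12 B + m12 A * m22 B)
       (m21 A * m11 B + m22 A * m21 B) (m21 A * m12 B + m22 A * m22 B).

Definition id2 : mat2 := Mat2 1 0 0 1.

Definition det2 (A : mat2) : R := m11 A * m22 A - m12 A * m21 A.

Definition tr2 (A : mat2) : R := m11 A + m22 A.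

Definition act2 (A : mat2) (p : R * R) : R * R :=
  (m11 A * p.1 + m12 A * p.2, m21 A * p.1 + m22 A * p.2).

Lemma mul2A A B C : mul2 A (mul2 B C) = mul2 (mul2 A B) C.
Proof. by rewrite /mul2 /=; congr Mat2; ring. Qed.

Lemma mul2id A : mul2 A id2 = A.
Proof. by case: A => a b c d; rewrite /mul2 /=; congr Mat2; ring. Qed.

Lemma det2M A B : det2 (mul2 A B) = det2 A * det2 B.
Proof. by rewrite /det2 /mul2 /=; ring. Qed.

Lemma act2M A B p : act2 (mul2 A B) p = act2 A (act2 B p).
Proof. by rewrite /act2 /mul2 /=; congr pair; ring. Qed.

(* [cheb E n] is the Chebyshev polynomial of the second kind [U_{n-1}(E/2)]. *)
Fixpoint cheb E (n : nat) : R :=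
  match n with
  | 0 => 0
  | m.+1 => match m with 0 => 1 | k.+1 => E * cheb E m - cheb E k end
  end.

Arguments cheb : simpl never.

Lemma chebSS E n : cheb E n.+2 = E * cheb E n.+1 - cheb E n.
Proof. by []. Qed.

(** The determinant of a power of [step E 0], with the recursion substituted. *)
Lemma cheb_norm E n :
  cheb E n.+1 ^+ 2 + cheb E n ^+ 2 - E * cheb E n.+1 * cheb E n = 1.
Proof.
elim: n => [|n IH]; first by rewrite /cheb; ring.
by rewrite chebSS -[RHS]IH; ring.
Qed.

Definition step E v : mat2 := Mat2 (E - v) (-1) 1 0.

Definition letter_transfer E lam (l : nat) (b : bool) : mat2 :=
  iter l.-1 (mul2 (step E 0)) (step E (lam * b%:R)).

Definition word_transfer E lam l u : mat2 :=
  foldl (fun M b => mul2 (letter_transfer E lam l b) M) id2 u.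

Lemma letter_transferE E lam n b :
  letter_transfer E lam n.+1 b =
    Mat2 (cheb E n.+1 * (E - lam * b%:R) - cheb E n) (- cheb E n.+1)
         (cheb E n.+1 - lam * b%:R * cheb E n) (- cheb E n).
Proof.
rewrite /letter_transfer /=; elim: n => [|n IH].
  by rewrite /step /cheb /=; congr Mat2; ring.
by rewrite iterS IH /mul2 /step /= chebSS; congr Mat2; ring.
Qed.

Lemma det2_letter_transfer E lam n b : det2 (letter_transfer E lam n.+1 b) = 1.
Proof. by rewrite letter_transferE /det2 /= -[RHS](cheb_norm E n); ring. Qed.

Lemma word_transfer_cat E lam l u1 u2 :
  word_transfer E lam l (u1 ++ u2) =
    mul2 (word_transfer E lam l u2) (word_transfer E lam l u1).
Proof.
elim/last_ind: u2 => [|u2 b IH].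
  by rewrite cats0 /word_transfer; case: (foldl _ _ _) => *; rewrite /mul2 /=; congr Mat2; ring.
by rewrite -rcons_cat /word_transfer !foldl_rcons -/(word_transfer _ _ _ _) IH mul2A.
Qed.

Lemma det2_word_transfer E lam n u : det2 (word_transfer E lam n.+1 u) = 1.
Proof.
elim/last_ind: u => [|u b IH]; first by rewrite /det2 /=; ring.
by rewrite /word_transfer foldl_rcons det2M IH det2_letter_transfer mulr1.
Qed.

Definition word_potential lam l u (i : nat) : R :=
  if (l %| i)%N then lam * (nth false u (i %/ l)%N)%:R else 0.

(** Index [i.+1] of [th] is site i of the word; [th 0] is the value at the site before it. *)
Lemma word_transferP E lam n u th :
  (forall i, (i < n.+1 * size u)%N ->
     th i.+2 = (E - word_potential lam n.+1 u i) * th i.+1 - th i) ->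
  act2 (word_transfer E lam n.+1 u) (th 1, th 0) =
    (th (n.+1 * size u).+1, th (n.+1 * size u)%N).
Proof.
elim/last_ind: u => [|u b IH] hth.
  by rewrite muln0 /act2 /=; congr pair; ring.
rewrite /word_transfer foldl_rcons act2M -/(word_transfer _ _ _ _) IH; last first.
  move=> i hi; rewrite hth; last by rewrite size_rcons; lia.
  rewrite /word_potential nth_rcons.
  by case: ifP => // /dvdnP[q e]; rewrite e mulnK // ifT //; nia.
rewrite size_rcons; set k := (n.+1 * size u)%N.
suff H j : (j <= n)%N -> act2 (iter j (mul2 (step E 0)) (step E (lam * b%:R)))
    (th k.+1, th k) = (th (k + j).+2, th (k + j).+1).
  rewrite /letter_transfer /= H //; congr (th _, th _); rewrite /k; lia.
elim: j => [|j IHj] hj.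
  rewrite addn0 hth; last by rewrite size_rcons /k; nia.
  rewrite /word_potential dvdn_mulr // mulKn // nth_rcons ltnn eqxx.
  by rewrite /act2 /=; congr pair; ring.
rewrite iterS act2M IHj; last by lia.
rewrite addnS [in RHS]hth; last by rewrite size_rcons /k; nia.
have -> : word_potential lam n.+1 (rcons u b) (k + j).+1 = 0.
  rewrite /word_potential -addnS dvdn_addr ?dvdn_mulr //.
  by rewrite gtnNdvd //; lia.
by rewrite /act2 /=; congr pair; ring.
Qed.

End TransferMatrices.

Arguments cheb : simpl never.

Section TraceMap.
Context {R : comNzRingType}.
Implicit Types (E lam c x : R).

(** The starting value 1 is the half-trace of A B^(-1) for the two letter matrices A and B: they
    differ in one site only, so A B^(-1) is conjugate to a unipotent matrix. *)
Definition trace_orbit c x (n : nat) : R :=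
  (iter n (fun t => (t.1.2, t.2, 2 * t.2 * t.1.2 - t.1.1)) (1, c, x)).1.1.

Lemma trace_orbit0 c x : trace_orbit c x 0 = 1. Proof. by []. Qed.
Lemma trace_orbit1 c x : trace_orbit c x 1 = c. Proof. by []. Qed.
Lemma trace_orbit2 c x : trace_orbit c x 2 = x. Proof. by []. Qed.

Lemma trace_orbitS c x n : trace_orbit c x n.+3 =
  2 * trace_orbit c x n.+2 * trace_orbit c x n.+1 - trace_orbit c x n.
Proof. by rewrite /trace_orbit !iterS. Qed.

End TraceMap.

(* Half-traces of the transfer matrices over the words 0 and 1; the half-trace
   over [fib_word k] is [sieved_trace E lam l k.+2]. *)
Section SievedTrace.
Context {R : fieldType}.
Implicit Types (E lam : R).

(** For l > 0 this is T_l(E/2), with T_l the Chebyshev polynomial of the first kind. *)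
Definition half_trace0 E l : R := E * cheb E l / 2 - cheb E l.-1.
Definition half_trace1 E lam l : R := half_trace0 E l - lam * cheb E l / 2.

Definition sieved_trace E lam l : nat -> R :=
  trace_orbit (half_trace0 E l) (half_trace1 E lam l).

Lemma tr2_fib_word E lam n k : (2 : R) != 0 ->
  tr2 (word_transfer E lam n.+1 (fib_word k)) = 2 * sieved_trace E lam n.+1 k.+2.
Proof.
move=> two; set M := fun k => word_transfer E lam n.+1 (fib_word k).
(* Cayley-Hamilton for B. It is applied to M_(j+2) = M_j (M_(j-1) M_j), with B = M_j. *)
have tr3 (A B : mat2) : det2 B = 1 ->
    tr2 (mul2 B (mul2 A B)) = tr2 (mul2 A B) * tr2 B - tr2 A.
  by move=> dB; rewrite -[tr2 A in RHS]mul1r -dB /tr2 /det2 /mul2 /=; ring.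
have MS j : M j.+2 = mul2 (M j) (M j.+1).
  by rewrite /M fib_wordSS word_transfer_cat.
have e0 : M 0%N = letter_transfer E lam n.+1 true.
  by rewrite /M /word_transfer /= mul2id.
have e1 : M 1%N = mul2 (letter_transfer E lam n.+1 false) (M 0%N).
  by rewrite /M /word_transfer /=.
have t0 : tr2 (letter_transfer E lam n.+1 false) = 2 * sieved_trace E lam n.+1 1.
  rewrite letter_transferE /tr2 /= /sieved_trace trace_orbit1 /half_trace0.
  by rewrite /= mulr0; field.
have dM j : det2 (M j) = 1 by exact: det2_word_transfer.
suff: tr2 (M k) = 2 * sieved_trace E lam n.+1 k.+2 /\
      tr2 (M k.+1) = 2 * sieved_trace E lam n.+1 k.+3 /\
      tr2 (M k.+2) = 2 * sieved_trace E lam n.+1 k.+4 by case.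
elim: k => [|k [IH1 [IH2 IH3]]].
  have h0 : tr2 (M 0%N) = 2 * sieved_trace E lam n.+1 2.
    rewrite e0 letter_transferE /tr2 /= /sieved_trace trace_orbit2.
    by rewrite /half_trace1 /half_trace0; field.
  have h1 : tr2 (M 1%N) = 2 * sieved_trace E lam n.+1 3.
    rewrite e1 e0 !letter_transferE /tr2 /mul2 /= /sieved_trace trace_orbitS.
    rewrite trace_orbit2 trace_orbit1 trace_orbit0 /half_trace1 /half_trace0 /=.
    have := cheb_norm E n; set a := cheb E n.+1; set b := cheb E n => h.
    rewrite -[X in _ = 2 * (_ - X)]h; field.
    exact: two.
  split=> //; split=> //.
  by rewrite MS e1 tr3 // -e1 t0 h1 h0 /sieved_trace [X in _ = 2 * X]trace_orbitS; ring.
split=> //; split=> //.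
by rewrite MS (MS k) tr3 // -MS IH3 IH2 IH1 /sieved_trace [X in _ = 2 * X]trace_orbitS; ring.
Qed.

End SievedTrace.

(** * Spectral gap of a symmetric matrix *)

Section SpectralGap.
Context {R : realType}.
Local Open Scope complex_scope.
Local Open Scope sesquilinear_scope.

Let sqnorm n (v : 'rV[R[i]]_n) : R[i] := (v *m v ^t*) 0 0.

Let sqnormE n (v : 'rV[R[i]]_n) : sqnorm v = \sum_i v 0 i * Num.conj (v 0 i).
Proof. by rewrite /sqnorm mxE; apply: eq_bigr => i _; rewrite !mxE. Qed.

Let sqnorm_unitary n (v : 'rV[R[i]]_n) (P : 'M[R[i]]_n) : P \is unitarymx ->
  sqnorm (v *m P) = sqnorm v.
Proof.
move=> /unitarymxP hP.
by rewrite /sqnorm trmx_mul map_mxM mulmxA -(mulmxA v) hP mulmx1.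
Qed.

Let conj_real (x : R) : Num.conj (x%:C) = x%:C.
Proof. exact: conjc_real. Qed.

Let sqnorm_real n (v : 'rV[R]_n) :
  sqnorm (map_mx (real_complex R) v) = (\sum_i v 0 i ^+ 2)%:C.
Proof.
rewrite sqnormE rmorph_sum; apply: eq_bigr => i _.
by rewrite mxE conj_real -rmorphM expr2.
Qed.

Lemma ReD (x y : R[i]) : complex.Re (x + y) = complex.Re x + complex.Re y.
Proof. by case: x; case: y. Qed.

Lemma ImD (x y : R[i]) : complex.Im (x + y) = complex.Im x + complex.Im y.
Proof. by case: x; case: y. Qed.

Lemma ReMr (x : R[i]) (a : R) : complex.Re (x * a%:C) = complex.Re x * a.
Proof. by case: x => b c /=; rewrite mulr0 subr0. Qed.

Lemma ImMr (x : R[i]) (a : R) : complex.Im (x * a%:C) = complex.Im x * a.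
Proof. by case: x => b c /=; rewrite mulr0 add0r. Qed.

(** The matrix is diagonalised over the complex numbers, while the gap concerns real eigenvectors:
    the real and imaginary parts of a row of the unitary matrix are real eigenvectors, and one of
    them is nonzero. *)
Lemma symmetric_spectral_gap n (A : 'M[R]_n) (E e : R) : A^T = A -> 0 < e ->
  (forall (mu : R) (v : 'rV[R]_n), v != 0 -> v *m A = mu *: v -> e <= `|mu - E|) ->
  forall u : 'rV[R]_n, e ^+ 2 * (\sum_i u 0 i ^+ 2) <=
    \sum_i (u *m (A - E%:M)) 0 i ^+ 2.
Proof.
move=> symA e0 gap u.
pose AC : 'M[R[i]]_n := map_mx (real_complex R) A.
have ACt : AC ^t* = AC.
  apply/matrixP => i j; rewrite !mxE conj_real.
  by have /matrixP/(_ i j) := symA; rewrite mxE => ->.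
have herm : AC \is hermsymmx.
  by apply/is_hermitianmxP; rewrite expr0 scale1r ACt.
have /orthomx_spectralP AE : AC \is normalmx by apply/normalmxP; rewrite ACt.
have Dreal := hermitian_spectral_diag_real herm.
set P := spectralmx AC in AE; set D := spectral_diag AC in AE Dreal.
have uP : P \is unitarymx := spectral_unitarymx AC.
have PP : P *m invmx P = 1%:M by rewrite mulmxV // spectral_unit.
have PP' : invmx P *m P = 1%:M by rewrite mulVmx // spectral_unit.
have PA : P *m AC = diag_mx D *m P by rewrite [in LHS]AE !mulmxA PP mul1mx.
have eig j : exists2 mu : R, D 0 j = mu%:C & e <= `|mu - E|.
  exists (complex.Re (D 0 j)); first by rewrite RRe_real //; exact: (mxOverP Dreal).
  set mu := complex.Re _.
  have Dmu : D 0 j = mu%:C by rewrite RRe_real //; exact: (mxOverP Dreal).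
  have rowE : row j P *m AC = D 0 j *: row j P.
    by rewrite -row_mul PA row_mul row_diag_mx -scalemxAl -rowE.
  have eigen_part (f : R[i] -> R) : {morph f : x y / x + y} -> f 0 = 0 ->
      (forall x a, f (x * a%:C) = f x * a) ->
      map_mx f (row j P) *m A = mu *: map_mx f (row j P).
    move=> fD f0 fM; apply/rowP => i; rewrite !mxE.
    have /rowP/(_ i) := rowE; rewrite Dmu !mxE => /(congr1 f).
    rewrite (big_morph f fD f0) mulrC fM mulrC => <-.
    by apply: eq_bigr => k _; rewrite !mxE fM.
  have e1 := eigen_part _ ReD erefl ReMr.
  have e2 := eigen_part _ ImD erefl ImMr.
  have [x0|x0] := eqVneq (map_mx (@complex.Re R) (row j P)) 0; last exact: gap x0 e1.
  have [y0|y0] := eqVneq (map_mx (@complex.Im R) (row j P)) 0; last exact: gap y0 e2.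
  have r0 : row j P = 0.
    apply/rowP => i; move/rowP/(_ i): x0; move/rowP/(_ i): y0; rewrite !mxE.
    by case: (P j i) => a b /= -> ->.
  have /(congr1 (mulmx^~ (invmx P))) := r0.
  rewrite -row_mul PP mul0mx => /rowP/(_ j); rewrite !mxE eqxx /= => /eqP.
  by rewrite oner_eq0.
pose uc := map_mx (real_complex R) u.
pose c := uc *m invmx P.
have ucE : uc = c *m P by rewrite -mulmxA PP' mulmx1.
have wE : map_mx (real_complex R) (u *m (A - E%:M)) =
    c *m diag_mx (\row_j (D 0 j - E%:C)) *m P.
  rewrite map_mxM map_mxB -/uc -/AC map_scalar_mx /=.
  have -> : diag_mx (\row_j (D 0 j - E%:C)) = diag_mx D - E%:C%:M.
    by apply/matrixP => i j; rewrite !mxE; case: eqP => // _; rewrite ?mulr1n ?mulr0n ?subr0.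
  by rewrite ucE -mulmxA mulmxBr PA mul_mx_scalar -(mulmxA c) mulmxBl mul_scalar_mx.
rewrite -lecR rmorphM /= -!sqnorm_real wE -/uc ucE !(sqnorm_unitary _ uP) !sqnormE.
rewrite mulr_sumr; apply: ler_sum => j _.
have [mu Dj emu] := eig j.
rewrite mul_mx_diag !mxE Dj -rmorphB /=; move: (\sum_j0 _) => z.
rewrite [Num.conj (_ * _)]rmorphM /= conj_real mulrACA [leLHS]mulrC.
apply: ler_wpM2l; first exact: mul_conjC_ge0.
rewrite -rmorphM /= lecR -expr2 -(real_normK (num_real (mu - E))).
by rewrite lerXn2r // nnegrE ?normr_ge0 // ltW.
Qed.

Lemma symmetric_solve n (A : 'M[R]_n) (E e : R) : A^T = A -> 0 < e ->
  (forall (mu : R) (v : 'rV[R]_n), v != 0 -> v *m A = mu *: v -> e <= `|mu - E|) ->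
  forall g : 'rV[R]_n, exists2 u : 'rV[R]_n, u *m (A - E%:M) = g &
    e ^+ 2 * (\sum_i u 0 i ^+ 2) <= \sum_i g 0 i ^+ 2.
Proof.
move=> symA e0 gap g.
have unitA : A - E%:M \in unitmx.
  rewrite -row_free_unit -kermx_eq0; apply/rowV0P => v /sub_kermxP hv.
  apply: contraTeq e0 => v0; rewrite -leNgt.
  apply: le_trans (gap E v v0 _) _; last by rewrite subrr normr0.
  by apply/eqP; rewrite -subr_eq0 -mul_mx_scalar -mulmxBr hv.
exists (g *m invmx (A - E%:M)); first by rewrite mulmxKV.
by have := symmetric_spectral_gap symA e0 gap (g *m invmx (A - E%:M)); rewrite mulmxKV.
Qed.

End SpectralGap.

(** * Bounds on the Hausdorff dimension *)

Section Cylinders.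
Context {R : realType}.
Variables (n : nat -> nat) (g : nat -> nat -> bool).

Let agrees (p : seq bool) (i : nat) : bool :=
  all (fun j => nth false p j == g i j) (iota 0 (minn (size p) (n i))).

(* The mass, for the uniform measure on [nat -> bool], of the intersection of the
   [i]-th cylinder with the cylinder of prefix [p]. *)
Let mass (p : seq bool) (i : nat) : R :=
  if agrees p i then 2^-1 ^+ maxn (size p) (n i) else 0.

Let mass_split p i : mass p i = mass (rcons p false) i + mass (rcons p true) i.
Proof.
rewrite /mass /agrees !size_rcons.
have eqa (b : bool) m : (m <= size p)%N ->
    all (fun j => nth false (rcons p b) j == g i j) (iota 0 m) =
    all (fun j => nth false p j == g i j) (iota 0 m).
  move=> hm; apply: eq_in_all => j; rewrite mem_iota /= add0n => hj.
  by rewrite nth_rcons (leq_trans hj hm).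
have [hn|hn] := leqP (n i) (size p).
  have -> : minn (size p).+1 (n i) = n i by apply/minn_idPr; lia.
  have -> : maxn (size p).+1 (n i) = (size p).+1 by apply/maxn_idPl; lia.
  rewrite !eqa //; case: ifP => _; last by rewrite addr0.
  by rewrite exprS; field.
have -> : minn (size p).+1 (n i) = (size p).+1 by apply/minn_idPl.
have -> : maxn (size p).+1 (n i) = n i by apply/maxn_idPr.
rewrite -(addn1 (size p)) iotaD !all_cat /= !eqa // !add0n !nth_rcons ltnn eqxx !andbT.
case: (all _ _) => /=; last by rewrite addr0.
by case: (g i (size p)) => /=; rewrite ?addr0 ?add0r.
Qed.

Let mass_ge0 p i : 0 <= mass p i.
Proof. by rewrite /mass; case: ifP => // _; rewrite exprn_ge0. Qed.

Local Open Scope ereal_scope.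

(** Cylinders of total measure below 1 do not cover the Cantor space. The uncovered point is built
    greedily: if the cylinders take less than the full measure of a prefix ([light]), the same is
    true of one of its two extensions. Agreement with cylinder i up to depth [n i] would make that
    prefix fully taken. *)
Lemma cylinder_escape : \sum_(0 <= i <oo) ((2^-1 ^+ n i)%R : R)%:E < 1 ->
  exists sigma : nat -> bool, forall i, exists2 j, (j < n i)%N & sigma j <> g i j.
Proof.
move=> lt1.
pose light p := \sum_(0 <= i <oo) (mass p i)%:E < ((2^-1 ^+ size p)%R : R)%:E.
pose b p := ~~ `[< light (rcons p false) >].
have light0 : light [::].
  rewrite /light /= expr0; apply: le_lt_trans lt1.
  apply: lee_nneseries => i *; rewrite ?lee_fin //.
  by rewrite /mass /agrees /= min0n max0n.
have lightS p : light p -> light (rcons p (b p)).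
  move=> lp; rewrite /b; case: asboolP => //= nl.
  rewrite /light ltNge; apply/negP => h.
  move: nl; rewrite /light => /negP; rewrite -leNgt => h'.
  move: lp; rewrite /light ltNge => /negP; apply.
  under eq_eseriesr do rewrite mass_split EFinD.
  rewrite nneseriesD; try by move=> *; rewrite lee_fin.
  apply: le_trans (leeD h' h); rewrite -EFinD lee_fin !size_rcons exprS.
  by have := exprn_ge0 (size p) (_ : 0 <= 2^-1 :> R)%R; lra.
pose P := fix P m := if m is m'.+1 then rcons (P m') (b (P m')) else [::].
have lightP m : light (P m) by elim: m => //= m; exact: lightS.
have sP m : size (P m) = m by elim: m => //= m IH; rewrite size_rcons IH.
have nP m j : (j < m)%N -> nth false (P m) j = b (P j).
  elim: m => // m IH; rewrite ltnS leq_eqVlt => /orP[/eqP ->|h] /=.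
    by rewrite nth_rcons sP ltnn eqxx.
  by rewrite nth_rcons sP h IH.
exists (fun j => b (P j)) => i; apply: contrapT => nex.
have := lightP (n i); rewrite /light sP ltNge => /negP; apply.
apply: (le_trans (y := (mass (P (n i)) i)%:E)).
  rewrite /mass /agrees sP minnn maxnn ifT //.
  apply/allP => j; rewrite mem_iota /= add0n => hj; rewrite nP //.
  by apply/eqP; apply: contrapT => h; apply: nex; exists j.
apply: le_trans (nneseries_lim_ge i.+1 _); last by move=> *; rewrite lee_fin.
rewrite big_nat_recr //= leeDr //.
by apply: sume_ge0 => k _; rewrite lee_fin.
Qed.

End Cylinders.

Section HausdorffDimensionBounds.
Context {R : realType}.
Implicit Types (A X : set R) (s : R).
Local Open Scope ereal_scope.

Lemma hausdorff_dim_ge0 A : 0 <= hausdorff_dim A.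
Proof. by apply: le_ereal_inf_tmp => _ [s [s0 _] <-]; rewrite lee_fin. Qed.

Lemma hausdorff_weight_ge0 s (U : set R) : 0 <= hausdorff_weight s U.
Proof. by rewrite /hausdorff_weight; case: ifP => // _; exact: poweR_ge0. Qed.

Lemma diameter_ge0 (U : set R) x : U x -> 0 <= diameter U.
Proof.
move=> Ux; apply: ereal_sup_ubound; exists (x, x) => //=.
by rewrite subrr normr0.
Qed.

Lemma diameter_ge (U : set R) x y : U x -> U y -> (`|x - y|)%:E <= diameter U.
Proof. by move=> Ux Uy; apply: ereal_sup_ubound; exists (x, y). Qed.

Lemma hausdorff_premeasure_le s delta A n (U : nat -> set R) (d : R) :
  (0 <= s)%R -> (0 <= d <= delta)%R -> A `<=` \bigcup_(i in `I_n) U i ->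
  (forall i x y, U i x -> U i y -> (`|x - y| <= d)%R) ->
  hausdorff_premeasure s delta A <= (n%:R * d `^ s)%:E.
Proof.
move=> s0 /andP[d0 dd] AU Ud.
(* Padding by the empty set is free: its diameter is -oo and its weight 0, even for s = 0. *)
pose V i := if (i < n)%N then U i else set0.
have dV i : diameter (V i) <= d%:E.
  apply: ge_ereal_sup => _ [[x y] [/= Vx Vy] <-]; rewrite lee_fin.
  by move: Vx Vy; rewrite /V; case: ifP => // _; exact: Ud.
apply: (le_trans (y := \sum_(0 <= i <oo) hausdorff_weight s (V i))).
  apply: ereal_inf_lbound; exists V => //; split.
    move=> x /AU[i /= ni Ux]; exists i => //.
    by rewrite /V ni.
  by move=> i; apply: le_trans (dV i) _; rewrite lee_fin.
apply: lime_le; first by apply: is_cvg_nneseries => i *; exact: hausdorff_weight_ge0.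
near=> m.
have wV i : hausdorff_weight s (V i) <= (if (i < n)%N then d `^ s else 0%R)%:E.
  rewrite /hausdorff_weight; case: eqP => [_|/eqP/set0P[x Vx]].
    by case: ifP => // _; rewrite lee_fin powR_ge0.
  have ni : (i < n)%N by move: Vx; rewrite /V; case: ifP.
  rewrite ni -poweR_EFin; apply: gt0_ler_poweR => //.
    by rewrite in_itv /= (diameter_ge0 Vx) leey.
  by rewrite in_itv /= lee_fin d0 leey.
apply: le_trans (lee_sum _ (fun i _ => wV i)) _.
rewrite sumEFin lee_fin.
have -> : (\sum_(0 <= i < m) (if (i < n)%N then d `^ s else 0) = (minn m n)%:R * d `^ s)%R.
  elim: (m) => [|k IH]; first by rewrite big_nil min0n mul0r.
  rewrite big_nat_recr //= IH; case: (ltnP k n) => h.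
    by rewrite (minn_idPl h) -natr1 mulrDl mul1r.
  by rewrite (minn_idPr (leqW h)) addr0.
by rewrite ler_wpM2r ?powR_ge0 // ler_nat geq_minr.
Unshelve. all: by end_near. Qed.

Lemma hausdorff_dim_le s A : (0 <= s)%R ->
  (forall delta eta : R, (0 < delta)%R -> (0 < eta)%R ->
    exists (n : nat) (U : nat -> set R) (d : R),
    [/\ (0 <= d <= delta)%R, A `<=` \bigcup_(i in `I_n) U i,
        forall i x y, U i x -> U i y -> (`|x - y| <= d)%R & (n%:R * d `^ s <= eta)%R]) ->
  hausdorff_dim A <= s%:E.
Proof.
move=> s0 h; apply: ereal_inf_lbound; exists s => //; split=> //.
apply/eqP; rewrite eq_le; apply/andP; split.
  apply: ge_ereal_sup => _ [delta /= d0 <-]; apply/lee_addgt0Pr => e e0.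
  have [n [U [d [dd AU Ud ne]]]] := h _ _ d0 e0.
  apply: le_trans (hausdorff_premeasure_le s0 dd AU Ud) _.
  by rewrite add0e lee_fin.
apply: le_trans (_ : hausdorff_premeasure s 1 A <= _); last first.
  by apply: ereal_sup_ubound; exists 1%R => //=.
apply: le_ereal_inf_tmp => _ [U _ <-].
by apply: nneseries_ge0 => i *; exact: hausdorff_weight_ge0.
Qed.

(** A mass distribution argument on codes: points of X in a set of diameter d share a code prefix of
    length n with a q^n of order d, so the set costs a cylinder of measure 2^(-n), at most a
    constant times d^s. A cover of small weight would then give cylinders of total measure below 1,
    and [cylinder_escape] a code whose point is not covered. *)
Lemma hausdorff_dim_gt0 A X (c : R -> nat -> bool) (a q : R) :
  (0 < a)%R -> (0 < q < 1)%R -> X `<=` A ->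
  (forall sigma : nat -> bool, exists2 x, X x & forall n, c x n = sigma n) ->
  (forall x y n, X x -> X y -> c x n <> c y n -> (a * q ^+ n <= `|x - y|)%R) ->
  0 < hausdorff_dim A.
Proof.
move=> a0 /andP[q0 q1] XA csurj csep.
(* The exponent with q^s0 = 1/2. *)
pose s0 : R := (ln 2^-1 / ln q)%R.
have lnq : (ln q < 0)%R by rewrite ln_lt0 // q0.
have ln2 : (ln 2^-1 < 0 :> R)%R by rewrite ln_lt0 // invr_gt0 ltr0n /= invf_lt1 // ltr1n.
have s00 : (0 < s0)%R by rewrite /s0 nmulr_rgt0 // invr_lt0.
apply: (lt_le_trans (y := s0%:E)); first by rewrite lte_fin.
apply: le_ereal_inf_tmp => _ [s [s_ge0 sA] <-]; rewrite lee_fin leNgt.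
apply/negP => ss0.
have qs : (2^-1 <= q `^ s)%R.
  rewrite /powR (gt_eqF q0) -[leLHS]lnK ?posrE ?invr_gt0 // ler_expR.
  have lnq0 : (ln q != 0)%R by rewrite lt_eqF.
  by rewrite -[leLHS](divfK lnq0) ler_wnM2r // ltW.
pose K : R := ((a `^ s)^-1)%R.
have as0 : (0 < a `^ s)%R by rewrite powR_gt0.
have K0 : (0 < K)%R by rewrite invr_gt0.
suff h : (2 * K)^-1%:E <= hausdorff_premeasure s 1 A.
  have : (2 * K)^-1%:E <= hausdorff_measure s A.
    by apply: le_trans h _; apply: ereal_sup_ubound; exists 1%R => //=.
  by rewrite sA lee_fin leNgt invr_gt0 mulr_gt0.
apply: le_ereal_inf_tmp => _ [U [AU dU] <-].
rewrite leNgt; apply/negP => small.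
(* The slack [2^-1 / 2^(i+1)] pays for sets that are empty or a single point, whose weight may be 0.
   It sums to 1/2; the weights get the other half, whence [(2 * K)^-1]. *)
have choose i : exists nn : nat,
    ((2^-1 ^+ nn)%R)%:E <= K%:E * hausdorff_weight s (U i) + (2^-1 / (2 ^ i.+1)%:R)%:E /\
    forall x y, X x -> X y -> U i x -> U i y -> forall j, (j < nn)%N -> c x j = c y j.
  have w0 := hausdorff_weight_ge0 s (U i).
  have triv : (forall x y, X x -> X y -> U i x -> U i y -> x = y) -> exists nn : nat,
    ((2^-1 ^+ nn)%R)%:E <= K%:E * hausdorff_weight s (U i) + (2^-1 / (2 ^ i.+1)%:R)%:E /\
    forall x y, X x -> X y -> U i x -> U i y -> forall j, (j < nn)%N -> c x j = c y j.
    move=> h; exists i.+2; split=> [|x y Xx Xy Ux Uy j _]; last by rewrite (h x y).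
    rewrite (_ : (2^-1 ^+ i.+2)%R = (2^-1 / (2 ^ i.+1)%:R)%R); last first.
      by rewrite exprS natrX exprVn.
    by rewrite leeDr // mule_ge0 // lee_fin ltW.
  have [e|/set0P[x0 Ux0]] := eqVneq (U i) set0.
    by apply: triv => x y _ _; rewrite e.
  have D0 := diameter_ge0 Ux0.
  have [d eD] : exists d : R, diameter (U i) = d%:E.
    exists (fine (diameter (U i))); rewrite fineK // ge0_fin_numE //.
    by apply: le_lt_trans (dU i) _; rewrite ltry.
  have Ud x y : U i x -> U i y -> (`|x - y| <= d)%R.
    by move=> Ux Uy; rewrite -lee_fin -eD; exact: diameter_ge.
  have [d0|d0] := leP d 0%R.
    apply: triv => x y _ _ Ux Uy; apply/eqP; rewrite -subr_eq0 -normr_le0.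
    exact: le_trans (Ud _ _ Ux Uy) d0.
  have ex : exists nn, (a * q ^+ nn <= d)%R.
    have : (fun nn => (q ^+ nn)%R) @ \oo --> (0 : R)%R.
      by apply: cvg_expr; rewrite gtr0_norm.
    move=> /cvgrPdist_lt /(_ (d / a)%R (divr_gt0 d0 a0)) [N _ /(_ N (leqnn N))] /=.
    rewrite sub0r normrN gtr0_norm ?exprn_gt0 // ltr_pdivlMr // mulrC => h.
    by exists N; exact: ltW.
  (* For j < nn minimality gives a q^j > d, so two points of [U i] cannot differ at j; and a q^nn <=
     d bounds 2^(-nn) by K d^s. *)
  have [nn nd nmin] := ex_minnP ex.
  exists nn; split.
    apply: (le_trans (y := K%:E * hausdorff_weight s (U i))); last first.
      by rewrite leeDl // lee_fin divr_ge0.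
    rewrite /hausdorff_weight ifF; last by apply/eqP => e; rewrite e in Ux0.
    rewrite eD poweR_EFin -EFinM lee_fin /K mulrC ler_pdivlMr //.
    apply: (le_trans (y := ((a * q ^+ nn) `^ s)%R)); last first.
      by apply: ge0_ler_powR => //; rewrite nnegrE ltW // mulr_gt0 // exprn_gt0.
    have -> : ((a * q ^+ nn) `^ s = a `^ s * (q `^ s) ^+ nn)%R.
      rewrite powRM ?exprn_ge0 ?ltW //; congr (_ * _)%R.
      rewrite -(powR_mulrn nn (ltW q0)) -powRrM mulrC powRrM.
      by rewrite powR_mulrn ?powR_ge0.
    rewrite mulrC ler_pM2l // lerXn2r // nnegrE ?powR_ge0 // invr_ge0.
  move=> x y Xx Xy Ux Uy j hj; apply: contrapT => hc.
  have := nmin j; rewrite leqNgt hj => h.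
  suff : false by []. apply: h.
  exact: le_trans (csep _ _ _ Xx Xy hc) (Ud _ _ Ux Uy).
have [nn hnn] := boolp.choice choose.
have [g hg] : exists g : nat -> nat -> bool, forall i x, X x -> U i x ->
    forall j, (j < nn i)%N -> c x j = g i j.
  have /boolp.choice[g hg] : forall i, exists gi : nat -> bool, forall x, X x -> U i x ->
      forall j, (j < nn i)%N -> c x j = gi j; last by exists g.
  move=> i; have [[x [Xx Ux]]|nx] := pselect (exists x, X x /\ U i x).
    by exists (c x) => y Xy Uy j hj; apply: (hnn i).2.
  by exists (fun=> false) => y Xy Uy; case: nx; exists y.
have : \sum_(0 <= i <oo) ((2^-1 ^+ nn i)%R : R)%:E < 1.
  apply: (@le_lt_trans _ _ (\sum_(0 <= i <oo) (K%:E * hausdorff_weight s (U i) + (2^-1 / (2 ^ i.+1)%:R)%:E))).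
    by apply: lee_nneseries => i *; rewrite ?lee_fin ?exprn_ge0 //; exact: (hnn i).1.
  apply: le_lt_trans (epsilon_trick _ _ _) _ => //.
    by move=> i; rewrite mule_ge0 ?hausdorff_weight_ge0 // lee_fin ltW.
  rewrite nneseriesZl; last by move=> *; exact: hausdorff_weight_ge0.
  have : K%:E * (\sum_(0 <= i <oo) hausdorff_weight s (U i)) < (2^-1)%:E.
    have -> : (2^-1)%:E = K%:E * ((2 * K)^-1)%:E.
      by rewrite -EFinM invfM mulrCA mulfV ?mulr1 // gt_eqF.
    by rewrite lte_pmul2l // lte_fin.
  move=> h; have -> : 1 = (2^-1)%:E + (2^-1 : R)%:E :> \bar R.
    by rewrite -EFinD; congr EFin; field.
  by rewrite lte_leD ?lee_fin ?lexx // fin_numE.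
move=> /(@cylinder_escape _ _ g) [sigma hs].
have [x Xx cx] := csurj sigma.
have [i _ Uix] := AU _ (XA _ Xx).
have [j hj ne] := hs i.
by apply: ne; rewrite -cx; exact: hg.
Qed.

End HausdorffDimensionBounds.

(** * Expansion along trace orbits *)

Section TraceDynamics.
Context {R : realFieldType}.
Implicit Types (y : nat -> R) (W r : R).

Definition fricke (a b c : R) : R :=
  a ^+ 2 + b ^+ 2 + c ^+ 2 - 2 * a * b * c - 1.

Definition trace_recurrence y := forall n, y n.+3 = 2 * y n.+2 * y n.+1 - y n.

Lemma fricke_trace_recurrence y n : trace_recurrence y ->
  fricke (y n) (y n.+1) (y n.+2) = fricke (y 0%N) (y 1%N) (y 2%N).
Proof.
by move=> hy; elim: n => // n <-; rewrite /fricke hy; ring.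
Qed.

(** The three excluded conditions reproduce themselves one step later, see [escape_forever]. *)
Definition no_escape y := forall n,
  ~ [/\ 1 < `|y n.+1|, 1 < `|y n.+2| & `|y n| < `|y n.+1 * y n.+2|].

(** Completing the square in c: (c - ab)^2 = W^2 + (1 - a^2)(1 - b^2). *)
Lemma fricke_root W a b c : 0 <= W -> fricke a b c = W ^+ 2 ->
  `|a| <= 1 -> `|b| <= 1 -> W <= `|c - a * b|.
Proof.
rewrite /fricke => W0 h /ler_normlP[a1 a2] /ler_normlP[b1 b2].
have ha : 0 <= 1 - a ^+ 2 by nra.
have hb : 0 <= 1 - b ^+ 2 by nra.
rewrite -(ler_pXn2r (n := 2)) // ?nnegrE // real_normK ?num_real //.
rewrite (_ : (c - a * b) ^+ 2 = W ^+ 2 + (1 - a ^+ 2) * (1 - b ^+ 2)).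
  by rewrite lerDl mulr_ge0.
by rewrite -h; ring.
Qed.

Lemma normM_le1 (a b : R) : `|a| <= 1 -> `|b| <= 1 -> `|a * b| <= 1.
Proof. by move=> a1 b1; rewrite normrM mulr_ile1. Qed.

Lemma fricke_large W a b c : 0 <= W -> fricke a b c = W ^+ 2 ->
  `|a| <= 1 -> `|b| <= 1 -> W - 1 <= `|c|.
Proof.
move=> W0 h a1 b1; have q := fricke_root W0 h a1 b1.
have := normM_le1 a1 b1; have := ler_normB c (a * b); lra.
Qed.

Lemma normM_sub_le (a b a' b' : R) :
  `|a * b - a' * b'| <= `|a - a'| * `|b'| + `|a| * `|b - b'|.
Proof.
rewrite -!normrM (_ : a * b - a' * b' = (a - a') * b' + a * (b - b')); last by ring.
exact: ler_normD.
Qed.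

Lemma norm_sqr_sub_le (a a' : R) : `|a| <= 1 -> `|a'| <= 1 ->
  `|(1 - a ^+ 2) - (1 - a' ^+ 2)| <= 2 * `|a - a'|.
Proof.
move=> a1 a1'; rewrite (_ : _ - _ = (a - a') * (- (a + a'))); last by ring.
rewrite normrM normrN mulrC ler_wpM2r //.
have := ler_normD a a'; lra.
Qed.

Lemma norm_1sub_sqr_le (a : R) : `|a| <= 1 -> `|1 - a ^+ 2| <= 1.
Proof. by move=> /ler_normlP[a1 a2]; rewrite ler_norml; apply/andP; split; nra. Qed.

(** Since c and c' have the same sign and exceed 1 in modulus, q = c - ab and q' = c' - a'b' are on
    the same branch of the square root. Hence |q + q'| >= W + W', and dividing q^2 - q'^2 by q + q'
    bounds q - q'. *)
Lemma fricke_dist W W' a b c a' b' c' : 2 < W -> 2 < W' ->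
  fricke a b c = W ^+ 2 -> fricke a' b' c' = W' ^+ 2 ->
  `|a| <= 1 -> `|b| <= 1 -> `|a'| <= 1 -> `|b'| <= 1 -> 0 < c * c' ->
  `|c - c'| <= `|W - W'| + 2 * (`|a - a'| + `|b - b'|).
Proof.
move=> W2 W2' h h' a1 b1 a1' b1' cc.
have W0 : 0 <= W by lra.
have W0' : 0 <= W' by lra.
have c1 := fricke_large W0 h a1 b1.
have c1' := fricke_large W0' h' a1' b1'.
have q1 := fricke_root W0 h a1 b1.
have q1' := fricke_root W0' h' a1' b1'.
have ab := normM_le1 a1 b1; have ab' := normM_le1 a1' b1'.
have hs : W + W' <= `|(c - a * b) + (c' - a' * b')|.
  move: cc c1 c1' q1 q1' ab ab'.
  move: (a * b) (a' * b') => p p' cc c1 c1' q1 q1' /ler_normlP[p1 p2] /ler_normlP[p1' p2'].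
  have [c0|c0] := ltrP 0 c.
    have c0' : 0 < c' by rewrite -(pmulr_rgt0 _ c0).
    rewrite (gtr0_norm c0) in c1; rewrite (gtr0_norm c0') in c1'.
    rewrite ger0_norm in q1; last by lra.
    rewrite ger0_norm in q1'; last by lra.
    by rewrite ger0_norm; lra.
  have c0n : c < 0 by rewrite lt_neqAle c0 andbT; apply: contraTneq cc => ->; rewrite mul0r ltxx.
  have c0' : c' < 0 by rewrite -(nmulr_rgt0 _ c0n).
  rewrite (ltr0_norm c0n) in c1; rewrite (ltr0_norm c0') in c1'.
  rewrite ler0_norm in q1; last by lra.
  rewrite ler0_norm in q1'; last by lra.
  by rewrite ler0_norm; lra.
set q := c - a * b in hs; set q' := c' - a' * b' in hs.
have e1 : `|q - q'| * `|q + q'| <= `|W - W'| * (W + W') + 2 * (`|a - a'| + `|b - b'|).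
  rewrite -normrM.
  have -> : (q - q') * (q + q') = (W ^+ 2 - W' ^+ 2) +
      ((1 - a ^+ 2) * (1 - b ^+ 2) - (1 - a' ^+ 2) * (1 - b' ^+ 2)).
    by rewrite -h -h' /q /q' /fricke; ring.
  apply: le_trans (ler_normD _ _) _; apply: lerD.
    by rewrite subr_sqr normrM (ger0_norm (addr_ge0 W0 W0')).
  apply: le_trans (normM_sub_le _ _ _ _) _.
  have A := norm_sqr_sub_le a1 a1'; have B := norm_sqr_sub_le b1 b1'.
  have C := norm_1sub_sqr_le b1'; have D := norm_1sub_sqr_le a1.
  rewrite mulrDr; apply: lerD.
    by apply: le_trans (ler_wpM2l _ C) _; rewrite // mulr1.
  by apply: le_trans (ler_wpM2r _ D) _; rewrite // mul1r.
have e2 : `|q - q'| <= `|W - W'| + (`|a - a'| + `|b - b'|).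
  have A0 := normr_ge0 (a - a'); have B0 := normr_ge0 (b - b').
  have Q0 := normr_ge0 (q - q').
  have S0 : 0 < W + W' by lra.
  rewrite -(ler_pM2r S0).
  apply: (le_trans (y := `|q - q'| * `|q + q'|)); first by rewrite ler_wpM2l.
  apply: le_trans e1 _; rewrite [leRHS]mulrDl lerD2l mulrC ler_wpM2l ?addr_ge0 //; lra.
have e3 := normM_sub_le a b a' b'.
have e4 : `|a - a'| * `|b'| <= `|a - a'| by rewrite ler_piMr.
have e5 : `|a| * `|b - b'| <= `|b - b'| by rewrite ler_piMl.
have -> : c - c' = (q - q') + (a * b - a' * b') by rewrite /q /q'; ring.
have := ler_normD (q - q') (a * b - a' * b'); lra.
Qed.

(** Here m may vary as fast as W |v - v'|. The coefficient B, which is |v| or |4 v^2 - 1| in the two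
    uses, is small because its product with m is bounded, and it cancels this factor W. *)
Lemma fricke_small_dist W W' u v m u' v' m' B K : 2 < W -> 2 < W' ->
  fricke u v m = W ^+ 2 -> fricke u' v' m' = W' ^+ 2 ->
  `|u| <= 1 -> `|v| <= 1 -> `|u'| <= 1 -> `|v'| <= 1 -> 0 < m * m' ->
  `|u - u'| <= `|v - v'| -> `|W - W'| <= `|v - v'| * (W - 1) ->
  0 <= B <= 3 -> B * (W - 1) <= K ->
  B * `|m - m'| <= (K + 12) * `|v - v'|.
Proof.
move=> W2 W2' h h' u1 v1 u1' v1' mm uv WW /andP[B0 B3] BK.
have d := fricke_dist W2 W2' h h' u1 v1 u1' v1' mm.
have V0 := normr_ge0 (v - v').
have d' : `|m - m'| <= `|v - v'| * (W - 1) + 4 * `|v - v'| by lra.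
have h1 : B * `|m - m'| <= B * (`|v - v'| * (W - 1) + 4 * `|v - v'|).
  by rewrite ler_wpM2l.
have h2 : B * (W - 1) * `|v - v'| <= K * `|v - v'| by rewrite ler_wpM2r.
have h3 : B * `|v - v'| <= 3 * `|v - v'| by rewrite ler_wpM2r.
nra.
Qed.

(** The difference is 2 (v - v') m' + 2 v (m - m') - (u - u'). As the new value is small, |v m| <=
    1; so the first term has size 2 (W' - 1) |v - v'| and the others at most 27 |v - v'|, which
    [40 <= W'] absorbs. *)
Lemma expand_once W W' u v m u' v' m' : 40 <= W -> 40 <= W' ->
  fricke u v m = W ^+ 2 -> fricke u' v' m' = W' ^+ 2 ->
  `|u| <= 1 -> `|v| <= 1 -> `|u'| <= 1 -> `|v'| <= 1 -> 0 < m * m' ->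
  `|u - u'| <= `|v - v'| -> `|W - W'| <= `|v - v'| * (W - 1) ->
  `|2 * m * v - u| <= 1 ->
  W' * `|v - v'| <= `|(2 * m * v - u) - (2 * m' * v' - u')|.
Proof.
move=> W21 W21' h h' u1 v1 u1' v1' mm uv WW t1.
have m1 : W - 1 <= `|m| by apply: fricke_large h u1 v1; lra.
have m1' : W' - 1 <= `|m'| by apply: fricke_large h' u1' v1'; lra.
have vm : `|v| * (W - 1) <= 1.
  apply: (le_trans (y := `|v| * `|m|)); first by rewrite ler_wpM2l.
  have := ler_normD (2 * m * v - u) u; rewrite subrK !normrM normr_nat; lra.
have dm : `|v| * `|m - m'| <= (1 + 12) * `|v - v'|.
  apply: (fricke_small_dist _ _ h h') => //; try lra.
  by rewrite normr_ge0 /=; lra.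
have vm' : `|v - v'| * (W' - 1) <= `|v - v'| * `|m'| by rewrite ler_wpM2l.
have -> : 2 * m * v - u - (2 * m' * v' - u') =
  2 * ((v - v') * m') + 2 * (v * (m - m')) - (u - u') by ring.
set X := (v - v') * m'; set Y := v * (m - m'); set Z := u - u'.
have eX : `|2 * X| = 2 * (`|v - v'| * `|m'|) by rewrite !normrM normr_nat.
have eY : `|2 * Y| = 2 * (`|v| * `|m - m'|) by rewrite !normrM normr_nat.
have t2 := ler_normB (2 * X + 2 * Y) Z.
have t3 : `|2 * X| <= `|2 * X + 2 * Y - Z| + `|2 * Y| + `|Z|.
  have e : 2 * X = (2 * X + 2 * Y - Z) + (- (2 * Y)) + Z by ring.
  by rewrite {1}e; apply: le_trans (ler_normD _ _) _; rewrite lerD2r; exact: ler_normB.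
have V0 := normr_ge0 (v - v').
have WV : 40 * `|v - v'| <= W' * `|v - v'| by rewrite ler_wpM2r.
suff : W' * `|v - v'| <= 2 * (`|v - v'| * (W' - 1)) - 26 * `|v - v'| - `|v - v'|.
  by rewrite /Z in t3 *; lra.
nra.
Qed.

(** The value two steps later is (4 v^2 - 1) m - 2 u v. If it is small, 4 v^2 is close to 1; so v
    and v', of the same sign, satisfy |v + v'| >= 1/2, and the term 4 (v + v') (v - v') m'
    dominates. *)
Lemma expand_twice W W' u v m u' v' m' : 40 <= W -> 40 <= W' ->
  fricke u v m = W ^+ 2 -> fricke u' v' m' = W' ^+ 2 ->
  `|u| <= 1 -> `|v| <= 1 -> `|u'| <= 1 -> `|v'| <= 1 -> 0 < m * m' -> 0 < v * v' ->
  `|u - u'| <= `|v - v'| -> `|W - W'| <= `|v - v'| * (W - 1) ->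
  `|2 * (2 * m * v - u) * v - m| <= 1 ->
  `|2 * (2 * m' * v' - u') * v' - m'| <= 1 ->
  W' * `|v - v'| <= `|(2 * (2 * m * v - u) * v - m) - (2 * (2 * m' * v' - u') * v' - m')|.
Proof.
move=> W21 W21' h h' u1 v1 u1' v1' mm vv uv WW.
have Ev (p q s : R) : 2 * (2 * p * q - s) * q - p = (4 * q ^+ 2 - 1) * p - 2 * (s * q) by ring.
rewrite !Ev => t1 t1'.
have m1 : W - 1 <= `|m| by apply: fricke_large h u1 v1; lra.
have m1' : W' - 1 <= `|m'| by apply: fricke_large h' u1' v1'; lra.
have half (U q p s : R) : 40 <= U -> U - 1 <= `|p| -> `|s| <= 1 -> `|q| <= 1 ->
    `|(4 * q ^+ 2 - 1) * p - 2 * (s * q)| <= 1 ->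
    `|4 * q ^+ 2 - 1| * (U - 1) <= 3.
  move=> U40 p1 s1 q1 t; apply: (le_trans (y := `|4 * q ^+ 2 - 1| * `|p|)).
    by rewrite ler_wpM2l.
  have := ler_normD ((4 * q ^+ 2 - 1) * p - 2 * (s * q)) (2 * (s * q)).
  have := normM_le1 s1 q1; rewrite subrK !normrM normr_nat; lra.
have Q := half _ _ _ _ W21 m1 u1 v1 t1.
have Q' := half _ _ _ _ W21' m1' u1' v1' t1'.
have low (U q : R) : 40 <= U -> `|4 * q ^+ 2 - 1| * (U - 1) <= 3 -> 1 / 4 <= `|q|.
  move=> U40 hq; rewrite leNgt; apply/negP => q4.
  have q2 : `|q| ^+ 2 < 1 / 16.
    rewrite (_ : 1 / 16 = (1 / 4) ^+ 2); last by field.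
    by rewrite ltr_pXn2r // nnegrE //; lra.
  rewrite real_normK ?num_real // in q2.
  have : 3 / 4 < `|4 * q ^+ 2 - 1| by rewrite ler0_norm; lra.
  by move: (`|_ - 1|) hq => x; nra.
have v4 := low _ _ W21 Q; have v4' := low _ _ W21' Q'.
have vs : 1 / 2 <= `|v + v'|.
  have -> : `|v + v'| = `|v| + `|v'|.
    have [v0|v0] := ltrP 0 v.
      have v0' : 0 < v' by rewrite -(pmulr_rgt0 _ v0).
      by rewrite !gtr0_norm // addr_gt0.
    have v0n : v < 0 by rewrite lt_neqAle v0 andbT; apply: contraTneq vv => ->; rewrite mul0r ltxx.
    have v0' : v' < 0 by rewrite -(nmulr_rgt0 _ v0n).
    by rewrite !ltr0_norm ?opprD //; lra.
  lra.
have V0 := normr_ge0 (v - v').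
have dm : `|4 * v ^+ 2 - 1| * `|m - m'| <= (3 + 12) * `|v - v'|.
  apply: (fricke_small_dist _ _ h h') => //; try lra.
  by rewrite normr_ge0 /=; move: (`|4 * _ - 1|) (normr_ge0 (4 * v ^+ 2 - 1)) Q => x; nra.
have duv : `|u * v - u' * v'| <= 2 * `|v - v'|.
  apply: le_trans (normM_sub_le _ _ _ _) _.
  have e1 : `|u - u'| * `|v'| <= `|u - u'| by rewrite ler_piMr.
  have e2 : `|u| * `|v - v'| <= `|v - v'| by rewrite ler_piMl.
  lra.
set X := 4 * (v + v') * (v - v') * m'; set Y := (4 * v ^+ 2 - 1) * (m - m').
set Z := u * v - u' * v' in duv.
have eX : 2 * (`|v - v'| * (W' - 1)) <= `|X|.
  rewrite /X !normrM normr_nat.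
  have e1 : `|v - v'| * (W' - 1) <= `|v - v'| * `|m'| by rewrite ler_wpM2l.
  have e2 : 0 <= `|v - v'| * `|m'| by rewrite mulr_ge0.
  have e3 : 1 / 2 * (`|v - v'| * `|m'|) <= `|v + v'| * (`|v - v'| * `|m'|) by rewrite ler_wpM2r.
  rewrite -!mulrA; lra.
have eY : `|Y| <= 15 * `|v - v'| by rewrite /Y normrM; apply: le_trans dm _; lra.
have eZ : `|2 * Z| <= 4 * `|v - v'| by rewrite normrM normr_nat; lra.
have -> : (4 * v ^+ 2 - 1) * m - 2 * (u * v) - ((4 * v' ^+ 2 - 1) * m' - 2 * (u' * v')) =
   X + Y - 2 * Z by rewrite /X /Y /Z; ring.
have t3 : `|X| <= `|X + Y - 2 * Z| + `|Y| + `|2 * Z|.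
  have e : X = (X + Y - 2 * Z) + (- Y) + 2 * Z by ring.
  by rewrite {1}e; apply: le_trans (ler_normD _ _) _; rewrite lerD2r; exact: ler_normB.
have WV : 40 * `|v - v'| <= W' * `|v - v'| by rewrite ler_wpM2r.
suff : W' * `|v - v'| <= 2 * (`|v - v'| * (W' - 1)) - 19 * `|v - v'| by lra.
nra.
Qed.

Definition orbit_code y j : bool * bool := (`|y j| <= 1, 0 < y j).

Lemma orbit_code_mul_gt0 y y' j : orbit_code y j = orbit_code y' j ->
  y j != 0 -> y' j != 0 -> 0 < y j * y' j.
Proof.
case=> _; case: (ltrgt0P (y j)) => // h /esym; case: (ltrgt0P (y' j)) => // h' _ _ _.
  by rewrite mulr_gt0.
by rewrite nmulr_rgt0.
Qed.

(* Along two orbits with the same code, consider the times at which [|y k| <= 1]: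
   they are one or two steps apart, and every passage from one to the next
   multiplies the distance of the orbits by at least [W'] ([expand_once] when
   [y] is small enough to be multiplied by a large neighbour, [expand_twice] when
   two small values are separated by a large one). The hypothesis on [`|W - W'|]
   absorbs the dependence of the invariant surface on the energy. *)
Lemma orbit_expansion y y' W W' r : 40 <= W -> 40 <= W' -> 1 <= r -> r ^+ 2 <= W' ->
  trace_recurrence y -> trace_recurrence y' -> no_escape y -> no_escape y' ->
  fricke (y 0%N) (y 1%N) (y 2%N) = W ^+ 2 ->
  fricke (y' 0%N) (y' 1%N) (y' 2%N) = W' ^+ 2 ->
  `|y 0%N| <= 1 -> 1 < `|y 1%N| -> `|y 2%N| <= 1 ->
  `|y 0%N - y' 0%N| <= `|y 2%N - y' 2%N| ->
  `|W - W'| <= `|y 2%N - y' 2%N| * (W - 1) ->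
  forall N, (forall j, (j <= N.+2)%N -> orbit_code y j = orbit_code y' j) ->
  r ^+ N * `|y 2%N - y' 2%N| <= 2 * r.
Proof.
move=> W40 W40' r1 rW hy hy' ne ne' f0 f0' y0 y1 y2 D0 DW N hN.
set D := fun j => `|y j - y' j|.
have small j : (j <= N.+2)%N -> `|y j| <= 1 -> `|y' j| <= 1.
  by move=> /hN [<-].
have large j : (j <= N.+2)%N -> 1 < `|y j| -> 1 < `|y' j|.
  by move=> /hN [+ _]; rewrite !ltNge => ->.
have msign j : (j <= N.+2)%N -> 1 < `|y j| -> 0 < y j * y' j.
  move=> hj hl; have hl' := large _ hj hl; apply: orbit_code_mul_gt0; first exact: hN.
    by rewrite -normr_gt0; lra.
  by rewrite -normr_gt0; lra.
have F n : fricke (y n) (y n.+1) (y n.+2) = W ^+ 2 by rewrite fricke_trace_recurrence.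
have F' n : fricke (y' n) (y' n.+1) (y' n.+2) = W' ^+ 2 by rewrite fricke_trace_recurrence.
have perm (a b c : R) : fricke a c b = fricke a b c by rewrite /fricke; ring.
have W0 : 0 <= W by lra.
have W0' : 0 <= W' by lra.
have r0 : 0 <= r by lra.
have rW1 : r <= W' by apply: le_trans rW; rewrite expr2 ler_peMr.
have W1' : 1 <= W' by lra.
have D_ge0 j : 0 <= D j by exact: normr_ge0.
have rk k : 1 <= r ^+ k by apply: exprn_ege1.
rewrite -/(D 2%N).
(* [k.+2] is the last small time up to [N.+2], at most one step before it: hence one factor r in the
   bound. The 2 bounds the distance of two small values. *)
suff: exists k, [/\ k = N \/ k.+1 = N /\ 1 < `|y k.+3|, `|y k.+2| <= 1,
    (`|y k.+1| <= 1 /\ D k.+1 <= D k.+2) \/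
    [/\ 1 < `|y k.+1|, `|y k| <= 1 & D k <= D k.+2]
    & r ^+ k * D 2%N <= D k.+2].
  case=> k [hk yk _ rD].
  have kN : (k.+2 <= N.+2)%N by case: hk => [->|[<- _]] //.
  have yk' := small _ kN yk.
  have D2 : D k.+2 <= 2 by have := ler_normB (y k.+2) (y' k.+2); rewrite /D; lra.
  have rkD : r ^+ k * D 2%N <= 2 by lra.
  have H : r * (r ^+ k * D 2%N) <= r * 2 by rewrite ler_wpM2l.
  case: hk => [<-|[<- _]]; last by rewrite exprS -mulrA; lra.
  apply: le_trans rkD _; lra.
have H M : (M <= N)%N -> exists k, [/\ k = M \/ k.+1 = M /\ 1 < `|y k.+3|,
    `|y k.+2| <= 1,
    (`|y k.+1| <= 1 /\ D k.+1 <= D k.+2) \/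
    [/\ 1 < `|y k.+1|, `|y k| <= 1 & D k <= D k.+2]
    & r ^+ k * D 2%N <= D k.+2]; last exact: H.
elim: M => [|M IH] hM.
  exists 0%N; split=> //; [by left|by right|by rewrite expr0 mul1r].
have {IH}[k [hk yk prev rD]] := IH (ltnW hM).
have DWk : `|W - W'| <= D k.+2 * (W - 1).
  apply: le_trans DW _; rewrite ler_wpM2r //; first by lra.
  by apply: le_trans rD; rewrite ler_peMl.
case: hk => [ek|[ek yk3]]; subst M.
  have hk : (k.+2 <= N.+2)%N by rewrite !ltnS ltnW.
  have hk1 : (k.+1 <= N.+2)%N by exact: ltnW.
  have hk0 : (k <= N.+2)%N by exact: ltnW.
  have [yk3|yk3] := lerP `|y k.+3| 1; last first.
    by exists k; split=> //; right.
  case: prev => [[yk1 _]|[yk1 yk0 Dk]].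
    (* Three consecutive small values contradict [fricke_large]. *)
    by exfalso; have := fricke_large W0 (F k.+1) yk1 yk; lra.
  have E : W' * D k.+2 <= D k.+3.
    rewrite /D hy hy' -!(mulrA 2) (mulrC (y _)) (mulrC (y' _)) !mulrA.
    apply: (@expand_once W W') => //; rewrite ?(perm _ (y k.+1)) ?(perm _ (y' k.+1)) //.
    - exact: small.
    - exact: small.
    - exact: msign.
    - by rewrite -mulrA (mulrC (y _)) mulrA -hy.
  have Dle : D k.+2 <= D k.+3 by apply: le_trans E; rewrite ler_peMl.
  exists k.+1; split=> //; [by left|by left|].
  rewrite exprS -mulrA; apply: le_trans E.
  by apply: ler_pM => //; rewrite mulr_ge0 // exprn_ge0.
have hk3 : (k.+3 <= N.+2)%N by rewrite !ltnS ltnW.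
have hk : (k.+2 <= N.+2)%N by exact: ltnW.
have hk1 : (k.+1 <= N.+2)%N by exact: ltnW.
have hk0 : (k <= N.+2)%N by exact: ltnW.
(* Two large values after a small one would escape. *)
have yk4 : `|y k.+4| <= 1.
  rewrite leNgt; apply/negP => h; apply: (ne k.+2); split=> //.
  apply: (le_lt_trans yk); rewrite normrM; apply: (lt_trans yk3).
  by rewrite ltr_pMr // (lt_trans ltr01 yk3).
have yk4' : `|y' k.+4| <= 1 by apply: small.
suff E : W' * D k.+2 <= D k.+4.
  have Dle : D k.+2 <= D k.+4 by apply: le_trans E; rewrite ler_peMl.
  exists k.+2; split=> //; [by left|by right|].
  apply: le_trans E.
  have -> : r ^+ k.+2 = r ^+ 2 * r ^+ k by rewrite -exprD.
  rewrite -mulrA.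
  by apply: ler_pM => //; rewrite ?mulr_ge0 ?exprn_ge0.
case: prev => [[yk1 Dk]|[yk1 yk0 Dk]].
  rewrite /D (hy k.+1) (hy' k.+1) -!(mulrA 2) !mulrA.
  apply: (@expand_once W W') => //; first exact: small.
  - exact: small.
  - exact: msign.
  - by rewrite -hy.
rewrite /D (hy k.+1) (hy' k.+1) (hy k) (hy' k).
have sw (a b c d : R) : 2 * (2 * a * b - c) * a - d = 2 * (2 * b * a - c) * a - d by ring.
rewrite !sw; apply: (@expand_twice W W') => //; rewrite ?(perm _ (y k.+1)) ?(perm _ (y' k.+1)) //.
- exact: small.
- exact: small.
- exact: msign.
(* If y_(k+2) vanished, y_(k+4) = - y_(k+1) would be large. *)
- apply: orbit_code_mul_gt0; first exact: hN.
    apply/negP => /eqP v0; move: yk4; rewrite hy v0 mulr0 sub0r normrN.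
    by rewrite leNgt yk1.
  apply/negP => /eqP v0; move: yk4'; rewrite hy' v0 mulr0 sub0r normrN.
  by rewrite leNgt (large _ hk1 yk1).
- by rewrite -sw -hy -hy.
- by rewrite -sw -hy' -hy'.
Qed.

End TraceDynamics.

(** * Growth and variation of the Chebyshev polynomials at energies above 2 *)

Section ChebyshevGrowth.
Context {R : realFieldType}.
Implicit Types (E rho : R).

(** For E >= 2 the recursion makes the increments nondecreasing, and the first one is 1. *)
Lemma cheb_increment E n : 2 <= E -> 0 <= cheb E n /\ 1 <= cheb E n.+1 - cheb E n.
Proof.
move=> E2; elim: n => [|n [h0 h1]].
  by rewrite /cheb subr0; split; lra.
split; first lra.
rewrite chebSS; have : 2 * cheb E n.+1 <= E * cheb E n.+1 by rewrite ler_wpM2r //; lra.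
lra.
Qed.

Lemma cheb_ge0 E n : 2 <= E -> 0 <= cheb E n.
Proof. by move=> /(cheb_increment n) []. Qed.

Lemma cheb_ge1 E n : 2 <= E -> 1 <= cheb E n.+1.
Proof. by move=> /(cheb_increment n) []; lra. Qed.

Lemma cheb_ratio E rho n : 2 <= E -> rho <= E - 1 -> rho * cheb E n <= cheb E n.+1.
Proof.
move=> E2 hr; have [h0 h1] := cheb_increment n E2.
have : rho * cheb E n <= (E - 1) * cheb E n by rewrite ler_wpM2r.
case: n h0 h1 => [|n] h0 h1; first by rewrite /cheb !mulr0.
have [h0' h1'] := cheb_increment n E2.
rewrite chebSS; lra.
Qed.

Lemma cheb_exp_ge E rho n : 2 <= E -> 0 <= rho -> rho <= E - 1 ->
  rho ^+ n <= cheb E n.+1.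
Proof.
move=> E2 r0 hr; elim: n => [|n IH]; first by rewrite expr0 cheb_ge1.
by rewrite exprS; apply: le_trans (cheb_ratio _ E2 hr); rewrite ler_wpM2l.
Qed.

(* The Christoffel-Darboux recursion
   [Q (n+1) = (E - E') u_(n+1) v_(n+1) + Q n], for [Q n = u_(n+1) v_n - v_(n+1) u_n]. *)
Lemma cheb_wronskian E E' rho beta n : 2 <= E' -> E' <= E -> 1 < rho ->
  rho <= E' - 1 -> rho ^+ 2 <= beta * (rho ^+ 2 - 1) ->
  0 <= cheb E n.+1 * cheb E' n - cheb E' n.+1 * cheb E n
    <= beta * (E - E') * (cheb E n * cheb E' n).
Proof.
move=> E2' EE r1 hr hb; have E2 := le_trans E2' EE.
have hr' : rho <= E - 1 by lra.
elim: n => [|n /andP[IH1 IH2]]; first by rewrite /cheb !mul0r !mulr0 subr0 lexx.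
have a0 := cheb_ge0 n E2; have b0 := cheb_ge0 n E2'.
have a1 := cheb_ratio n E2 hr'; have b1 := cheb_ratio n E2' hr.
rewrite !chebSS.
set u := cheb E n.+1 in IH1 IH2 a1 *; set v := cheb E' n.+1 in IH1 IH2 b1 *.
set p := cheb E n in IH1 IH2 a0 a1 *; set q := cheb E' n in IH1 IH2 b0 b1 *.
have u0 : 0 <= u by apply: le_trans a1; rewrite mulr_ge0 //; lra.
have v0 : 0 <= v by apply: le_trans b1; rewrite mulr_ge0 //; lra.
have -> : (E * u - p) * v - (E' * v - q) * u = (E - E') * (u * v) + (u * q - v * p) by ring.
have d0 : 0 <= E - E' by lra.
have uv0 : 0 <= u * v by rewrite mulr_ge0.
have pq0 : 0 <= p * q by rewrite mulr_ge0.
apply/andP; split; first by rewrite addr_ge0 // mulr_ge0.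
have uv : rho ^+ 2 * (p * q) <= u * v.
  rewrite (_ : _ * _ = (rho * p) * (rho * q)); last by ring.
  by rewrite ler_pM // mulr_ge0 //; lra.
have r2 : 1 < rho ^+ 2 by rewrite exprn_egt1.
have b0' : 0 <= beta.
  rewrite -(pmulr_lge0 _ (_ : 0 < rho ^+ 2 - 1)); last by lra.
  apply: le_trans hb; lra.
(* [beta] dominates the geometric series in rho^(-2), that is 1 + beta rho^(-2) <= beta. *)
suff : u * v + beta * (p * q) <= beta * (u * v).
  move=> h; have : (E - E') * (u * v + beta * (p * q)) <= (E - E') * (beta * (u * v)).
    by rewrite ler_wpM2l.
  lra.
rewrite -(ler_pM2l (_ : 0 < rho ^+ 2)); last by lra.
have h1 : beta * (rho ^+ 2 * (p * q)) <= beta * (u * v) by rewrite ler_wpM2l.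
have h2 : rho ^+ 2 * (u * v) <= beta * (rho ^+ 2 - 1) * (u * v) by rewrite ler_wpM2r.
lra.
Qed.

(** Each step adds one Wronskian term to the relative variation, so the rate grows linearly in n
    although the polynomial grows exponentially. *)
Lemma cheb_lipschitz E E' rho beta n : 2 <= E' -> E' <= E -> 1 < rho ->
  rho <= E' - 1 -> rho ^+ 2 <= beta * (rho ^+ 2 - 1) ->
  0 <= cheb E n.+1 - cheb E' n.+1 <= n%:R * beta * (E - E') * cheb E n.+1.
Proof.
move=> E2' EE r1 hr hb; have E2 := le_trans E2' EE.
have r2 : 1 < rho ^+ 2 by rewrite exprn_egt1.
have b0 : 0 <= beta.
  rewrite -(pmulr_lge0 _ (_ : 0 < rho ^+ 2 - 1)); last by lra.
  apply: le_trans hb; lra.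
have d0 : 0 <= E - E' by lra.
elim: n => [|n /andP[IH1 IH2]]; first by rewrite /cheb !mul0r subrr lexx.
have /andP[Q1 Q2] := cheb_wronskian n.+1 E2' EE r1 hr hb.
have v1 := cheb_ge1 n E2'; have v2 := cheb_ge1 n.+1 E2'.
have u1 := cheb_ge1 n E2; have [_ ui] := cheb_increment n.+1 E2.
set U := cheb E n.+2 in Q1 Q2 ui *; set V := cheb E' n.+2 in Q1 Q2 v2 *.
set u := cheb E n.+1 in IH1 IH2 Q1 Q2 u1 ui *.
set v := cheb E' n.+1 in IH1 IH2 Q1 Q2 v1 *.
have v0 : 0 < v by lra.
have e : (U - V) * v = (U * v - V * u) + V * (u - v) by ring.
apply/andP; split.
  by rewrite -(pmulr_lge0 _ v0) e addr_ge0 // mulr_ge0 //; lra.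
rewrite -(ler_pM2r v0) e -natr1.
have h1 : V * (u - v) <= V * (n%:R * beta * (E - E') * u) by rewrite ler_wpM2l //; lra.
have c0 : 0 <= n%:R * beta * (E - E') by rewrite !mulr_ge0.
have h2 : n%:R * beta * (E - E') * (V * u) <= n%:R * beta * (E - E') * (U * v).
  by rewrite ler_wpM2l //; lra.
have h3 : beta * (E - E') * (u * v) <= beta * (E - E') * (U * v).
  by rewrite ler_wpM2l ?mulr_ge0 // ler_wpM2r //; lra.
lra.
Qed.

End ChebyshevGrowth.

(** * Dependence of the initial point of the trace orbit on the energy *)

Section InitialCondition.
Context {R : realFieldType}.
Implicit Types (E lam : R).

(** With first coordinate 1 the invariant is the square of the difference of the other two. *)
Lemma sieved_fricke E lam n :
  fricke (sieved_trace E lam n.+1 0) (sieved_trace E lam n.+1 1)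
    (sieved_trace E lam n.+1 2) = (lam * cheb E n.+1 / 2) ^+ 2.
Proof. rewrite /sieved_trace trace_orbit0 trace_orbit1 trace_orbit2 /fricke /half_trace1.
by field. Qed.

Lemma sieved_trace_recurrence E lam l : trace_recurrence (sieved_trace E lam l).
Proof. by move=> n; exact: trace_orbitS. Qed.

Lemma half_trace0_gt1 E n : 2 < E -> 1 < half_trace0 E n.+1.
Proof.
move=> E2; rewrite /half_trace0 /=.
have [h0 h1] := cheb_increment n (ltW E2).
have : 2 * cheb E n.+1 < E * cheb E n.+1 by rewrite ltr_pM2r //; lra.
lra.
Qed.

(** The Pell equation for Chebyshev polynomials of both kinds. *)
Lemma half_trace0_sqr E n :
  half_trace0 E n.+1 ^+ 2 = 1 + cheb E n.+1 ^+ 2 * (E ^+ 2 - 4) / 4.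
Proof. by rewrite /half_trace0 /= -[X in _ = X + _](cheb_norm E n); field. Qed.

(** The Pell equation for T = x + W, divided by W^2, leaves the energy alone on the left. *)
Lemma half_trace1_expansion E lam n (W := lam * cheb E n.+1 / 2)
    (x := half_trace1 E lam n.+1) : lam != 0 -> W != 0 ->
  (E ^+ 2 - 4) / lam ^+ 2 - 1 = W^-1 ^+ 2 * (x ^+ 2 - 1) + 2 * (x * W^-1).
Proof.
move=> l0 W0; have hC : half_trace0 E n.+1 = x + W by rewrite /x /half_trace1 /W subrK.
have h : (x + W) ^+ 2 = 1 + W ^+ 2 * ((E ^+ 2 - 4) / lam ^+ 2).
  by rewrite -hC half_trace0_sqr /W; field.
have -> : (E ^+ 2 - 4) / lam ^+ 2 = ((x + W) ^+ 2 - 1) / W ^+ 2 by rewrite h; field; rewrite W0.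
by field.
Qed.

(* [half_trace1_expansion] recovers the energy from [x] up to [O(1/W)]; since [W]
   is Lipschitz only at the relative rate [L], differences of [x] dominate those of
   the energy and of [W] as soon as [L] is small compared with [W]. *)
Lemma initial_estimate E E' lam L n (W := lam * cheb E n.+1 / 2)
    (W' := lam * cheb E' n.+1 / 2)
    (D := `|half_trace1 E lam n.+1 - half_trace1 E' lam n.+1|) :
  4 < lam -> 2 <= E' -> E' <= E -> 0 <= L ->
  0 <= cheb E n.+1 - cheb E' n.+1 <= L * (E - E') * cheb E n.+1 ->
  2 * lam ^+ 2 * L <= W' - 1 ->
  `|half_trace1 E lam n.+1| <= 1 -> `|half_trace1 E' lam n.+1| <= 1 ->
  E - E' <= 2 * lam ^+ 2 * D /\ `|W - W'| <= D * (W - 1).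
Proof.
move=> lam4 E2' EE L0 /andP[ch0 ch1] hL x1 x1'.
have E2 := le_trans E2' EE.
have lam0 : 0 < lam by lra.
have d0 : 0 <= E - E' by lra.
have WW' : 0 <= W - W' by rewrite /W /W' -mulrBl -mulrBr divr_ge0 // mulr_ge0 // ltW.
have WL : W - W' <= L * (E - E') * W.
  rewrite /W /W' -mulrBl -mulrBr (_ : _ * (_ / 2) = lam * (L * (E - E') * cheb E n.+1) / 2); last by ring.
  by rewrite ler_pM2r ?invr_gt0 // ler_pM2l.
have l20 : 0 < lam ^+ 2 by rewrite exprn_gt0.
have lL : 0 <= 2 * lam ^+ 2 * L by apply: mulr_ge0 => //; lra.
have W1' : 1 <= W' by lra.
have W0 : 0 < W by lra.
have W0' : 0 < W' by lra.
have := half_trace1_expansion (lt0r_neq0 lam0) (lt0r_neq0 W0).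
have := half_trace1_expansion (lt0r_neq0 lam0) (lt0r_neq0 W0').
rewrite -/W -/W' /=; set x := half_trace1 E lam n.+1 in x1 D *.
set x' := half_trace1 E' lam n.+1 in x1' D *.
set p := W^-1; set p' := W'^-1 => e' e.
have p0 : 0 < p by rewrite invr_gt0.
have p0' : 0 < p' by rewrite invr_gt0.
have pW : p * W = 1 by rewrite mulVf ?gt_eqF.
have pW' : p' * W' = 1 by rewrite mulVf ?gt_eqF.
have pp : p <= p' by rewrite lef_pV2 ?posrE //; lra.
have p1' : p' <= 1 by rewrite invf_le1.
have D0 : 0 <= D by exact: normr_ge0.
have dp : p' - p <= L * (E - E') * p'.
  have -> : p' - p = p * (W - W') * p' by rewrite mulrBr mulrBl pW mul1r -mulrA (mulrC W') pW' mulr1.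
  rewrite ler_pM2r // (le_trans (y := p * (L * (E - E') * W))) //; first by rewrite ler_pM2l.
  by rewrite (mulrCA p) pW mulr1.
have A1 : x * p - x' * p' <= D * p + (p' - p).
  have := normM_sub_le p x p' x'; rewrite (gtr0_norm p0) (distrC p p') (ger0_norm (_ : 0 <= p' - p)); last by lra.
  have h : (p' - p) * `|x'| <= p' - p by rewrite ler_piMr //; lra.
  move=> hh.
  have := ler_norm (p * x - p' * x'); rewrite /D; lra.
have A2 : p ^+ 2 * (x ^+ 2 - 1) - p' ^+ 2 * (x' ^+ 2 - 1) <= 2 * D * p + 2 * (p' - p).
  clear e e' A1 dp WL hL lL ch0 ch1 WW' pW pW'.
  have s1 := norm_sqr_sub_le x1 x1'; have s2 := norm_1sub_sqr_le x1'.
  have s2' := ler_norm (1 - x' ^+ 2).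
  have s3 : x ^+ 2 - x' ^+ 2 <= 2 * D.
    apply: le_trans s1; rewrite -normrN; apply: le_trans (ler_norm _); lra.
  have s4 : p ^+ 2 * (x ^+ 2 - x' ^+ 2) <= p * (2 * D).
    apply: (le_trans (y := p ^+ 2 * (2 * D))); first by rewrite ler_pM2l // exprn_gt0.
    rewrite ler_wpM2r //; first by lra.
    by rewrite expr2 ler_piMr; lra.
  have s5 : (p' ^+ 2 - p ^+ 2) * (1 - x' ^+ 2) <= (p' ^+ 2 - p ^+ 2) * 1.
    by rewrite ler_wpM2l //; [rewrite subr_ge0 ler_pXn2r // ?nnegrE ltW|lra].
  have s6 : p' ^+ 2 - p ^+ 2 <= 2 * (p' - p).
    rewrite subr_sqr mulrC ler_wpM2r //; lra.
  lra.
have A3 : 4 * (E - E') <= ((E ^+ 2 - 4) / lam ^+ 2 - (E' ^+ 2 - 4) / lam ^+ 2) * lam ^+ 2.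
  rewrite -mulrBl divfK ?gt_eqF // (_ : _ - _ - _ = (E + E') * (E - E')); last by ring.
  by rewrite ler_wpM2r //; lra.
have A4 : (E ^+ 2 - 4) / lam ^+ 2 - (E' ^+ 2 - 4) / lam ^+ 2 <= 4 * D * p + 4 * (L * (E - E') * p').
  lra.
clear e e' A1 A2.
have A5 : 4 * (E - E') <= (4 * D * p + 4 * (L * (E - E') * p')) * lam ^+ 2.
  by apply: le_trans A3 _; rewrite ler_pM2r.
(* By [hL] the last term in [A5] is at most half of the left side there. *)
have A6 : 2 * lam ^+ 2 * L * p' <= 1.
  have : 2 * lam ^+ 2 * L * p' <= (W' - 1) * p' by rewrite ler_pM2r.
  rewrite mulrBl (mulrC W') pW'; lra.
have A7 : 2 * (lam ^+ 2 * L * p') * (E - E') <= E - E' by rewrite ler_piMl //; lra.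
(* The factor p = 1/W is kept: it cancels the W in the bound on W - W' below. *)
have A8 : E - E' <= 2 * lam ^+ 2 * (D * p) by lra.
have Dp : D * p <= D by rewrite ler_piMr //; lra.
split.
  by apply: le_trans A8 _; rewrite ler_wpM2l //; lra.
rewrite ger0_norm //.
apply: le_trans WL _.
have A9 : (E - E') * W <= 2 * lam ^+ 2 * D.
  have : (E - E') * W <= 2 * lam ^+ 2 * (D * p) * W by rewrite ler_pM2r.
  by rewrite -!mulrA pW mulr1 !mulrA.
have A10 : L * ((E - E') * W) <= L * (2 * lam ^+ 2 * D) by rewrite ler_wpM2l.
have A11 : 2 * lam ^+ 2 * L * D <= (W' - 1) * D by rewrite ler_wpM2r.
have A12 : (W' - 1) * D <= (W - 1) * D by rewrite ler_wpM2r //; lra.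
lra.
Qed.

End InitialCondition.

(** * Periodic approximants *)

Section CyclicMatrix.
Context {R : realType}.
Implicit Types (v : nat -> R) (mu : R).

(** Adding indicators keeps this the periodic operator also in sizes 1 and 2, where the two
    neighbours coincide. *)
Definition cyclic_matrix v p : 'M[R]_p.+1 :=
  \matrix_(i, j) ((j == ordS i)%:R + (j == ord_pred i)%:R + v i *+ (i == j)).

Lemma cyclic_matrix_sym v p : (cyclic_matrix v p)^T = cyclic_matrix v p.
Proof.
apply/matrixP => i j; rewrite !mxE.
have e (a b : 'I_p.+1) : (a == ordS b) = (b == ord_pred a).
  by apply/eqP/eqP => ->; rewrite ?ordSK ?ord_predK.
rewrite (e i j) -(e j i) [_%:R + _]addrC; congr (_ + _).
by rewrite [i == j]eq_sym; case: eqP => [->|_].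
Qed.

Lemma mul_cyclic_matrix v p (u : 'rV[R]_p.+1) j :
  (u *m cyclic_matrix v p) 0 j = u 0 (ord_pred j) + u 0 (ordS j) + v j * u 0 j.
Proof.
rewrite mxE; under eq_bigr => i _ do rewrite mxE !mulrDr.
rewrite !big_split /=; congr (_ + _ + _).
- rewrite (bigD1 (ord_pred j)) //= ord_predK eqxx mulr1 big1 ?addr0 // => i.
  by case: (j =P ordS i) => [->|_ _]; rewrite ?ordSK ?eqxx // mulr0.
- rewrite (bigD1 (ordS j)) //= ordSK eqxx mulr1 big1 ?addr0 // => i.
  by case: (j =P ord_pred i) => [->|_ _]; rewrite ?ord_predK ?eqxx // mulr0.
- rewrite (bigD1 j) //= eqxx mulr1n mulrC big1 ?addr0 // => i.
  by case: eqP => // _ _; rewrite mulr0n mulr0.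
Qed.

(** A determinant of 1 gives det (A - 1) = 2 - tr A; [k1] and [k2] are Cramer's rule. *)
Lemma act2_fixed_tr2 (A : @mat2 R) x : det2 A = 1 -> act2 A x = x -> x <> (0, 0) ->
  tr2 A = 2.
Proof.
case: A x => a b c d [x1 x2]; rewrite /det2 /act2 /tr2 /= => dA [e1 e2] x0.
apply/eqP; rewrite -subr_eq0; apply/eqP.
have k1 : (a + d - 2) * x1 = 0.
  have -> : (a + d - 2) * x1 = (a * d - b * c - 1) * x1 - (d - 1) * (a * x1 + b * x2 - x1)
    + b * (c * x1 + d * x2 - x2) by ring.
  by rewrite dA e1 e2; ring.
have k2 : (a + d - 2) * x2 = 0.
  have -> : (a + d - 2) * x2 = (a * d - b * c - 1) * x2 - (a - 1) * (c * x1 + d * x2 - x2)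
    + c * (a * x1 + b * x2 - x1) by ring.
  by rewrite dA e1 e2; ring.
apply/eqP; case: (eqVneq x1 0) => [x1e|x1n]; last first.
  by move/eqP: k1; rewrite mulf_eq0 (negPf x1n) orbF.
case: (eqVneq x2 0) => [x2e|x2n]; first by rewrite x1e x2e in x0.
by move/eqP: k2; rewrite mulf_eq0 (negPf x2n) orbF.
Qed.

(** An eigenvector, continued periodically, is fixed by the unimodular transfer matrix over one
    period. *)
Lemma cyclic_matrix_eigen lam n k mu (p := (n.+1 * size (fib_word k)).-1)
    (u : 'rV[R]_p.+1) :
  u != 0 -> u *m cyclic_matrix (word_potential lam n.+1 (fib_word k)) p = mu *: u ->
  sieved_trace mu lam n.+1 k.+2 = 1.
Proof.
set v := word_potential lam n.+1 _ => u0 hu.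
have sz0 : (0 < size (fib_word k))%N by apply: leq_ltn_trans (size_fib_word k).
have ep : p.+1 = (n.+1 * size (fib_word k))%N by rewrite /p prednK // muln_gt0.
(* Modulo [p.+1], [i + p] is i - 1: the shift by one of [word_transferP]. *)
pose th i := u 0 (inord ((i + p) %% p.+1)).
have hth i : (i < n.+1 * size (fib_word k))%N -> th i.+2 = (mu - v i) * th i.+1 - th i.
  rewrite -ep => hi; pose j : 'I_p.+1 := Ordinal hi.
  have e1 : th i.+1 = u 0 j.
    rewrite /th; congr (u 0 _); apply: val_inj; rewrite /= inordK ?ltn_mod //.
    by rewrite addSnnS modnDr modn_small.
  have e2 : th i.+2 = u 0 (ordS j).
    rewrite /th; congr (u 0 _); apply: val_inj; rewrite /= inordK ?ltn_mod //=.
    by rewrite addSnnS modnDr.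
  have e0 : th i = u 0 (ord_pred j).
    rewrite /th; congr (u 0 _); apply: val_inj; rewrite /= inordK ?ltn_mod //=.
    by rewrite addnS.
  have := congr1 (fun M : 'rV_p.+1 => M 0 j) hu; rewrite mul_cyclic_matrix mxE.
  by rewrite e0 e1 e2 -[nat_of_ord j]/i; lra.
have act := word_transferP hth.
have per i : th (p.+1 + i)%N = th i.
  by rewrite /th -addnA modnDl.
have p1 : th p.+2 = th 1%N by rewrite -[p.+2]addn1 per.
have p0 : th p.+1 = th 0%N by rewrite -[p.+1]addn0 per.
rewrite -ep p1 p0 in act.
have two : (2 : R) != 0 by rewrite pnatr_eq0.
have := tr2_fib_word mu lam n k two.
rewrite (act2_fixed_tr2 (det2_word_transfer _ _ _ _) act) => [|[t1 t0]].
  by move=> h; lra.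
have th0 i : (i <= p.+1)%N -> th i = 0 /\ th i.+1 = 0.
  elim: i => [//|i IH] hi; have [a b] := IH (ltnW hi).
  by split=> //; rewrite hth -?ep // a b; ring.
move/eqP: u0; apply; apply/rowP => j; rewrite mxE.
have [_ <-] := th0 j (ltnW (ltn_ord j)).
rewrite /th; congr (u 0 _); apply: val_inj; rewrite /= inordK ?ltn_mod //.
by rewrite addSnnS modnDr modn_small.
Qed.

End CyclicMatrix.

(** * Solving the Schrodinger equation on the line *)

Section IntervalSums.
Context {R : realType}.
Implicit Types (g : int -> R) (m : int) (n : nat).

Definition isum g m n : R := \sum_(0 <= i < n) g (m + i%:Z).

Let interval m n : seq int := [seq m + i%:Z | i <- iota 0 n].

Let isumE g m n : isum g m n = \sum_(k <- interval m n) g k.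
Proof. by rewrite /isum big_map /index_iota subn0. Qed.

Let uniq_interval m n : uniq (interval m n).
Proof. by rewrite map_inj_uniq ?iota_uniq // => i j /addrI []. Qed.

Lemma isum_le_esum g m n : (forall k, 0 <= g k) ->
  ((isum g m n)%:E <= \esum_(k in [set: int]) (g k)%:E)%E.
Proof.
move=> g0; apply: esum_ge; exists [set` interval m n].
  by split=> //; exact: finite_seq.
by rewrite isumE -sumEFin (fsbig_seq _ _ (uniq_interval m n)).
Qed.

Lemma esum_le_isum g (M : R) : (forall k, 0 <= g k) ->
  (forall m n, isum g m n <= M) -> (\esum_(k in [set: int]) (g k)%:E <= M%:E)%E.
Proof.
move=> g0 h; apply: ge_ereal_sup => _ [F [finF _] <-].
rewrite fsbig_finite // sumEFin lee_fin.
set s := finmap.enum_fset _; have us : uniq s by exact: finmap.fset_uniq.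
pose N := \max_(k <- s) `|k|%N.
have sN k : k \in s -> (`|k| <= N)%N by move=> ks; rewrite /N (big_rem k ks) leq_maxl.
apply: le_trans (h (- N%:Z) (N + N).+1); rewrite isumE.
rewrite (perm_big [seq k <- interval (- N%:Z) (N + N).+1 | k \in s]); last first.
  apply: uniq_perm; rewrite ?filter_uniq // => k.
  rewrite mem_filter; case ks: (k \in s) => //=; symmetry.
  apply/mapP; exists (absz (k + N%:Z)%R); last by have := sN _ ks; lia.
  by rewrite mem_iota; have := sN _ ks; lia.
rewrite big_filter big_mkcond; apply: ler_sum => k _.
by case: ifP.
Qed.

Lemma isum_le_support g m n m' n' : (forall k, 0 <= g k) ->
  (forall k, ~~ (m' <= k < m' + n'%:Z) -> g k = 0) -> isum g m n <= isum g m' n'.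
Proof.
move=> g0 supp; rewrite !isumE (bigID (fun k => k \in interval m' n')) /=.
rewrite [X in _ + X]big1 ?addr0 => [|k kI]; last first.
  apply: supp; apply: contra kI => /andP[k1 k2].
  by apply/mapP; exists (absz (k - m')); [rewrite mem_iota|]; lia.
rewrite -big_filter (perm_big [seq k <- interval m' n' | k \in interval m n]); last first.
  by apply: uniq_perm; rewrite ?filter_uniq // => k; rewrite !mem_filter andbC.
rewrite big_filter big_mkcond; apply: ler_sum => k _.
by case: ifP.
Qed.

Lemma ler_isum g1 g2 m n : (forall k, g1 k <= g2 k) -> isum g1 m n <= isum g2 m n.
Proof. by move=> h; apply: ler_sum => i _. Qed.

Lemma isumD g1 g2 m n : isum (fun k => g1 k + g2 k) m n = isum g1 m n + isum g2 m n.
Proof. by rewrite /isum big_split. Qed.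

Lemma isumZ a g m n : isum (fun k => a * g k) m n = a * isum g m n.
Proof. by rewrite /isum mulr_sumr. Qed.

Lemma isum_shift g m n (a : int) : isum (fun k => g (k + a)) m n = isum g (m + a) n.
Proof. by apply: eq_bigr => i _; rewrite addrAC. Qed.

Lemma isum_const_eq0 g (c Q : R) : (forall m n, isum (fun k => `|g k|) m n <= Q) ->
  (forall n, exists m, forall i, (i < n)%N -> g (m + i%:Z) = c) -> c = 0.
Proof.
move=> hQ hc; apply/eqP; rewrite -normr_eq0 eq_le normr_ge0 andbT leNgt.
apply/negP => c0.
have nQ n : n%:R * `|c| <= Q.
  have [m hm] := hc n; apply: le_trans (hQ m n); rewrite /isum.
  rewrite (eq_big_nat _ _ (F2 := fun=> `|c|)); last by move=> i /andP[_ hi]; rewrite hm.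
  by rewrite sumr_const_nat subn0 mulr_natl.
have := archi_boundP (_ : 0 <= Q / `|c|); rewrite ltr_pdivrMr // => h.
have Q0 : 0 <= Q by apply: le_trans (nQ 0%N); rewrite mul0r.
by have := nQ (Num.bound (Q / `|c|)); rewrite leNgt h // divr_ge0.
Qed.

End IntervalSums.

Lemma ultra_fmap (T U : Type) (f : T -> U) (G : set_system T) :
  UltraFilter G -> UltraFilter (f @ G).
Proof.
move=> UG; split=> [|H PH sub]; first exact: fmap_proper_filter.
rewrite predeqE => A; split=> [HA|]; last exact: sub.
have [//|GA] := in_ultra_setVsetC (f @^-1` A) UG.
have : H (A `&` ~` A) by apply: filterI => //; exact: sub.
by rewrite setICr => /filter_not_empty.
Qed.

Section SecondOrderDifference.
Context {R : realType}.
Variables (V : int -> R) (E : R).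
Implicit Types (u f phi : int -> R).

Definition solves u f := forall k, u (k - 1) + u (k + 1) + V k * u k - E * u k = f k.

Definition sq_bounded u (F : R) := forall m n, isum (fun k => u k ^+ 2) m n <= F.

(** A finite-volume form of a bounded inverse: C is uniform in N, and nothing is asked of the
    equation off the window. *)
Definition locally_solvable (C : R) := forall (N : nat) f (F : R), sq_bounded f F ->
  exists2 u, sq_bounded u (C * F) &
    forall k : int, (`|k| <= N)%N ->
      u (k - 1) + u (k + 1) + V k * u k - E * u k = f k.

Lemma sq_bounded_norm u F k : sq_bounded u F -> `|u k| <= 1 + F.
Proof.
move=> /(_ k 1%N); rewrite /isum big_nat1 addr0 => h.
have [u1|u1] := lerP `|u k| 1.
  by have := sqr_ge0 (u k); lra.
suff : `|u k| <= `|u k| ^+ 2 by rewrite real_normK ?num_real //; lra.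
by rewrite expr2 ler_peMr //; exact: ltW.
Qed.

(** The values at each site are bounded, so they converge along one ultrafilter finer than [\oo];
    this replaces a diagonal subsequence, and the bounds on finite sums pass to the limit. *)
Lemma locally_solvable_solves C f F : locally_solvable C -> sq_bounded f F ->
  exists2 u, sq_bounded u (C * F) & solves u f.
Proof.
move=> loc fF.
have /boolp.choice[u hu] : forall N : nat, exists u, sq_bounded u (C * F) /\
    forall k : int, (`|k| <= N)%N -> u (k - 1) + u (k + 1) + V k * u k - E * u k = f k.
  by move=> N; have [u u1 u2] := loc N f F fF; exists u.
have [G [ultraG subG]] := ultraFilterLemma (F := \oo : set_system nat) _.
have limit k : exists l : R, u N k @[N --> G] --> l.
  have hG : (u ^~ k @ G) `[- (1 + C * F), 1 + C * F]%classic.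
    suff -> : (u ^~ k @ G) `[- (1 + C * F), 1 + C * F]%classic = G setT by exact: filterT.
    congr G; apply/seteqP; split=> // N _ /=.
    by rewrite in_itv /= -ler_norml; apply: sq_bounded_norm; exact: (hu N).1.
  have := @segment_compact R (- (1 + C * F)) (1 + C * F); rewrite compact_ultra.
  by move=> /(_ _ (ultra_fmap (u ^~ k) ultraG) hG) [l [_ hl]]; exists l.
have {limit} /boolp.choice[l hl] := limit.
exists l => [m n|k].
  have : isum (fun k => u N k ^+ 2) m n @[N --> G] --> isum (fun k => l k ^+ 2) m n.
    elim: n => [|n IH].
      rewrite /isum big_nil; under eq_fun do rewrite big_nil.
      exact: cvg_cst.
    have e g : isum g m n.+1 = isum g m n + g (m + n%:Z) by rewrite /isum big_nat_recr.
    rewrite e; under eq_fun do rewrite e.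
    apply: cvgD => //; rewrite expr2; under eq_fun do rewrite expr2.
    by apply: cvgM; exact: hl.
  move=> h; rewrite -(cvg_lim _ h) //; apply: limr_le; first by apply/cvg_ex; eexists; exact: h.
  by near=> N; exact: (hu N).1.
have h1 : u N (k - 1) + u N (k + 1) + V k * u N k - E * u N k @[N --> G] -->
    l (k - 1) + l (k + 1) + V k * l k - E * l k.
  apply: cvgB; last by apply: cvgM; [exact: cvg_cst|exact: hl].
  apply: cvgD; last by apply: cvgM; [exact: cvg_cst|exact: hl].
  by apply: cvgD; exact: hl.
have h2 : u N (k - 1) + u N (k + 1) + V k * u N k - E * u N k @[N --> G] --> f k.
  apply: cvg_near_cst; apply: subG; exists `|k|%N => // N /= hN.
  by rewrite (hu N).2.
by apply: (@cvg_unique _ _ _ _ _ _ h1 h2).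
Unshelve. all: by end_near. Qed.

(* The Wronskian of [phi] with a square-summable solution for a point source at [k0]
   is summable, constant on both sides of [k0], and jumps there by [- phi k0]. *)
Lemma locally_solvable_kernel C phi P : locally_solvable C -> sq_bounded phi P ->
  solves phi (fun=> 0) -> forall k, phi k = 0.
Proof.
move=> loc phiP phi0 k0.
pose f k : R := (k == k0)%:R.
have f1 : sq_bounded f 1.
  move=> m n; have -> : isum (fun k => f k ^+ 2) m n = (count (fun i => m + i%:Z == k0) (iota 0 n))%:R.
    rewrite /isum /index_iota subn0 -sum1_count natr_sum [RHS]big_mkcond /=.
    by apply: eq_bigr => i _; rewrite /f; case: eqP => _; rewrite ?expr1n ?expr0n.
  rewrite -[leRHS]/(1%N%:R) ler_nat; have [[i hi]|no] := pselect (exists i : nat, m + i%:Z = k0).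
    apply: leq_trans (_ : count_mem i (iota 0 n) <= 1)%N.
      by apply: sub_count => j /= /eqP; rewrite -hi => /addrI [->].
    by rewrite count_uniq_mem ?iota_uniq // leq_b1.
  rewrite (eq_count (a2 := pred0)) ?count_pred0 // => i /=.
  by apply/negbTE/eqP => h; apply: no; exists i.
have [u uC uf] := locally_solvable_solves loc f1.
pose w k := phi (k + 1) * u k - phi k * u (k + 1).
have wE k : w k = w (k - 1) - phi k * f k.
  rewrite /w subrK -(uf k).
  have -> : phi (k + 1) = - phi (k - 1) - V k * phi k + E * phi k.
    by have := phi0 k; lra.
  ring.
have wk k : k != k0 -> w k = w (k - 1).
  by move=> hk; rewrite wE /f (negPf hk) mulr0 subr0.
have wfw (i : nat) : w (k0 + i%:Z) = w k0.
  elim: i => [|i <-]; first by rewrite addr0.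
  rewrite wk; last by lia.
  by congr w; lia.
have wbw (i : nat) : w (k0 - 1 - i%:Z) = w (k0 - 1).
  elim: i => [|i <-]; first by rewrite subr0.
  by rewrite [RHS]wk; [congr w|]; lia.
have wQ m n : isum (fun k => `|w k|) m n <= P + C * 1.
  apply: (le_trans (y := isum (fun k => 2^-1 * (phi (k + 1) ^+ 2 + phi k ^+ 2) + 2^-1 * (u k ^+ 2 + u (k + 1) ^+ 2)) m n)).
    apply: ler_isum => k; rewrite /w.
    move: (phi (k + 1)) (phi k) (u k) (u (k + 1)) => a b c d.
    by rewrite ler_norml; apply/andP; split; have := sqr_ge0 (a - c); have := sqr_ge0 (a + c);
      have := sqr_ge0 (b - d); have := sqr_ge0 (b + d); nra.
  rewrite isumD !isumZ !isumD.
  rewrite (isum_shift (fun k => phi k ^+ 2)) (isum_shift (fun k => u k ^+ 2)).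
  have := phiP (m + 1) n; have := phiP m n; have := uC (m + 1) n; have := uC m n; lra.
have w1 : w k0 = 0.
  by apply: (isum_const_eq0 wQ) => n; exists k0 => i _; exact: wfw.
have w2 : w (k0 - 1) = 0.
  apply: (isum_const_eq0 wQ) => n; exists (k0 - n%:Z) => i hi.
  by rewrite -(wbw (n - i.+1)%N); congr w; lia.
by have := wE k0; rewrite w1 w2 /f eqxx mulr1; lra.
Qed.

End SecondOrderDifference.

(** * From local solvability to the resolvent set *)

Section Resolvent.
Context {R : realType}.
Local Open Scope complex_scope.
Implicit Types (psi phi : int -> R[i]).

Lemma abs_sq_ge0 (z : R[i]) : 0 <= abs_sq z.
Proof. by rewrite addr_ge0 ?sqr_ge0. Qed.

Lemma l2sq_le psi (M : R) : (forall m n, isum (fun k => abs_sq (psi k)) m n <= M) ->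
  (l2sq psi <= M%:E)%E.
Proof. by apply: esum_le_isum => k; exact: abs_sq_ge0. Qed.

Lemma l2sq_ge0 psi : (0 <= l2sq psi)%E.
Proof. by apply: esum_ge0 => k _; rewrite lee_fin abs_sq_ge0. Qed.

Lemma l2sq_fin psi : l2 psi -> l2sq psi = (fine (l2sq psi))%:E.
Proof. by move=> h; rewrite fineK // ge0_fin_numE // l2sq_ge0. Qed.

Lemma isum_le_l2sq psi m n : l2 psi ->
  isum (fun k => abs_sq (psi k)) m n <= fine (l2sq psi).
Proof.
move=> h; rewrite -lee_fin -l2sq_fin //.
by apply: isum_le_esum => k; exact: abs_sq_ge0.
Qed.

Lemma l2_isum psi (M : R) : (forall m n, isum (fun k => abs_sq (psi k)) m n <= M) -> l2 psi.
Proof. by move=> /l2sq_le h; apply: le_lt_trans h _; rewrite ltry. Qed.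

Lemma l2norm_le psi (M : R) : (forall m n, isum (fun k => abs_sq (psi k)) m n <= M) ->
  l2norm psi <= Num.sqrt M.
Proof.
move=> h; apply: ler_wsqrtr; rewrite -lee_fin -l2sq_fin; first exact: l2sq_le.
exact: l2_isum h.
Qed.

Lemma sq_bounded_Re psi : l2 psi ->
  sq_bounded (fun k => complex.Re (psi k)) (fine (l2sq psi)).
Proof.
move=> h m n; apply: le_trans (isum_le_l2sq m n h); apply: ler_isum => k.
by rewrite /abs_sq lerDl sqr_ge0.
Qed.

Lemma sq_bounded_Im psi : l2 psi ->
  sq_bounded (fun k => complex.Im (psi k)) (fine (l2sq psi)).
Proof.
move=> h m n; apply: le_trans (isum_le_l2sq m n h); apply: ler_isum => k.
by rewrite /abs_sq lerDr sqr_ge0.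
Qed.

Lemma l2_combination (a : R[i]) psi phi : l2 psi -> l2 phi -> l2 (a *: psi + phi).
Proof.
move=> h1 h2.
apply: (@l2_isum _ (2 * abs_sq a * fine (l2sq psi) + 2 * fine (l2sq phi))) => m n.
apply: (le_trans (y := isum (fun k => 2 * abs_sq a * abs_sq (psi k) + 2 * abs_sq (phi k)) m n)).
  apply: ler_isum => k; rewrite /abs_sq.
  rewrite (_ : (a *: psi + phi) k = a * psi k + phi k) //.
  case: a => a b; case: (psi k) => c d; case: (phi k) => e f /=.
  set x := a * c - b * d; set y := a * d + b * c.
  have : 2 * (a ^+ 2 + b ^+ 2) * (c ^+ 2 + d ^+ 2) = 2 * x ^+ 2 + 2 * y ^+ 2.
    by rewrite /x /y; ring.
  have := sqr_ge0 (x - e); have := sqr_ge0 (y - f); nra.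
rewrite isumD !isumZ lerD // ler_wpM2l ?isum_le_l2sq //.
by rewrite mulr_ge0 // abs_sq_ge0.
Qed.

Definition schrodinger (V : int -> R) psi : int -> R[i] :=
  fun n => psi (n - 1) + psi (n + 1) + (V n)%:C * psi n.

Lemma schrodinger_Re V (E : R) psi k :
  complex.Re ((schrodinger V psi - E%:C *: psi) k) =
  complex.Re (psi (k - 1)) + complex.Re (psi (k + 1)) + V k * complex.Re (psi k)
    - E * complex.Re (psi k).
Proof.
rewrite (_ : (schrodinger V psi - E%:C *: psi) k = schrodinger V psi k - E%:C * psi k) //.
rewrite /schrodinger; case: (psi k) (psi (k - 1)) (psi (k + 1)) => a b [c d] [e f] /=.
ring.
Qed.

Lemma schrodinger_Im V (E : R) psi k :
  complex.Im ((schrodinger V psi - E%:C *: psi) k) =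
  complex.Im (psi (k - 1)) + complex.Im (psi (k + 1)) + V k * complex.Im (psi k)
    - E * complex.Im (psi k).
Proof.
rewrite (_ : (schrodinger V psi - E%:C *: psi) k = schrodinger V psi k - E%:C * psi k) //.
rewrite /schrodinger; case: (psi k) (psi (k - 1)) (psi (k + 1)) => a b [c d] [e f] /=.
ring.
Qed.

Lemma complex_eqP (z z' : R[i]) : complex.Re z = complex.Re z' ->
  complex.Im z = complex.Im z' -> z = z'.
Proof. by case: z; case: z' => a b c d /= -> ->. Qed.

(** V and E are real, so real and imaginary parts are solved separately, each with squared norm at
    most C times that of f. The inverse B is a choice of preimages; its linearity comes from
    uniqueness. *)
Lemma locally_solvable_resolvent V (E C : R) : 0 <= C -> locally_solvable V E C ->
  resolvent_set (schrodinger V) E%:C.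
Proof.
move=> C0 loc; set T := schrodinger V; set z := E%:C.
have kernel psi : l2 psi -> T psi - z *: psi = 0 -> psi = 0.
  move=> lpsi h; apply: funext => k; apply: complex_eqP.
    apply: (locally_solvable_kernel loc (sq_bounded_Re lpsi)) => j.
    by rewrite -schrodinger_Re -/T -/z h.
  apply: (locally_solvable_kernel loc (sq_bounded_Im lpsi)) => j.
  by rewrite -schrodinger_Im -/T -/z h.
have Tlin (a : R[i]) u1 u2 : T (a *: u1 + u2) - z *: (a *: u1 + u2) =
    a *: (T u1 - z *: u1) + (T u2 - z *: u2).
  apply: funext => k.
  rewrite (_ : (T (a *: u1 + u2) - z *: (a *: u1 + u2)) k =
    (a * u1 (k - 1) + u2 (k - 1)) + (a * u1 (k + 1) + u2 (k + 1)) +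
    (V k)%:C * (a * u1 k + u2 k) - z * (a * u1 k + u2 k)) //.
  rewrite (_ : (a *: (T u1 - z *: u1) + (T u2 - z *: u2)) k =
    a * (u1 (k - 1) + u1 (k + 1) + (V k)%:C * u1 k - z * u1 k) +
    (u2 (k - 1) + u2 (k + 1) + (V k)%:C * u2 k - z * u2 k)) //.
  ring.
have uniq u1 u2 : l2 u1 -> l2 u2 -> T u1 - z *: u1 = T u2 - z *: u2 -> u1 = u2.
  move=> l1 l2' h.
  have l3 := l2_combination (-1) l1 l2'.
  have := kernel _ l3; rewrite Tlin h scaleN1r addNr => /(_ erefl).
  by rewrite scaleN1r addrC => /eqP; rewrite subr_eq0 => /eqP ->.
have exist f : l2 f -> exists u, [/\ l2 u, T u - z *: u = f &
    l2norm u <= Num.sqrt (2 * C) * l2norm f].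
  move=> lf.
  have [u1 b1 s1] := locally_solvable_solves loc (sq_bounded_Re lf).
  have [u2 b2 s2] := locally_solvable_solves loc (sq_bounded_Im lf).
  pose u k := Complex (u1 k) (u2 k).
  have bu m n : isum (fun k => abs_sq (u k)) m n <= 2 * C * fine (l2sq f).
    have e : isum (fun k => abs_sq (u k)) m n =
        isum (fun k => u1 k ^+ 2) m n + isum (fun k => u2 k ^+ 2) m n by rewrite -isumD.
    have := b1 m n; have := b2 m n; rewrite e; lra.
  exists u; split; first exact: l2_isum bu.
    apply: funext => k; apply: complex_eqP.
      by rewrite schrodinger_Re -s1.
    by rewrite schrodinger_Im -s2.
  apply: le_trans (l2norm_le bu) _; rewrite sqrtrM //.
  by rewrite mulr_ge0.
pose B f := if pselect (exists u, l2 u /\ T u - z *: u = f) is left h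
  then projT1 (cid h) else 0.
have BP f : (exists u, l2 u /\ T u - z *: u = f) -> l2 (B f) /\ T (B f) - z *: B f = f.
  move=> ex; rewrite /B; case: pselect => [h|[]//].
  exact: (projT2 (cid h)).
have BP' f : l2 f -> l2 (B f) /\ T (B f) - z *: B f = f.
  by move=> /exist [u [u1 u2 _]]; apply: BP; exists u.
exists B.
  split; first by move=> f /BP'[].
    move=> a f g lf lg; have [l1 e1] := BP' _ lf; have [l2' e2] := BP' _ lg.
    have [l3 e3] := BP' _ (l2_combination a lf lg).
    by apply: uniq => //; [exact: l2_combination|rewrite Tlin e1 e2].
  exists (Num.sqrt (2 * C)) => f lf; have [l1 e1] := BP' _ lf.
  have [u [lu eu nu]] := exist _ lf.
  by rewrite (uniq _ u l1 lu) // e1 eu.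
move=> psi lpsi; split; last by have [] := BP' _ lpsi.
have ex : exists u, l2 u /\ T u - z *: u = T psi - z *: psi by exists psi.
by have [l1 e1] := BP _ ex; exact: uniq.
Qed.

End Resolvent.

Section SievedResolvent.
Context {R : realType}.
Implicit Types (lam E mu e : R).

Lemma sieved_potential_window lam n (w : int -> bool) (s : int) (u : seq bool) (j L : nat) :
  (forall i : nat, (i < L)%N -> w (s + i%:Z) = nth false u (j + i)) ->
  forall i : nat, (i < n.+1 * L)%N ->
    sieved_potential lam n.+1 w (n.+1%:Z * s + i%:Z) =
    word_potential lam n.+1 u (n.+1 * j + i).
Proof.
move=> hw i hi; rewrite /sieved_potential /word_potential.
have -> : (n.+1%:Z %| (n.+1%:Z * s + i%:Z))%Z = (n.+1 %| i)%N.
  by rewrite rpredDl ?dvdz_mulr // dvdzE.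
rewrite dvdn_addr ?dvdn_mulr //; case: ifP => // /dvdnP[q e].
have hq : (q < L)%N by rewrite e in hi; nia.
rewrite e mulnC -mulnDr mulKn // -hw // PoszM -mulrDr mulKz //.
Qed.

(* A window of the potential is also a window of the cyclic Jacobi matrix of a long
   word [fib_word k]. An eigenvalue [mu] of that matrix has half-trace 1, so the
   matrix has no spectrum within [e] of [E]. *)
Lemma sieved_locally_solvable lam n (w : int -> bool) E e k0 :
  fib_subshift w -> 0 < e ->
  (forall mu, `|mu - E| < e -> forall k, (k0 <= k)%N -> 1 < `|sieved_trace mu lam n.+1 k|) ->
  locally_solvable (sieved_potential lam n.+1 w) E (e ^- 2).
Proof.
move=> hw e0 gap N f F fF.
(* The margin keeps the window and its neighbours away from the wrap-around of the cyclic matrix. *)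
pose N' := N.+2; pose L := (N' + N').+1.
have [j hj] := fib_subshift_window (- N'%:Z) hw (isT : (0 < L)%N).
pose k := maxn k0 (j + L)%N.
have hk : (j + L <= k)%N by rewrite leq_maxr.
have hpot := @sieved_potential_window lam n _ _ _ _ _ (hj k hk).
have szk := size_fib_word k.
pose p := (n.+1 * size (fib_word k)).-1.
have ep : p.+1 = (n.+1 * size (fib_word k))%N.
  by rewrite /p prednK // muln_gt0 /=; lia.
pose v := word_potential lam n.+1 (fib_word k).
pose A := cyclic_matrix v p.
have eig (mu : R) (x : 'rV[R]_p.+1) : x != 0 -> x *m A = mu *: x -> e <= `|mu - E|.
  move=> x0 /(cyclic_matrix_eigen x0) ht; rewrite leNgt; apply/negP => he.
  have := gap _ he k.+2; rewrite ht normr1 ltxx => h.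
  suff : false by []. apply: h; rewrite /k; lia.
(* The row of the cyclic matrix that stands for site 0 of the line. *)
pose j0 : nat := (n.+1 * (j + N'))%N.
pose g : 'rV[R]_p.+1 := \row_i f (i%:Z - j0%:Z).
have [u uE un] := symmetric_solve (cyclic_matrix_sym v p) e0 eig g.
have gF : \sum_i g 0 i ^+ 2 <= F.
  apply: le_trans (fF (- j0%:Z) p.+1); rewrite /isum big_mkord; apply: ler_sum => i _.
  by rewrite mxE addrC.
pose U (a : int) : R := if 0 <= a + j0%:Z < p.+1%:Z then u 0 (inord (absz (a + j0%:Z))) else 0.
have Uin (i : 'I_p.+1) : U (i%:Z - j0%:Z) = u 0 i.
  by rewrite /U subrK ltz_nat ltn_ord /= inord_val.
exists U.
  move=> m q; apply: (le_trans (y := isum (fun a => U a ^+ 2) (- j0%:Z) p.+1)).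
    apply: isum_le_support => a; first exact: sqr_ge0.
    move=> ha; rewrite /U ifF ?expr0n //; apply/negP => h; move/negP: ha; apply.
    by lia.
  have -> : isum (fun a => U a ^+ 2) (- j0%:Z) p.+1 = \sum_i u 0 i ^+ 2.
    rewrite /isum big_mkord; apply: eq_bigr => i _.
    by rewrite addrC Uin.
  by rewrite ler_pdivlMl ?exprn_gt0 //; apply: le_trans un gF.
move=> a ha.
have hi1 : (0 <= a + j0%:Z - 1)%R by rewrite /j0 /N'; nia.
have hi2 : (a + j0%:Z + 1 < p.+1%:Z)%R by rewrite ep /j0 /N'; rewrite /L /N' in hk; nia.
have [i ei] : exists i : nat, a + j0%:Z = i.+1%:Z by exists (absz (a + j0%:Z - 1)%R); lia.
have hi : (i.+2 < p.+1)%N by lia.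
pose o0 : 'I_p.+1 := Ordinal (ltn_trans (ltnSn i) (ltn_trans (ltnSn i.+1) hi)).
pose o1 : 'I_p.+1 := Ordinal (ltn_trans (ltnSn i.+1) hi).
pose o2 : 'I_p.+1 := Ordinal hi.
have U1 : U a = u 0 o1 by rewrite -Uin; congr U; rewrite /o1 /=; lia.
have U0 : U (a - 1) = u 0 o0 by rewrite -Uin; congr U; rewrite /o0 /=; lia.
have U2 : U (a + 1) = u 0 o2 by rewrite -Uin; congr U; rewrite /o2 /=; lia.
have P1 : ord_pred o1 = o0.
  by apply: val_inj; rewrite /= modnDr modn_small //; lia.
have S1 : ordS o1 = o2 by apply: val_inj; rewrite /= modn_small.
have := congr1 (fun M : 'rV_p.+1 => M 0 o1) uE.
rewrite mulmxBr mul_mx_scalar mxE mul_cyclic_matrix P1 S1 -U0 -U1 -U2 !mxE -U1.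
have -> : f (o1%:Z - j0%:Z) = f a by congr f; rewrite /=; lia.
move=> <-; congr (_ + _ * _ - _).
have hb : exists2 b : nat, a = n.+1%:Z * (- N'%:Z) + b%:Z & (b < n.+1 * L)%N.
  by exists (absz (a + n.+1%:Z * N'%:Z)%R); rewrite /L /N'; nia.
have [b eb hbL] := hb.
rewrite eb hpot // /v; congr (word_potential _ _ _ _).
by rewrite /= ; move: ei; rewrite eb /j0; nia.
Qed.

End SievedResolvent.

(** * Floquet solutions and approximate eigenvectors *)

Section FloquetSolutions.
Context {R : realType}.
Implicit Types (v : nat -> R) (E x y : R).

Fixpoint recurrence_solution v E (q : R * R) (i : nat) : R * R :=
  if i is j.+1 then
    let r := recurrence_solution v E q j in (r.2, (E - v j) * r.2 - r.1)
  else q.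

(* [p + i q] is an eigenvector for the eigenvalue [x + i y] of modulus 1. *)
Lemma floquet_vector (A : @mat2 R) x y : det2 A = 1 -> tr2 A = 2 * x ->
  x ^+ 2 + y ^+ 2 = 1 ->
  exists p q : R * R,
    [/\ act2 A p = (x * p.1 - y * q.1, x * p.2 - y * q.2),
        act2 A q = (y * p.1 + x * q.1, y * p.2 + x * q.2) &
        0 < p.1 ^+ 2 + p.2 ^+ 2 + q.1 ^+ 2 + q.2 ^+ 2].
Proof.
case: A => a b c d; rewrite /det2 /tr2 /act2 /= => dA tA xy.
have dE : d = 2 * x - a by lra.
(* The eigenvector is (b, x - a + i y). If it vanishes, the matrix is lower triangular with diagonal
   entries x, and (0, 1) is an eigenvector. *)
have [h|h] := ltrP 0 (b ^+ 2 + (x - a) ^+ 2 + y ^+ 2).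
  exists (b, x - a), (0, y) => /=; split; last by rewrite expr0n /=; lra.
    by congr pair; [ring|rewrite dE in dA *; nra].
  by congr pair; rewrite ?dE; ring.
have b0 := sqr_ge0 b; have xa0 := sqr_ge0 (x - a); have y0 := sqr_ge0 y.
have /eqP : b ^+ 2 = 0 by lra.
have /eqP : (x - a) ^+ 2 = 0 by lra.
have /eqP : y ^+ 2 = 0 by lra.
rewrite !sqrf_eq0 => /eqP ye /eqP xe /eqP be.
have ae : a = x by lra.
exists (0, 1), (0, 0) => /=; rewrite expr1n !expr0n /=; split; last by lra.
  by rewrite be dE ye ae; congr pair; ring.
by rewrite ye; congr pair; ring.
Qed.

(** As |x| <= 1, x + i sqrt(1 - x^2) is an eigenvalue of modulus 1; the solution a + i b is
    multiplied by it over each period, so its squared modulus is periodic. *)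
Lemma floquet_solution v E lam n u x : (0 < size u)%N ->
  (forall i, (i < n.+1 * size u)%N -> v i = word_potential lam n.+1 u i) ->
  (forall i, v (i + n.+1 * size u)%N = v i) ->
  tr2 (word_transfer E lam n.+1 u) = 2 * x -> `|x| <= 1 ->
  exists a b : nat -> R,
  [/\ forall i, a i.+2 = (E - v i) * a i.+1 - a i,
      forall i, b i.+2 = (E - v i) * b i.+1 - b i,
      forall i, a (i + n.+1 * size u)%N ^+ 2 + b (i + n.+1 * size u)%N ^+ 2 = a i ^+ 2 + b i ^+ 2
    & 0 < a 0%N ^+ 2 + b 0%N ^+ 2 + (a 1%N ^+ 2 + b 1%N ^+ 2)].
Proof.
move=> u0 vw vper tx /ler_normlP[x1 x2]; set p := (n.+1 * size u)%N in vw vper *.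
have xy : x ^+ 2 + Num.sqrt (1 - x ^+ 2) ^+ 2 = 1 by rewrite sqr_sqrtr; [lra|nra].
have [r [s [er es rs0]]] := floquet_vector (det2_word_transfer E lam n u) tx xy.
set y := Num.sqrt _ in xy er es.
pose a i := (recurrence_solution v E (r.2, r.1) i).1.
pose b i := (recurrence_solution v E (s.2, s.1) i).1.
have aS i : a i.+2 = (E - v i) * a i.+1 - a i by [].
have bS i : b i.+2 = (E - v i) * b i.+1 - b i by [].
have wa : act2 (word_transfer E lam n.+1 u) (a 1%N, a 0%N) = (a p.+1, a p).
  by apply: word_transferP => i hi; rewrite aS vw.
have wb : act2 (word_transfer E lam n.+1 u) (b 1%N, b 0%N) = (b p.+1, b p).
  by apply: word_transferP => i hi; rewrite bS vw.
have ea : (a 1%N, a 0%N) = r by rewrite /a /=; case: (r).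
have eb : (b 1%N, b 0%N) = s by rewrite /b /=; case: (s).
rewrite ea er in wa; rewrite eb es in wb.
have per i : [/\ a (i + p)%N = x * a i - y * b i, b (i + p)%N = y * a i + x * b i,
    a (i.+1 + p)%N = x * a i.+1 - y * b i.+1 & b (i.+1 + p)%N = y * a i.+1 + x * b i.+1].
  elim: i => [|i [h1 h2 h3 h4]].
    rewrite add0n add1n; case: wa => <- <-; case: wb => <- <-.
    by rewrite -ea -eb.
  split=> //.
    by rewrite !addSn aS vper -addSn h3 h1 aS bS; ring.
  by rewrite !addSn bS vper -addSn h4 h2 aS bS; ring.
exists a, b; split=> //.
  by move=> i; have [-> -> _ _] := per i; nra.
have : 0 < (r.1 ^+ 2 + r.2 ^+ 2 + s.1 ^+ 2 + s.2 ^+ 2) by [].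
by rewrite -ea -eb /=; lra.
Qed.

End FloquetSolutions.

Section Weyl.
Context {R : realType}.
Local Open Scope complex_scope.
Implicit Types (lam E : R).

Lemma periodic_sum (A : nat -> R) p k : (forall i, A (i + p)%N = A i) ->
  \sum_(0 <= i < k * p) A i = k%:R * \sum_(0 <= i < p) A i.
Proof.
move=> per; elim: k => [|k IH]; first by rewrite mul0n big_nil mul0r.
have perk i : A (i + k * p)%N = A i.
  elim: k {IH} => [|k IH]; first by rewrite mul0n addn0.
  by rewrite mulSn addnCA addnC per.
rewrite mulSn addnC (big_cat_nat (n := (k * p)%N)) ?leq_addr //= IH -natr1 mulrDl mul1r.
congr (_ + _); rewrite -{1}[(k * p)%N]add0n big_addn addKn.
by apply: eq_bigr => i _; rewrite perk.
Qed.

(** Truncated subtraction makes the weight 0 from 2 p on. *)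
Definition tent_weight (p i : nat) : R := (minn i (p + p - i))%:R.

Definition tent (s : int) p (c : nat -> R) (j : int) : R :=
  if s <= j then tent_weight p (absz (j - s)) * c (absz (j - s)) else 0.

(** Where c solves the equation, only the increments of the weight remain, and these are at most 1:
    the error is bounded by neighbouring values of c, independently of the height p. *)
Lemma tent_cutoff (V : int -> R) E (s : int) p (p0 : (0 < p)%N) v c (f := tent s p c) :
  (forall i, (i < p + p)%N -> V (s + i.+1%:Z) = v i) ->
  (forall i, c i.+2 = (E - v i) * c i.+1 - c i) ->
  [/\ forall j, ~~ (s <= j < s + (p + p).+1%:Z) ->
        f (j - 1) + f (j + 1) + V j * f j - E * f j = 0,
      forall i, (i < (p + p).+1)%N ->
        (f (s + i%:Z - 1) + f (s + i%:Z + 1) + V (s + i%:Z) * f (s + i%:Z)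
           - E * f (s + i%:Z)) ^+ 2 <=
        2 * c i.+1 ^+ 2 + 2 * (if i is k.+1 then c k else 0) ^+ 2,
      forall j, ~~ (s <= j < s + (p + p).+1%:Z) -> f j = 0
    & forall i : nat, f (s + i%:Z) = tent_weight p i * c i].
Proof.
move=> Vv cS.
have fE (i : nat) : f (s + i%:Z) = tent_weight p i * c i.
  by rewrite /f /tent lerDl (addrC s) addrK.
have w0 i : (p + p <= i)%N -> tent_weight p i = 0.
  by move=> hi; rewrite /tent_weight (_ : (p + p - i)%N = 0%N) ?minn0 //; lia.
have fhigh j : s + (p + p)%:Z <= j -> f j = 0.
  move=> hj; have [i ei] : exists i : nat, j = s + i%:Z by exists (absz (j - s)%R); lia.
  by rewrite ei fE w0 ?mul0r //; lia.
have flow j : j <= s -> f j = 0.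
  rewrite /f /tent => hj; case: ifP => // hj'.
  have -> : j - s = 0 by lia.
  by rewrite /tent_weight min0n mul0r.
have lip i : -1 <= tent_weight p i.+1 - tent_weight p i <= 1.
  rewrite /tent_weight; have h1 : (minn i.+1 (p + p - i.+1) <= (minn i (p + p - i)).+1)%N by lia.
  have h2 : (minn i (p + p - i) <= (minn i.+1 (p + p - i.+1)).+1)%N by lia.
  by move: h1 h2; rewrite -!(ler_nat R) -!natr1; lra.
split=> //.
- move=> j hj; have [h|h] := lerP (s + (p + p).+1%:Z) j.
    by rewrite !fhigh; [ring|lia..].
  by rewrite !flow; [ring|lia..].
- case=> [_|i hi].
    rewrite addr0 (flow (s - 1)) ?(flow s); [|lia..].
    rewrite (fE 1%N) /tent_weight (_ : minn 1 _ = 1%N); last by lia.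
    by have := sqr_ge0 (c 1%N); rewrite expr0n /=; nra.
  have -> : s + i.+1%:Z - 1 = s + i%:Z by lia.
  have -> : s + i.+1%:Z + 1 = s + i.+2%:Z by lia.
  rewrite !fE Vv // cS.
  have /andP[l1 l2] := lip i; have /andP[l3 l4] := lip i.+1.
  move: (tent_weight p i) (tent_weight p i.+1) (tent_weight p i.+2) l1 l2 l3 l4.
  move=> x y z l1 l2 l3 l4; set q := (E - v i) * c i.+1 - c i.
  have -> : x * c i + z * q + v i * (y * c i.+1) - E * (y * c i.+1) =
      (x - y) * c i + (z - y) * q by rewrite /q; ring.
  have e1 : ((x - y) * c i) ^+ 2 <= c i ^+ 2.
    by rewrite exprMn ler_piMl ?sqr_ge0 //; nra.
  have e2 : ((z - y) * q) ^+ 2 <= q ^+ 2.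
    by rewrite exprMn ler_piMl ?sqr_ge0 //; nra.
  by have := sqr_ge0 ((x - y) * c i - (z - y) * q); nra.
- move=> j hj; have [h|h] := lerP (s + (p + p).+1%:Z) j; first by apply: fhigh; lia.
  by apply: flow; lia.
Qed.

Lemma resolvent_lower_bound T (z : R[i]) : resolvent_set T z ->
  exists M : R, forall psi (a b : R) m n, l2 psi ->
    a <= isum (fun k => abs_sq (psi k)) m n ->
    (forall m n, isum (fun k => abs_sq ((T psi - z *: psi) k)) m n <= b) ->
    a <= M ^+ 2 * b.
Proof.
case=> B [BT _ [M hM]] hB; exists M => psi a b m n lpsi ha hb.
have lphi : l2 (T psi - z *: psi) := l2_isum hb.
have := hM _ lphi; have [-> _] := hB _ lpsi => h.
have b0 : 0 <= b by apply: le_trans (hb 0 0%N); rewrite /isum big_nil.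
have n0 : 0 <= l2norm psi by exact: sqrtr_ge0.
have : l2norm psi ^+ 2 <= (M * l2norm (T psi - z *: psi)) ^+ 2.
  by rewrite lerXn2r // nnegrE // (le_trans n0 h).
rewrite exprMn !sqr_sqrtr ?fine_ge0 ?l2sq_ge0 // => h2.
apply: le_trans (le_trans ha (isum_le_l2sq _ _ lpsi)) _.
apply: le_trans h2 _; rewrite ler_wpM2l ?sqr_ge0 // -lee_fin -l2sq_fin //.
exact: l2sq_le.
Qed.

(* On an occurrence of [fib_word k ++ fib_word k] of sieved length [2 p], a Floquet
   solution times a tent of height [p] has squared norm at least [p^2 S / 2], and its
   image under [H - E] has squared norm at most [12 S]. *)
Lemma sieved_spectrum_of_trace lam n (w : int -> bool) E : fib_subshift w ->
  (forall N, exists2 k, (N <= k)%N & `|sieved_trace E lam n.+1 k.+2| <= 1) ->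
  sieved_spectrum lam n.+1 w E.
Proof.
move=> hw htr /resolvent_lower_bound [M hM].
(* The estimates below give p^2 <= 24 M^2, against p^2 >= p >= k > 24 M^2. *)
have [k kM trk] := htr (Num.bound (24 * M ^+ 2)).+1.
have kM2 : 24 * M ^+ 2 < k%:R.
  apply: lt_le_trans (archi_boundP _) _; first by rewrite mulr_ge0 // sqr_ge0.
  by rewrite ler_nat; exact: ltnW.
have szk := size_fib_word k; have k1 : (0 < k)%N by apply: leq_ltn_trans kM.
set u := fib_word k in szk; pose p := (n.+1 * size u)%N.
have kp : (k < p)%N by rewrite /p; nia.
have p2 : (1 < p)%N by apply: leq_ltn_trans kp.
have p0 : (0 < p)%N by exact: ltnW.
have [s0 hs] := fib_subshift_square k hw; rewrite -/u in hs.
pose v i := word_potential lam n.+1 u (i %% p).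
have two : (2 : R) != 0 by rewrite pnatr_eq0.
have [a [b [aS bS per ab0]]] := @floquet_solution R v E lam n u _
  (leq_ltn_trans (leq0n _) szk) (fun i hi => congr1 _ (modn_small hi))
  (fun i => congr1 _ (modnDr _ _)) (tr2_fib_word E lam n k two) trk.
rewrite -/p in per.
pose A i := a i ^+ 2 + b i ^+ 2.
have A0 i : 0 <= A i by rewrite addr_ge0 ?sqr_ge0.
pose S := \sum_(0 <= i < p) A i.
have S0 : 0 < S.
  rewrite /S -(subnKC p2) big_nat_recl // big_nat_recl //=.
  rewrite addrA; apply: (lt_le_trans ab0); rewrite lerDl.
  by apply: sumr_ge0.
have sumA q c : (q <= c * p)%N -> \sum_(0 <= i < q) A i <= c%:R * S.
  move=> hq; rewrite -periodic_sum //.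
  rewrite [leRHS](big_cat_nat (n := q)) //= lerDl; exact: sumr_ge0.
(* One site before the square: the tent vanishes at s. *)
pose s : int := n.+1%:Z * s0 - 1.
pose V := sieved_potential lam n.+1 w.
have Vv i : (i < p + p)%N -> V (s + i.+1%:Z) = v i.
  move=> hi; have -> : s + i.+1%:Z = n.+1%:Z * s0 + i%:Z by rewrite /s; lia.
  rewrite /V (@sieved_potential_window _ lam n w s0 (u ++ u) 0 (size (u ++ u))) //; last first.
    by rewrite size_cat mulnDr.
  rewrite muln0 add0n /v /word_potential.
  have [ip|ip] := ltnP i p.
    rewrite modn_small //; case: ifP => // /dvdnP[q e].
    by rewrite e mulnK // nth_cat ifT //; rewrite e /p mulnC ltn_mul2l in ip.
  have [j ej] : exists j, i = (j + p)%N by exists (i - p)%N; lia.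
  have jp : (j < p)%N by lia.
  rewrite ej modnDr modn_small // dvdn_addl ?dvdn_mulr //; case: ifP => // /dvdnP[q e].
  rewrite e /p (mulnC n.+1) -mulnDl !mulnK // nth_cat ltnNge leq_addl /=.
  by rewrite addnK.

have [ga0 gab fa0 fab] := tent_cutoff p0 Vv aS.
have [gb0 gbb fb0 fbb] := tent_cutoff p0 Vv bS.
set fa := tent s p a in ga0 gab fa0 fab; set fb := tent s p b in gb0 gbb fb0 fbb.
pose psi j : R[i] := Complex (fa j) (fb j).
have psiE j : abs_sq (psi j) = fa j ^+ 2 + fb j ^+ 2 by [].
have lpsi : l2 psi.
  apply: (@l2_isum _ _ (isum (fun j => abs_sq (psi j)) s (p + p).+1)) => m q.
  apply: isum_le_support => j; first exact: abs_sq_ge0.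
  by move=> hj; rewrite psiE fa0 // fb0 // expr0n addr0.
have shift (F : nat -> R) : \sum_(p <= i < p + p) F i = \sum_(0 <= i < p) F (i + p)%N.
  by rewrite -{1}[p]add0n big_addn addnK.
have h : p%:R ^+ 2 / 2 * S <= M ^+ 2 * (12 * S).
  apply: (hM psi _ _ s (p + p)%N lpsi) => [|m q].
    have -> : isum (fun j => abs_sq (psi j)) s (p + p) =
        \sum_(0 <= i < p + p) tent_weight p i ^+ 2 * A i.
      by apply: eq_bigr => i _; rewrite psiE fab fbb !exprMn -mulrDr.
    (* Sites i and i + p are paired: their weights are i and p - i, and i^2 + (p - i)^2 >= p^2 /
       2. *)
    rewrite (big_cat_nat (n := p)) ?leq_addr //= shift -big_split /=.
    rewrite /S mulr_sumr !big_mkord; apply: ler_sum => i _.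
    rewrite /A per -/(A i) -mulrDl ler_wpM2r //.
    have -> : tent_weight p i = i%:R :> R by rewrite /tent_weight (minn_idPl _) //; have := ltn_ord i; lia.
    have -> : tent_weight p (i + p)%N = p%:R - i%:R :> R.
      rewrite /tent_weight subnDr (minn_idPr _); last by have := ltn_ord i; lia.
      by rewrite natrB // ltnW.
    have := sqr_ge0 (i%:R - p%:R / 2 : R); lra.
  pose A' i := if i is j.+1 then A j else 0.
  apply: (le_trans (y := isum (fun k => abs_sq ((schrodinger V psi - E%:C *: psi) k)) s (p + p).+1)).
    apply: isum_le_support => j; first exact: abs_sq_ge0.
    move=> hj; rewrite /abs_sq schrodinger_Re schrodinger_Im /=.
    by have := ga0 j hj; have := gb0 j hj => -> ->; rewrite expr0n addr0.
  apply: (le_trans (y := \sum_(0 <= i < (p + p).+1) (2 * A i.+1 + 2 * A' i))).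
    rewrite /isum !big_mkord; apply: ler_sum => i _; rewrite /abs_sq schrodinger_Re schrodinger_Im /=.
    have := gab i (ltn_ord i); have := gbb i (ltn_ord i).
    by rewrite /A' /A; case: (nat_of_ord i) => [|j]; rewrite ?expr0n /=; lra.
  rewrite big_split /= -!mulr_sumr.
  have h1 : \sum_(0 <= i < (p + p).+1) A i.+1 <= 3 * S.
    apply: le_trans (sumA (p + p).+2 3 _); last by lia.
    by rewrite [leRHS]big_nat_recl //= lerDr.
  have h2 : \sum_(0 <= i < (p + p).+1) A' i <= 3 * S.
    by rewrite big_nat_recl //= add0r; apply: sumA; lia.
  lra.
have : p%:R ^+ 2 / 2 <= M ^+ 2 * 12.
  by rewrite -(ler_pM2r S0) -[leRHS]mulrA.
have kp' : k%:R <= p%:R :> R by rewrite ler_nat ltnW.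
have k1' : 1 <= p%:R :> R by rewrite ler1n.
have : p%:R <= p%:R ^+ 2 :> R by rewrite expr2 ler_peMr.
lra.
Qed.

End Weyl.

(** * Energies in the spectrum do not escape *)

Section Escape.
Context {R : realType}.
Implicit Types (E lam mu : R) (y : nat -> R).

Lemma cheb_continuous n : continuous (fun E : R => cheb E n).
Proof.
suff : continuous (fun E : R => cheb E n) /\ continuous (fun E : R => cheb E n.+1) by case.
elim: n => [|n [IH1 IH2]]; first by split=> x; exact: cvg_cst.
split=> // x; apply: cvgB; last exact: IH1.
by apply: cvgM; [exact: cvg_id|exact: IH2].
Qed.

Lemma sieved_trace_continuous lam l k : continuous (fun E => sieved_trace E lam l k).
Proof.
pose P k := continuous (fun E => sieved_trace E lam l k).
have P1 : P 1%N.
  move=> x; apply: cvgB; last exact: cheb_continuous.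
  apply: cvgM; last exact: cvg_cst.
  by apply: cvgM; [exact: cvg_id|exact: cheb_continuous].
have P2 : P 2%N.
  move=> x; apply: cvgB; first exact: P1.
  apply: cvgM; last exact: cvg_cst.
  by apply: cvgM; [exact: cvg_cst|exact: cheb_continuous].
suff : [/\ P k, P k.+1 & P k.+2] by case.
elim: k => [|k [h0 h1 h2]]; first by split=> // x; exact: cvg_cst.
split=> // x.
have -> : (fun E => sieved_trace E lam l k.+3) = (fun E => 2 * sieved_trace E lam l k.+2 *
    sieved_trace E lam l k.+1 - sieved_trace E lam l k).
  by apply: funext => E; exact: trace_orbitS.
apply: cvgB; last exact: h0.
apply: cvgM; last exact: h1.
by apply: cvgM; [exact: cvg_cst|exact: h2].
Qed.

(** |y_(i+3)| >= 2 |y_(i+1) y_(i+2)| - |y_i| > |y_(i+1) y_(i+2)|, which exceeds |y_(i+1)| and 1; so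
    the conditions persist. *)
Lemma escape_forever y m : trace_recurrence y ->
  1 < `|y m.+1| -> 1 < `|y m.+2| -> `|y m| < `|y m.+1 * y m.+2| ->
  forall k, (m < k)%N -> 1 < `|y k|.
Proof.
move=> hy h1 h2 h3 k hk; rewrite -(subnKC hk) addSn; move: (k - m.+1)%N => {hk}k.
have escape_step i : 1 < `|y i.+1| -> 1 < `|y i.+2| -> `|y i| < `|y i.+1 * y i.+2| ->
    1 < `|y i.+3| /\ `|y i.+1| < `|y i.+2 * y i.+3|.
  rewrite hy; set p := y i.+1; set q := y i.+2; set o := y i => a b c.
  rewrite normrM in c; rewrite normrM.
  have h := lerB_dist (2 * q * p) o.
  rewrite -[X in `|X| - _]mulrA !normrM normr_nat in h.
  have h4 : `|p| * `|q| < `|2 * q * p - o| by lra.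
  have p0 : 0 < `|p| by lra.
  have q0 : 0 < `|q| by lra.
  have pq : `|p| < `|p| * `|q| by rewrite ltr_pMr.
  have h5 : `|p| < `|2 * q * p - o| by lra.
  split; first lra.
  apply: (lt_trans h5); rewrite ltr_pMl //; lra.
suff H j : [/\ 1 < `|y (m + j).+1|, 1 < `|y (m + j).+2| &
    `|y (m + j)%N| < `|y (m + j).+1 * y (m + j).+2|] by have [] := H k.
elim: j => [|j [a b c]]; first by rewrite !addn0.
by rewrite !addnS; have [] := escape_step _ a b c.
Qed.

(** Escape is read off three traces by strict inequalities, so it is an open condition on the energy
    and yields one gap for all later k. *)
Lemma no_escape_of_spectrum lam n (w : int -> bool) E : fib_subshift w ->
  sieved_spectrum lam n.+1 w E -> no_escape (sieved_trace E lam n.+1).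
Proof.
move=> hw spec m [h1 h2 h3]; apply: spec.
have near1 k : 1 < `|sieved_trace E lam n.+1 k| ->
    \forall mu \near E, 1 < `|sieved_trace mu lam n.+1 k|.
  move=> h; have : (fun mu => `|sieved_trace mu lam n.+1 k|) @ E --> `|sieved_trace E lam n.+1 k|.
    by apply: cvg_norm; exact: sieved_trace_continuous.
  by move=> /cvgr_gt /(_ _ h).
have near2 : \forall mu \near E,
    0 < `|sieved_trace mu lam n.+1 m.+1 * sieved_trace mu lam n.+1 m.+2| - `|sieved_trace mu lam n.+1 m|.
  have : (fun mu => `|sieved_trace mu lam n.+1 m.+1 * sieved_trace mu lam n.+1 m.+2| - `|sieved_trace mu lam n.+1 m|) @ E
    --> `|sieved_trace E lam n.+1 m.+1 * sieved_trace E lam n.+1 m.+2| - `|sieved_trace E lam n.+1 m|.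
    apply: cvgB; last by apply: cvg_norm; exact: sieved_trace_continuous.
    by apply: cvg_norm; apply: cvgM; exact: sieved_trace_continuous.
  by move=> /cvgr_gt; apply; rewrite subr_gt0.
have : \forall mu \near E, forall k, (m < k)%N -> 1 < `|sieved_trace mu lam n.+1 k|.
  near=> mu; apply: escape_forever.
  - exact: sieved_trace_recurrence.
  - by near: mu; exact: near1.
  - by near: mu; exact: near1.
  - by rewrite -subr_gt0; near: mu; exact: near2.
move=> /nbhs_ballP [e /= e0 he].
apply: (@locally_solvable_resolvent _ _ _ (e ^- 2)); first by rewrite invr_ge0 exprn_ge0 // ltW.
apply: (@sieved_locally_solvable _ lam n w E e m.+1 hw e0) => mu hmu k hk.
by apply: he => //; rewrite /ball /= distrC.
Unshelve. all: by end_near. Qed.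

End Escape.

Section Crossing.
Context {R : realType}.
Implicit Types (f : R -> R).

(** b' is the first point where f reaches v, and a' the last point before it where f equals u, found
    as a first hit of x |-> - f (- x). *)
Let crossing_up f (a b u v : R) : continuous f -> a <= b -> u <= v ->
  f a <= u -> v <= f b ->
  exists a' b', [/\ a <= a', a' <= b', b' <= b, f a' = u /\ f b' = v &
    forall x, a' <= x <= b' -> u <= f x <= v].
Proof.
move=> cf ab uv fa fb.
have first_hit (g : R -> R) (c d t : R) : continuous g -> c <= d -> g c <= t -> t <= g d ->
    exists2 e, c <= e <= d & g e = t /\ forall x, c <= x -> x < e -> g x < t.
  move=> cg cd gc gd; pose S := [set x | c <= x <= d /\ t <= g x].
  have Sd : S d by split=> //; rewrite cd lexx.
  have lbS : lbound S c by move=> x [/andP[]].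
  have hS : has_inf S by split; [exists d|exists c].
  have ci : c <= inf S by apply: lb_le_inf => //; exists d.
  have id : inf S <= d by apply: ge_inf => //; exists c.
  have below x : c <= x -> x < inf S -> g x < t.
    move=> cx xi; rewrite ltNge; apply/negP => tx.
    have : inf S <= x.
      apply: ge_inf; first by exists c.
      by split=> //; rewrite cx (le_trans (ltW xi)).
    by rewrite leNgt xi.
  have ti : t <= g (inf S).
    rewrite leNgt; apply/negP => gi.
    have /cvgr_lt /(_ _ gi) /nbhs_ballP [e /= e0 he] := cg (inf S).
    have [x [cxd tx] xe] := inf_adherent e0 hS.
    have ix : inf S <= x by apply: ge_inf; [exists c|].
    have : g x < t by apply: he; rewrite /ball /= ler0_norm; lra.
    by rewrite ltNge tx.
  exists (inf S); [by rewrite ci|split=> //].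
  have [|e] := @IVT R g c (inf S) t ci (continuous_subspaceT cg).
    by rewrite ge_min le_max gc ti orbT.
  rewrite in_itv /= => /andP[ce ei] ge.
  have [->//|] : inf S = e \/ e < inf S.
    by move: ei; rewrite le_eqVlt => /orP[/eqP ->|]; [left|right].
  by move=> /(below _ ce); rewrite ge ltxx.
have [b' /andP[ab' bb'] [fb' lt_b']] := first_hit f a b v cf ab (le_trans fa uv) fb.
pose g x := - f (- x).
have cg : continuous g.
  move=> x; apply: cvgN; apply: (@continuous_comp _ _ _ -%R f); last exact: cf.
  exact: oppr_continuous.
have [|||e /andP[be ea] [ge lt_e]] := first_hit g (- b') (- a) (- u) cg.
- by rewrite lerN2.
- by rewrite /g opprK fb' lerN2.
- by rewrite /g opprK lerN2.
exists (- e), b'; split=> //; first by lra.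
- by lra.
- by split=> //; rewrite -[u]opprK -ge /g opprK.
move=> x /andP[x1 x2]; apply/andP; split.
  have [xe|xe] := ltrP (- x) e; last first.
    have -> : x = - e by lra.
    by rewrite -[u]opprK -ge /g opprK.
  have := lt_e (- x); rewrite /g opprK ltrN2 => h; apply: ltW; apply: h => //; lra.
have [xb|xb] := ltrP x b'; first by apply: ltW; apply: lt_b' => //; lra.
have -> : x = b' by lra.
by rewrite fb'.
Qed.

Lemma interval_crossing f (a b u v : R) : continuous f -> a <= b -> u <= v ->
  f a <= u /\ v <= f b \/ v <= f a /\ f b <= u ->
  exists a' b', [/\ a <= a', a' <= b', b' <= b,
    f a' = u /\ f b' = v \/ f a' = v /\ f b' = u &
    forall x, a' <= x <= b' -> u <= f x <= v].
Proof.
move=> cf ab uv [[fa fb]|[fa fb]].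
  have [a' [b' [h1 h2 h3 h4 h5]]] := crossing_up cf ab uv fa fb.
  by exists a', b'; split=> //; left.
have cg : continuous (fun x => - f x) by move=> x; apply: cvgN; exact: cf.
have [||| a' [b' [h1 h2 h3 [h4 h6] h5]]] := @crossing_up _ a b (- v) (- u) cg ab.
- by rewrite lerN2.
- by rewrite lerN2.
- by rewrite lerN2.
exists a', b'; split=> //; first by right; split; apply: oppr_inj.
by move=> x /h5; rewrite !lerN2 andbC.
Qed.

End Crossing.

(** * Positivity of the dimension *)

Section LipschitzOn.
Context {R : realFieldType}.
Implicit Types (f g : R -> R) (c d : R).

(** One constant bounds both the values and the variation, so the property is stable under
    products. *)
Definition lipschitz_on c d f := exists2 L, 1 <= L & forall E E',
  c <= E <= d -> c <= E' <= d -> `|f E| <= L /\ `|f E - f E'| <= L * `|E - E'|.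

Lemma lipschitz_on_cst c d (k : R) : lipschitz_on c d (fun=> k).
Proof.
exists (1 + `|k|) => [|E E' _ _]; first by rewrite lerDl.
by rewrite subrr normr0 lerDr; split=> //; rewrite mulr_ge0 // addr_ge0.
Qed.

Lemma lipschitz_on_id c d : lipschitz_on c d id.
Proof.
exists (1 + (`|c| + `|d|)) => [|E E' /andP[h1 h2] _]; first by rewrite lerDl addr_ge0.
split; last by rewrite ler_peMl // lerDl addr_ge0.
rewrite ler_norml; have := ler_norm (- c); rewrite normrN; have := ler_norm d.
by have := normr_ge0 c; have := normr_ge0 d; lra.
Qed.

Lemma lipschitz_onB c d f g : lipschitz_on c d f -> lipschitz_on c d g ->
  lipschitz_on c d (fun x => f x - g x).
Proof.
move=> [L L1 hf] [M M1 hg]; exists (L + M) => [|E E' hE hE']; first lra.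
have [f1 f2] := hf _ _ hE hE'; have [g1 g2] := hg _ _ hE hE'.
split; first by have := ler_normB (f E) (g E); lra.
have -> : f E - g E - (f E' - g E') = (f E - f E') - (g E - g E') by ring.
by have := ler_normB (f E - f E') (g E - g E'); lra.
Qed.

Lemma lipschitz_onM c d f g : lipschitz_on c d f -> lipschitz_on c d g ->
  lipschitz_on c d (fun x => f x * g x).
Proof.
move=> [L L1 hf] [M M1 hg]; exists (2 * (L * M)) => [|E E' hE hE']; first nra.
have [f1 f2] := hf _ _ hE hE'; have [g1 g2] := hg _ _ hE hE'.
have [g1' _] := hg _ _ hE' hE.
have LM : 0 <= L * M by nra.
split; first by rewrite normrM; apply: (le_trans (ler_pM _ _ f1 g1)) => //; lra.
apply: le_trans (normM_sub_le _ _ _ _) _.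
have h1 : `|f E - f E'| * `|g E'| <= L * `|E - E'| * M by apply: ler_pM.
have h2 : `|f E| * `|g E - g E'| <= L * (M * `|E - E'|) by apply: ler_pM.
lra.
Qed.

Lemma lipschitz_on_cheb c d n : lipschitz_on c d (fun E => cheb E n).
Proof.
suff : lipschitz_on c d (fun E => cheb E n) /\ lipschitz_on c d (fun E => cheb E n.+1) by case.
elim: n => [|n [h1 h2]]; first by split; exact: lipschitz_on_cst.
split=> //; apply: lipschitz_onB => //; apply: lipschitz_onM => //.
exact: lipschitz_on_id.
Qed.

Lemma lipschitz_on_half_trace0 c d l : lipschitz_on c d (fun E => half_trace0 E l).
Proof.
apply: lipschitz_onB; last exact: lipschitz_on_cheb.
apply: lipschitz_onM; last exact: lipschitz_on_cst.
by apply: lipschitz_onM; [exact: lipschitz_on_id|exact: lipschitz_on_cheb].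
Qed.

Lemma lipschitz_on_half_trace1 c d lam l : lipschitz_on c d (fun E => half_trace1 E lam l).
Proof.
apply: lipschitz_onB; first exact: lipschitz_on_half_trace0.
apply: lipschitz_onM; last exact: lipschitz_on_cst.
by apply: lipschitz_onM; [exact: lipschitz_on_cst|exact: lipschitz_on_cheb].
Qed.

(** In the recurrence the product contributes a factor 2 (B + B) and the subtracted term 1. *)
Lemma trace_dist_growth (y y' : nat -> R) B L : trace_recurrence y -> trace_recurrence y' ->
  1 <= B -> 0 <= L -> (forall k, `|y k| <= B) -> (forall k, `|y' k| <= B) ->
  (forall k, (k <= 2)%N -> `|y k - y' k| <= L) ->
  forall k, `|y k - y' k| <= L * (4 * B + 1) ^+ k.
Proof.
move=> hy hy' B1 L0 yB yB' init k; set G := 4 * B + 1.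
have G1 : 1 <= G by rewrite /G; lra.
have Gk j : 1 <= G ^+ j by exact: exprn_ege1.
have base j : (j <= 2)%N -> `|y j - y' j| <= L * G ^+ j.
  by move=> /init h; apply: (le_trans h); rewrite ler_peMr.
suff : [/\ `|y k - y' k| <= L * G ^+ k, `|y k.+1 - y' k.+1| <= L * G ^+ k.+1 &
   `|y k.+2 - y' k.+2| <= L * G ^+ k.+2] by case.
elim: k => [|k [h0 h1 h2]]; first by split; exact: base.
split=> //; rewrite hy hy'.
have e1 := normM_sub_le (y k.+2) (y k.+1) (y' k.+2) (y' k.+1).
have e2 : `|y k.+2 - y' k.+2| * `|y' k.+1| <= L * G ^+ k.+2 * B by apply: ler_pM.
have e3 : `|y k.+2| * `|y k.+1 - y' k.+1| <= B * (L * G ^+ k.+2).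
  apply: ler_pM => //; apply: (le_trans h1); rewrite ler_wpM2l // [leRHS]exprS ler_peMl //.
  by have := Gk k.+1; lra.
have e4 : `|y k - y' k| <= L * G ^+ k.+2.
  apply: (le_trans h0); rewrite ler_wpM2l // -addn2 exprD ler_peMr //.
    by have := Gk k; lra.
rewrite -!mulrA (_ : _ - _ - _ = 2 * (y k.+2 * y k.+1 - y' k.+2 * y' k.+1) - (y k - y' k)); last by ring.
apply: le_trans (ler_normB _ _) _; rewrite normrM normr_nat exprS.
have -> : L * (G * G ^+ k.+2) = 4 * (B * (L * G ^+ k.+2)) + L * G ^+ k.+2 by rewrite /G; ring.
lra.
Qed.

End LipschitzOn.

Section PositiveDimension.
Context {R : realType}.
Variables (lam : R) (n : nat).
Hypothesis lam4 : 4 < lam.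

Let y E := sieved_trace E lam n.+1.
Let W E := lam * cheb E n.+1 / 2.
Let K : set R := [set E | lam - 2 <= E <= lam + 2].

Let y_rec E : trace_recurrence (y E).
Proof. exact: sieved_trace_recurrence. Qed.

Let W_ge E : K E -> lam / 2 <= W E.
Proof.
move=> /andP[h _]. have l4 := lam4; have E2 : 2 <= E by lra.
have : lam * 1 <= lam * cheb E n.+1 by rewrite ler_wpM2l ?cheb_ge1 //; lra.
rewrite /W; lra.
Qed.

Let fr E k : fricke (y E k) (y E k.+1) (y E k.+2) = W E ^+ 2.
Proof. by rewrite fricke_trace_recurrence // sieved_fricke. Qed.

Let fr' E k : fricke (y E k) (y E k.+2) (y E k.+1) = W E ^+ 2.
Proof. by rewrite -(fr E k) /fricke; ring. Qed.

(** Both bounds come from (c - ab)^2 = W^2 + (1 - a^2)(1 - b^2), which lies between W^2 and (W +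
    1)^2. *)
Let middle E k : K E -> `|y E k| <= 1 -> `|y E k.+2| <= 1 ->
  lam / 2 - 1 <= `|y E k.+1| <= W E + 2.
Proof.
have l4 := lam4; move=> hE h0 h2; have hW := W_ge hE; have W0 : 0 <= W E by lra.
have := fricke_large W0 (fr' E k) h0 h2 => h; apply/andP; split; first lra.
have ab := normM_le1 h0 h2.
have sq : `|y E k.+1 - y E k * y E k.+2| ^+ 2 <= (W E + 1) ^+ 2.
  rewrite real_normK ?num_real //; have := fr' E k; rewrite /fricke => e.
  move/ler_normlP: h0 => [a1 a2]; move/ler_normlP: h2 => [b1 b2].
  have ha : 0 <= y E k ^+ 2 <= 1 by rewrite sqr_ge0 /=; nra.
  have hb : 0 <= y E k.+2 ^+ 2 <= 1 by rewrite sqr_ge0 /=; nra.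
  have : (1 - y E k ^+ 2) * (1 - y E k.+2 ^+ 2) <= 1 by nra.
  nra.
rewrite ler_pXn2r ?nnegrE // in sq; last by lra.
have := lerB_dist (y E k.+1) (y E k * y E k.+2); lra.
Qed.

Let node m a b := [/\ lam - 2 <= a, a <= b, b <= lam + 2,
  forall E, a <= E <= b -> `|y E m.*2| <= 1 /\ `|y E m.*2.+2| <= 1 &
  y a m.*2.+2 <= -1 /\ 1 <= y b m.*2.+2 \/ 1 <= y a m.*2.+2 /\ y b m.*2.+2 <= -1].

(* With [f], [k], [p] the traces at times [2m+2], [2m+1], [2m], the trace at time
   [2m+4] is [(4 f^2 - 1) k - 2 f p]: it equals [- k] at [f = 0] and [3 k -+ 2 p] at
   [f = +-1], so it crosses [[-1, 1]] on each of the two halves of the interval. *)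
Let child m a b (t : bool) : node m a b -> exists a' b',
  [/\ a <= a', b' <= b, node m.+1 a' b' &
    forall E, a' <= E <= b' -> if t then 0 <= y E m.*2.+2 else y E m.*2.+2 <= 0].
Proof.
have l4 := lam4; move=> [ha ab hb hab ends].
have cy k : continuous (fun E => y E k) by exact: sieved_trace_continuous.
pose u : R := if t then 0 else -1; pose v : R := if t then 1 else 0.
have [|| a1 [b1 [aa1 ab1 bb1 e1 r1]]] := @interval_crossing R (y^~ m.*2.+2) a b u v (cy _) ab.
- by rewrite /u /v; case: (t); lra.
- by rewrite /u /v; case: (t); lra.
pose k E := y E m.*2.+1; pose f E := y E m.*2.+2; pose p E := y E m.*2.
have sub E : a1 <= E <= b1 -> a <= E <= b by move=> /andP[h1 h2]; apply/andP; lra.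
have kl E : a1 <= E <= b1 -> 1 < `|k E|.
  move=> /sub hE; have [p1 f1] := hab _ hE.
  have KE : K E by move/andP: hE => [h1 h2]; apply/andP; lra.
  by have /andP[] := middle KE p1 f1; rewrite /k; lra.
have Ia : a1 <= a1 <= b1 by rewrite lexx.
have Ib : a1 <= b1 <= b1 by rewrite lexx andbT.
(* |k| > 1 on the interval, so k has no zero there and keeps its sign. *)
have ksign : 1 < k a1 /\ 1 < k b1 \/ k a1 < -1 /\ k b1 < -1.
  have ka := kl _ Ia; have kb := kl _ Ib.
  have no0 : ~ (Num.min (k a1) (k b1) <= 0 <= Num.max (k a1) (k b1)).
    move=> h; have [c] := IVT ab1 (continuous_subspaceT (cy m.*2.+1)) h.
    by rewrite in_itv /= => /kl hc e; move: hc; rewrite /k e normr0 ltr10.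
  move: no0 ka kb; rewrite ge_min le_max !ltr_normr.
  move=> h /orP[x1|x1] /orP[x2|x2]; [by left| exfalso; apply: h | exfalso; apply: h |by right; lra].
    by clear l4 ha ab hb aa1 bb1; apply/andP; split; apply/orP; [right|left]; lra.
  by clear l4 ha ab hb aa1 bb1; apply/andP; split; apply/orP; [left|right]; lra.
have gE E : y E m.*2.+4 = 4 * f E ^+ 2 * k E - 2 * f E * p E - k E.
  by rewrite !y_rec /f /k /p; ring.
have pb E : a1 <= E <= b1 -> -1 <= p E <= 1.
  by move=> /sub /hab [+ _]; rewrite ler_norml.
have pa := pb _ Ia; have pb1 := pb _ Ib.
have ends1 : (y a1 m.*2.+4 <= -1 /\ 1 <= y b1 m.*2.+4) \/ (1 <= y a1 m.*2.+4 /\ y b1 m.*2.+4 <= -1).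
  rewrite !gE /f; move: e1; rewrite /u /v.
  by case: (t) => -[[-> ->]|[-> ->]]; case: ksign => -[x1 x2];
    rewrite ?expr0n ?expr1n ?sqrrN ?expr1n /=; [left|right|right|left|right|left|left|right]; clear l4 ha ab hb aa1 ab1 bb1; lra.
have [|| a' [b' [aa' ab' bb' e' r']]] := @interval_crossing R (y^~ m.*2.+4) a1 b1 (-1) 1 (cy _) ab1.
- by lra.
- by [].
exists a', b'; split; [exact: le_trans aa1 aa'|exact: le_trans bb' bb1| |].
  split; rewrite ?doubleS; [exact: le_trans ha (le_trans aa1 aa')|by []|exact: le_trans bb' (le_trans bb1 hb)| |].
    move=> E hE; split; last by rewrite ler_norml; exact: r'.
    have /andP[h1 h2] := hE; have [|//] := hab E.
    by rewrite (le_trans aa1 (le_trans aa' h1)) (le_trans h2 (le_trans bb' bb1)).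
  by case: e' => -[-> ->]; [left|right].
move=> E /andP[h1 h2]; have : a1 <= E <= b1 by rewrite (le_trans aa' h1) (le_trans h2 bb').
by move=> /r1 /andP[]; rewrite /u /v; case: (t).
Qed.

Let X : set R := [set E | K E /\ forall m, `|y E m.*2| <= 1].

Let realize (sigma : nat -> bool) : exists2 E, X E &
  forall m, if sigma m then 0 <= y E m.*2.+2 else y E m.*2.+2 <= 0.
Proof.
have l4 := lam4.
have root : exists p : R * R, node 0 p.1 p.2.
  have E2 : 2 <= lam + 2 by lra.
  have E2' : 2 <= lam - 2 by lra.
  have [c0 c1] := cheb_increment n E2; have [c0' c1'] := cheb_increment n E2'.
  have cy2 : continuous (fun E => y E 2) by exact: sieved_trace_continuous.
  have [|||a [b [h1 h2 h3 h4 h5]]] := @interval_crossing R (fun E => y E 2) (lam - 2) (lam + 2) (-1) 1 cy2.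
  - by lra.
  - by lra.
  (* At lam -+ 2 the half-trace is [-+ cheb E n.+1 - cheb E n]; [cheb_increment] bounds it away from
     (-1, 1). *)
  - left; rewrite /y /sieved_trace !trace_orbit2 /half_trace1 /half_trace0 /=.
    by split; lra.
  exists (a, b); split=> //=.
    move=> E /h5; rewrite -ler_norml => h; split=> //.
    by rewrite /y /sieved_trace trace_orbit0 normr1.
  by case: h4 => -[-> ->]; [left|right].
have [r0 hr0] := root.
have /boolp.choice[F hF] : forall q : nat * (R * R) * bool, exists p : R * R,
    node q.1.1 q.1.2.1 q.1.2.2 -> [/\ q.1.2.1 <= p.1, p.2 <= q.1.2.2, node q.1.1.+1 p.1 p.2 &
    forall E, p.1 <= E <= p.2 -> if q.2 then 0 <= y E q.1.1.*2.+2 else y E q.1.1.*2.+2 <= 0].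
  move=> [[m [a b]] t] /=; have [h|h] := pselect (node m a b); last by exists (0, 0).
  by have [a' [b' h']] := child t h; exists (a', b').
pose st := fix st m := if m is j.+1 then F (j, st j, sigma j) else r0.
have nst m : node m (st m).1 (st m).2.
  elim: m => // m IH; by have [_ _] := hF (m, st m, sigma m) IH.
have mono i j : (st i).1 <= (st (i + j)%N).1 /\ (st (i + j)%N).2 <= (st i).2.
  elim: j => [|j [h1 h2]]; first by rewrite addn0.
  rewrite addnS; have [h3 h4 _ _] := hF (_, _, sigma (i + j)%N) (nst (i + j)%N).
  by split; [exact: le_trans h1 h3|exact: le_trans h4 h2].
have ab i j : (st i).1 <= (st j).2.
  have [h1 _] := mono i j; have [_ h2] := mono j i; rewrite addnC in h2.
  have [_ h3 _ _ _] := nst (i + j)%N.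
  exact: le_trans h1 (le_trans h3 h2).
pose S := [set (st m).1 | m in [set: nat]].
have hS : has_sup S.
  by split; [exists (st 0%N).1; exists 0%N|exists (st 0%N).2 => _ [i _ <-]; exact: ab].
have inst m : (st m).1 <= sup S <= (st m).2.
  apply/andP; split; first by apply: sup_upper_bound => //; exists m.
  by apply: sup_le_ub => [|_ [i _ <-]]; [case: hS|exact: ab].
exists (sup S).
  split=> [|m]; last by have [_ _ _ h _] := nst m; have [] := h _ (inst m).
  have [h1 _ h2 _ _] := nst 0%N; have /andP[h3 h4] := inst 0%N.
  by apply/andP; split; [exact: le_trans h1 h3|exact: le_trans h4 h2].
by move=> m; have [_ _ _] := hF (m, st m, sigma m) (nst m); apply; exact: (inst m.+1).
Qed.

(** On X all traces are bounded by B and the even ones from time 2 on have modulus at least [delta].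
    Codes that differ at m thus force a distance 2 delta at time 2m + 2, and orbits separate by at
    most a factor G per step: this gives q = G^(-2). *)
Lemma sieved_dim_gt0 (w : int -> bool) : fib_subshift w ->
  (0 < hausdorff_dim (`[(lam - 2)%R, (lam + 2)%R] `&` sieved_spectrum lam n.+1 w))%E.
Proof.
move=> hw; have l4 := lam4.
have [L1 L11 hL1] := lipschitz_on_half_trace0 (lam - 2) (lam + 2) n.+1.
have [L2 L21 hL2] := lipschitz_on_half_trace1 (lam - 2) (lam + 2) lam n.+1.
have [L3 L31 hL3] := lipschitz_on_cheb (lam - 2) (lam + 2) n.+1.
pose B := lam * L3 + 2; pose L := L1 + L2.
have LL0 : 0 <= lam * L3 by apply: mulr_ge0; lra.
have B1 : 1 <= B by rewrite /B; lra.
have WB E : K E -> W E + 2 <= B.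
  move=> hE; have [h _] := hL3 E E hE hE; have := ler_norm (cheb E n.+1) => h'.
  have : lam * cheb E n.+1 <= lam * L3 by rewrite ler_wpM2l; lra.
  by rewrite /W /B; lra.
have yB E k : X E -> `|y E k| <= B.
  move=> [hE hX]; rewrite -[k]odd_double_half; case: (odd k); last first.
    by rewrite add0n; apply: le_trans (hX _) B1.
  have := hX (k./2.+1); rewrite doubleS => h2.
  by have /andP[_ h] := middle hE (hX k./2) h2; apply: le_trans h (WB _ hE).
(* From |2 y_(2m+3) y_(2m+2)| >= |y_(2m+1)| - |y_(2m+4)| >= (lam / 2 - 1) - 1. *)
pose delta := (lam / 2 - 2) / (2 * B).
have B20 : 0 < 2 * B by lra.
have delta0 : 0 < delta by rewrite divr_gt0 //; lra.
have far E m : X E -> delta <= `|y E m.*2.+2|.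
  move=> XE; have [hE hX] := XE.
  have h0 := hX m; have h2 := hX m.+1; have h4 := hX m.+2; rewrite !doubleS in h2 h4.
  have /andP[h1 _] := middle hE h0 h2.
  have h3 := yB E m.*2.+3 XE.
  rewrite y_rec in h4.
  have := lerB_dist (y E m.*2.+1) (2 * y E m.*2.+3 * y E m.*2.+2).
  rewrite distrC -mulrA !normrM normr_nat => h5.
  rewrite -mulrA in h4.
  rewrite /delta ler_pdivrMr //.
  have : `|y E m.*2.+3| * `|y E m.*2.+2| <= B * `|y E m.*2.+2| by rewrite ler_wpM2r.
  lra.
pose G := 4 * B + 1.
have G1 : 1 < G by rewrite /G; lra.
have G0 : 0 < G by lra.
have L0 : 0 < L by rewrite /L; lra.
apply: (@hausdorff_dim_gt0 R _ X (fun E m => 0 <= y E m.*2.+2) (2 * delta / (L * G ^+ 2)) (G ^- 2)).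
- by apply: divr_gt0; apply: mulr_gt0 => //; exact: exprn_gt0.
- by rewrite invr_gt0 exprn_gt0 //= invf_lt1 ?exprn_gt0 // exprn_egt1.
- move=> E [hE hX]; split; first by rewrite /= in_itv.
  apply: sieved_spectrum_of_trace => // N; exists N.*2; first by rewrite -addnn leq_addr.
  by have := hX N.+1; rewrite doubleS.
- move=> sigma; have [E XE hE] := realize sigma; exists E => // m.
  have := hE m; have := far E m XE; case: (sigma m) => // h1 h2.
  apply/negbTE; rewrite -ltNge lt_neqAle h2 andbT; apply: contraTneq h1 => ->.
  by rewrite normr0 -ltNge.
move=> E E' m XE XE' hne.
have grow : `|y E m.*2.+2 - y E' m.*2.+2| <= L * `|E - E'| * G ^+ m.*2.+2.
  apply: trace_dist_growth => //.
  - by rewrite mulr_ge0 // ltW.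
  - by move=> k; exact: yB.
  - by move=> k; exact: yB.
  have [hE _] := XE; have [hE' _] := XE'.
  have LD : 0 <= `|E - E'| by [].
  case=> [|[|[|//]]] _; rewrite /y /sieved_trace.
  - by rewrite !trace_orbit0 subrr normr0 mulr_ge0 // ltW.
  - rewrite !trace_orbit1; apply: le_trans (hL1 _ _ hE hE').2 _.
    by rewrite ler_wpM2r // /L; lra.
  - rewrite !trace_orbit2; apply: le_trans (hL2 _ _ hE hE').2 _.
    by rewrite ler_wpM2r // /L; lra.
have sep : 2 * delta <= `|y E m.*2.+2 - y E' m.*2.+2|.
  move: hne (far E m XE) (far E' m XE').
  move: (y E m.*2.+2) (y E' m.*2.+2) => p q.
  have [p0|p0] := lerP 0 p; have [q0|q0] := lerP 0 q => //= _.
    rewrite (ger0_norm p0) (ltr0_norm q0) => h1 h2.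
    by apply: le_trans (ler_norm _); lra.
  rewrite (ltr0_norm p0) (ger0_norm q0) => h1 h2.
  by rewrite distrC; apply: le_trans (ler_norm _); lra.
rewrite exprVn -exprM mul2n -mulrA -invfM ler_pdivrMr; last by apply: mulr_gt0; apply: mulr_gt0 || apply: exprn_gt0; rewrite ?exprn_gt0.
apply: le_trans sep (le_trans grow _).
have -> : G ^+ m.*2.+2 = G ^+ 2 * G ^+ m.*2 by rewrite -exprD.
by rewrite le_eqVlt; apply/orP; left; apply/eqP; ring.
Qed.

End PositiveDimension.

(** * The dimension tends to zero *)

Section DimensionLimit.
Context {R : realType}.
Implicit Types (lam s t rho : R).

(** Bernoulli's inequality at half the exponent, squared, grows quadratically. *)
Lemma linear_le_exp rho (A : R) : 1 < rho ->
  exists n0, forall n, (n0 <= n)%N -> A * (n%:R + 1) <= rho ^+ n.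
Proof.
move=> rho1; pose h := rho - 1; have h0 : 0 < h by rewrite /h; lra.
have bern m : 1 + m%:R * h <= rho ^+ m.
  elim: m => [|m IH]; first by rewrite mul0r addr0 expr0.
  have m0 : 0 <= m%:R * h ^+ 2 by rewrite mulr_ge0 // sqr_ge0.
  have : rho * (1 + m%:R * h) <= rho * rho ^+ m by rewrite ler_wpM2l //; lra.
  rewrite exprS -natr1 (_ : rho = 1 + h); last by rewrite /h; ring.
  lra.
pose B := 4 * `|A| / h ^+ 2; have h2 : 0 < h ^+ 2 by rewrite exprn_gt0.
have B0 : 0 <= B by rewrite divr_ge0 ?mulr_ge0 // ltW.
pose M := (Num.bound B).+1; exists M.*2 => n hn.
pose m := n./2; have Mm : (M <= m)%N by rewrite /m -(doubleK M) half_leq.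
have Bm : B <= m%:R.
  apply: ltW; apply: lt_le_trans (archi_boundP B0) _.
  by rewrite ler_nat; exact: ltnW.
have m1 : 1 <= m%:R :> R by rewrite ler1n; apply: leq_trans Mm.
have nm : n%:R + 1 <= 4 * m%:R :> R.
  have : (n <= m.*2.+1)%N by rewrite -{1}(odd_double_half n) -/m -addn1 addnC leq_add2l; case: odd.
  by rewrite -(ler_nat R) -natr1 -mul2n natrM; lra.
apply: (le_trans (y := (m%:R * h) ^+ 2)); last first.
  apply: (le_trans (y := (rho ^+ m) ^+ 2)).
    have := bern m; have mh : 0 <= m%:R * h by rewrite mulr_ge0 // ltW.
    by move=> hb; rewrite ler_pXn2r // ?nnegrE //; lra.
  rewrite -exprM muln2; apply: ler_weXn2l; first exact: ltW.
  by rewrite -[leqRHS](odd_double_half n) leq_addl.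
apply: (le_trans (y := `|A| * (4 * m%:R))).
  apply: (le_trans (y := `|A| * (n%:R + 1))); last by rewrite ler_wpM2l.
  by rewrite ler_wpM2r ?ler_norm // addr_ge0.
have : B * (h ^+ 2 * m%:R) <= m%:R * (h ^+ 2 * m%:R).
  by rewrite ler_wpM2r // mulr_ge0 // ltW.
have -> : B * (h ^+ 2 * m%:R) = 4 * `|A| * m%:R by rewrite /B mulrA divfK // gt_eqF.
lra.
Qed.

Lemma sieved_dim_le lam s : 4 < lam -> 0 < s ->
  exists n0, forall n, (n0 <= n)%N -> forall w : int -> bool, fib_subshift w ->
    (hausdorff_dim (`[(lam - 2)%R, (lam + 2)%R] `&` sieved_spectrum lam n.+1 w) <= s%:E)%E.
Proof.
move=> lam4 s0.
(* t^s = 1/5 is less than 1/4, so 4^N codes with diameters of order t^N have total weight of order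
   (4/5)^N. *)
pose t : R := 5^-1 `^ s^-1; pose r := t^-1.
have t0 : 0 < t by rewrite powR_gt0 // invr_gt0.
have ts : t `^ s = 5^-1 by rewrite /t -powRrM mulVf ?gt_eqF // powRr1 // invr_ge0.
have t1 : t < 1.
  rewrite ltNge; apply/negP => ht.
  have : (1 : R) `^ s <= t `^ s by apply: ge0_ler_powR; rewrite ?nnegrE // ltW.
  by rewrite powR1 ts; lra.
have r1 : 1 <= r by rewrite invf_ge1 // ltW.
(* The least value of E - 1 on K, which bounds the growth ratio of [cheb] from below. *)
pose rho := lam - 3; have rho1 : 1 < rho by rewrite /rho; lra.
have rho2 : 0 < rho ^+ 2 - 1 by rewrite subr_gt0 exprn_egt1.
pose beta := rho ^+ 2 / (rho ^+ 2 - 1).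
have beta0 : 0 <= beta by rewrite divr_ge0 ?sqr_ge0 // ltW.
have hbeta : rho ^+ 2 <= beta * (rho ^+ 2 - 1) by rewrite /beta divfK // gt_eqF.
(* The summands serve, in this order, the slope condition of [initial_estimate], the bound 40 with
   the 1 of [W - 1], and [r ^+ 2 <= W]. *)
have [n0 hn0] := linear_le_exp (2 * lam ^+ 2 * beta + 41 + r ^+ 2) rho1.
exists n0 => n hn w hw.
set A := `[_, _] `&` _.
pose y E := sieved_trace E lam n.+1.
pose W (E : R) := lam * cheb E n.+1 / 2.
have l20 : 0 <= lam ^+ 2 by exact: sqr_ge0.
have r20 : 0 <= r ^+ 2 by exact: sqr_ge0.
have big E : lam - 2 <= E -> [/\ 40 <= W E, r ^+ 2 <= W E &
    2 * lam ^+ 2 * (n%:R * beta) <= W E - 1].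
  move=> hE; have E2 : 2 <= E by lra.
  have c1 : rho ^+ n <= cheb E n.+1 by apply: cheb_exp_ge; rewrite /rho //; lra.
  have c0 : 1 <= cheb E n.+1 by exact: cheb_ge1.
  have Wc : rho ^+ n <= W E.
    apply: (le_trans c1); rewrite /W.
    have : 2 * cheb E n.+1 <= lam * cheb E n.+1 by rewrite ler_wpM2r //; lra.
    lra.
  have := hn0 n hn.
  have n0' : 0 <= n%:R :> R by [].
  have lb : 0 <= lam ^+ 2 * beta by exact: mulr_ge0.
  have nr : 0 <= n%:R * r ^+ 2 by exact: mulr_ge0.
  have nlb : 0 <= n%:R * (lam ^+ 2 * beta) by exact: mulr_ge0.
  by move=> h; split; lra.
have close N E E' : A E -> A E' -> E' <= E ->
    (forall j, (j <= N.+2)%N -> orbit_code (y E) j = orbit_code (y E') j) ->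
    `|E - E'| <= 4 * lam ^+ 2 * r * t ^+ N.
  move=> [KE sE] [KE' sE'] EE codes.
  move: KE KE'; rewrite /= !in_itv /= => /andP[E1 _] /andP[E1' _].
  have ne := no_escape_of_spectrum hw sE; have ne' := no_escape_of_spectrum hw sE'.
  (* As y_0 = 1 and y_1 > 1, a large y_2 would escape at time 0. *)
  have small F : lam - 2 <= F -> no_escape (y F) -> `|half_trace1 F lam n.+1| <= 1.
    move=> hF neF; rewrite leNgt; apply/negP => h; apply: (neF 0%N).
    rewrite /y /sieved_trace trace_orbit0 trace_orbit1 trace_orbit2 normr1.
    have C1 : 1 < `|half_trace0 F n.+1|.
      by apply: lt_le_trans (ler_norm _); apply: half_trace0_gt1; lra.
    by split=> //; rewrite normrM; apply: (lt_trans C1); rewrite ltr_pMr // (lt_trans ltr01).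
  have x1 := small _ E1 ne; have x1' := small _ E1' ne'.
  have [W40 Wr WL] := big _ E1; have [W40' Wr' WL'] := big _ E1'.
  have L0 : 0 <= n%:R * beta by exact: mulr_ge0.
  have E2' : 2 <= E' by lra.
  have lip : 0 <= cheb E n.+1 - cheb E' n.+1 <= n%:R * beta * (E - E') * cheb E n.+1.
    by apply: (cheb_lipschitz n E2' EE rho1 _ hbeta); rewrite /rho; lra.
  have [d1 d2] := initial_estimate lam4 E2' EE L0 lip WL' x1 x1'.
  have y1 F : lam - 2 <= F -> 1 < `|y F 1%N|.
    move=> hF; apply: lt_le_trans (ler_norm _).
    by rewrite /y /sieved_trace trace_orbit1; apply: half_trace0_gt1; lra.
  have y0 F : y F 0%N = 1 by rewrite /y /sieved_trace trace_orbit0.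
  have y2 F : y F 2%N = half_trace1 F lam n.+1 by rewrite /y /sieved_trace trace_orbit2.
  have exp := @orbit_expansion R (y E) (y E') (W E) (W E') r W40 W40' r1 Wr'
    (@sieved_trace_recurrence _ _ _ _) (@sieved_trace_recurrence _ _ _ _) ne ne'
    (sieved_fricke _ _ _) (sieved_fricke _ _ _).
  have := exp _ (y1 _ E1) _ _ _ N codes; rewrite !y0 !y2 normr1 subrr normr0.
  move=> /(_ (lexx _) x1 (normr_ge0 _) d2).
  set D := `|_ - half_trace1 E' lam n.+1| in d1 * => hD.
  rewrite ger0_norm ?subr_ge0 //; apply: (le_trans d1).
  have tr : t ^+ N * r ^+ N = 1 by rewrite -exprMn divff ?gt_eqF // expr1n.
  have hD' : D <= 2 * r * t ^+ N.
    have : t ^+ N * (r ^+ N * D) <= t ^+ N * (2 * r) by rewrite ler_wpM2l // exprn_ge0 // ltW.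
    by rewrite mulrA tr mul1r mulrC.
  have : 2 * lam ^+ 2 * D <= 2 * lam ^+ 2 * (2 * r * t ^+ N).
    by rewrite ler_wpM2l // mulr_ge0.
  lra.
apply: hausdorff_dim_le; first exact: ltW.
move=> delta eta delta0 eta0.
pose c := 4 * lam ^+ 2 * r.
have c0 : 0 < c.
  by apply: mulr_gt0; [apply: mulr_gt0 => //; apply: exprn_gt0|]; lra.
(* 64 = 4^3: the times 0, ..., N + 2 give 4^(N+3) codes. *)
have cs0 : 0 < 64 * c `^ s by rewrite mulr_gt0 // powR_gt0.
have [N [hN1 hN2]] : exists N, c * t ^+ N <= delta /\ 64 * c `^ s * (4 / 5) ^+ N <= eta.
  have lim (q k e : R) : 0 < q < 1 -> 0 < k -> 0 < e -> \forall N \near \oo, k * q ^+ N <= e.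
    move=> /andP[q0 q1] k0 e0.
    have : (fun N => q ^+ N) @ \oo --> (0 : R) by apply: cvg_expr; rewrite gtr0_norm.
    move=> /cvgr_lt /(_ (e / k)); rewrite divr_gt0 // => /(_ isT).
    by apply: filterS => N; rewrite ltr_pdivlMr // mulrC => /ltW.
  have q1 : 0 < t < 1 by rewrite t0.
  have q2 : 0 < (4 / 5 : R) < 1 by lra.
  have := filterI (lim _ _ _ q1 c0 delta0) (lim _ _ _ q2 cs0 eta0).
  by move=> [N _ /(_ N (leqnn N))] [h1 h2]; exists N.
pose T := {ffun 'I_N.+3 -> bool * bool}.
pose cd E : T := [ffun j : 'I_N.+3 => orbit_code (y E) j].
pose t00 : T := [ffun=> (true, true)].
exists #|T|, (fun i => A `&` [set E | cd E = nth t00 (enum T) i]), (c * t ^+ N).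
have cdj E j : (j <= N.+2)%N -> orbit_code (y E) j = cd E (inord j).
  by move=> hj; rewrite ffunE inordK.
split.
- by rewrite hN1 andbT mulr_ge0 ?exprn_ge0 // ltW.
- move=> E AE; exists (index (cd E) (enum T)); first by rewrite /= cardE index_mem mem_enum.
  by split=> //=; rewrite nth_index // mem_enum.
- move=> i E E' [AE /= e] [AE' /= e'].
  have same j : (j <= N.+2)%N -> orbit_code (y E) j = orbit_code (y E') j.
    by move=> hj; rewrite !cdj // e e'.
  have [EE|EE] := leP E' E; first exact: close.
  by rewrite distrC; apply: close => //; [exact: ltW|move=> j /same].
- apply: le_trans hN2; rewrite card_ffun card_ord card_prod card_bool natrX.
  rewrite (powRM s (ltW c0) (exprn_ge0 N (ltW t0))).
  have -> : (t ^+ N) `^ s = 5^-1 ^+ N.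
    by rewrite -(powR_mulrn N (ltW t0)) -powRrM mulrC powRrM ts powR_mulrn // invr_ge0.
  rewrite le_eqVlt; apply/orP; left; apply/eqP.
  rewrite exprMn -[N.+3]/(3 + N)%N exprD.
  by rewrite (_ : (2 * 2)%:R ^+ 3 = 64 :> R); [ring|rewrite -natrX].
Qed.

End DimensionLimit.

Theorem theorem1p7 (R : realType) (lam : R) (hlam : 4 < lam) :
  exists a b : R, a <= b /\
    forall w : int -> bool, fib_subshift w ->
      (forall l : nat, (0 < l)%N ->
         (0 < hausdorff_dim (`[a, b] `&` sieved_spectrum lam l w))%E) /\
      (hausdorff_dim (`[a, b] `&` sieved_spectrum lam l w) @[l --> \oo] --> 0%E).
Proof.
exists (lam - 2), (lam + 2); split; first lra.
move=> w hw; split; first by case=> // n _; exact: sieved_dim_gt0.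
have le (s : R) : 0 < s -> \forall l \near \oo,
    (hausdorff_dim (`[(lam - 2)%R, (lam + 2)%R] `&` sieved_spectrum lam l w) <= s%:E)%E.
  move=> s0; have [n0 hn0] := sieved_dim_le hlam s0.
  by exists n0.+1 => // -[|n] //= hn; exact: hn0.
have ge l : (0 <= hausdorff_dim (`[(lam - 2)%R, (lam + 2)%R] `&` sieved_spectrum lam l w))%E.
  exact: hausdorff_dim_ge0.
apply/fine_cvgP; split.
  have := le 1 ltr01; apply: filterS => l hl.
  by rewrite ge0_fin_numE //; apply: le_lt_trans hl _; rewrite ltry.
apply/cvgrPdist_le => e e0; have := le e e0; apply: filterS => l hl /=.
rewrite sub0r normrN ger0_norm ?fine_ge0 // -lee_fin fineK // ge0_fin_numE //.
by apply: le_lt_trans hl _; rewrite ltry.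
Qed.
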